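(* Let $n\in\mathbb N$, $\alpha>0$, $1<p<\infty$ and $\frac1p+\frac1{p'}=1$. Let $\mathcal{M}^n$ denote the set of holomorphic monomials $z\mapsto z^{\mathbf j}=z_1^{j_1}\cdots z_n^{j_n}$ on $\mathbb C^n$, $\mathbf j\in(\mathbb N\cup\{0\})^n$. Then \[ \sup_{g\in\mathcal{H}^n_{p,\alpha}\setminus\{0\}}\ \sup_{h\in\mathcal{M}^n}\mathcal{R}_{p,\alpha}(g,h)=C_p^{n/2}, \qquad \mathcal{R}_{p,\alpha}(g,h)=\frac{|\langle g,h\rangle_\alpha|}{\|g\|_{p,\alpha}\|h\|_{p',\alpha}}. \]
   Context: For $\alpha>0$ and $n\in\mathbb N$, $\gamma^n_\alpha(dz)=(\alpha/\pi)^n e^{-\alpha|z|^2}\lambda^n(dz)$ on $\mathbb C^n$, with $\lambda^n$ Lebesgue measure. For $1\le p<\infty$, $\mathcal{H}^n_{p,\alpha}$ is the space of holomorphic $f$ on $\mathbb C^n$ with $\|f\|_{p,\alpha}:=\left(\int|f|^p\,d\gamma^n_{\alpha p/2}\right)^{1/p}<\infty$ (monomials belong to every $\mathcal{H}^n_{p,\alpha}$). $\langle f,g\rangle_\alpha=\int f\overline{g}\,d\gamma^n_\alpha$. $C_p=2\,p^{-1/p}\,(p')^{-1/p'}$. *)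

(* Defs.v *)
From HB Require Import structures.
From mathcomp Require Import all_boot all_order all_algebra.
From mathcomp Require Import complex.
From mathcomp Require Import all_classical all_reals all_analysis.
Set Implicit Arguments. Unset Strict Implicit. Unset Printing Implicit Defensive.
Import Order.TTheory GRing.Theory Num.Theory.
Local Open Scope ring_scope.
Local Open Scope complex_scope.

Section Fock.
Variable R : realType.

Definition cabs (z : R[i]) : R := Num.sqrt (complex.Re z ^+ 2 + complex.Im z ^+ 2).

Definition ccons n (c : R[i]) (w : 'I_n -> R[i]) : 'I_n.+1 -> R[i] :=
  fun i => match unlift ord0 i with None => c | Some j => w j end.

Definition gdens (a x y : R) : R := (a / pi) * expR (- a * (x ^+ 2 + y ^+ 2)).

Fixpoint gintE (a : R) (n : nat) : (('I_n -> R[i]) -> \bar R) -> \bar R :=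
  match n with
  | 0 => fun F => F (fun _ => 0)
  | m.+1 => fun F =>
      (\int[@lebesgue_measure R]_x \int[@lebesgue_measure R]_y
         ((gdens a x y)%:E * gintE a (fun w => F (ccons (x +i* y) w))))%E
  end.

Fixpoint gintR (a : R) (n : nat) : (('I_n -> R[i]) -> R) -> R :=
  match n with
  | 0 => fun F => F (fun _ => 0)
  | m.+1 => fun F =>
      Rintegral (@lebesgue_measure R) setT (fun x =>
        Rintegral (@lebesgue_measure R) setT (fun y =>
          gdens a x y * gintR a (fun w => F (ccons (x +i* y) w))))
  end.

Definition gintC (a : R) (n : nat) (F : ('I_n -> R[i]) -> R[i]) : R[i] :=
  (gintR a (fun z => complex.Re (F z))) +i* (gintR a (fun z => complex.Im (F z))).

Definition shift_coord n (z : 'I_n -> R[i]) (i : 'I_n) (h : R[i]) : 'I_n -> R[i] :=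
  fun k => if k == i then z k + h else z k.

Definition holomorphic n (f : ('I_n -> R[i]) -> R[i]) : Prop :=
  (forall z (eps : R), 0 < eps -> exists2 delta : R, 0 < delta &
     forall w, (forall i, cabs (w i - z i) < delta) -> cabs (f w - f z) < eps)
  /\
  (forall z (i : 'I_n), exists c : R[i], forall eps : R, 0 < eps ->
     exists2 delta : R, 0 < delta & forall h : R[i],
       0 < cabs h < delta ->
       cabs (f (shift_coord z i h) - f z - c * h) <= eps * cabs h).

Definition pint (a p : R) n (f : ('I_n -> R[i]) -> R[i]) : \bar R :=
  gintE (a * p / 2) (fun z => ((cabs (f z)) `^ p)%:E).

Definition Hpa (a p : R) n (f : ('I_n -> R[i]) -> R[i]) : Prop :=
  holomorphic f /\ (pint a p f < +oo)%E.

Definition pnorm (a p : R) n (f : ('I_n -> R[i]) -> R[i]) : R :=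
  (fine (pint a p f)) `^ (p^-1).

Definition finner (a : R) n (f g : ('I_n -> R[i]) -> R[i]) : R[i] :=
  gintC a (fun z => f z * (g z)^*).

Definition monomial n (j : 'I_n -> nat) (z : 'I_n -> R[i]) : R[i] :=
  \prod_(i < n) z i ^+ j i.

Definition ratioR (a p p' : R) n (g h : ('I_n -> R[i]) -> R[i]) : R :=
  cabs (finner a g h) / (pnorm a p g * pnorm a p' h).

Definition Cp (p p' : R) : R := 2 * p `^ (- p^-1) * p' `^ (- p'^-1).

End Fock.

(* Main.v *)
(** Cauchy's theorem makes the circle averages of [Re (kappa g conj(z^j))] proportional
    to [|z_i|^(2 j_i)]. Averaging over the torus therefore reduces the pairing of [g] with
    [z^j] to a constant [c] times a product of Gaussian moments, while Jensen's inequality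
    bounds [|c|^p ||z^j||_p^p] by [||g||_p^p]: among all [g], the monomial itself is extremal.
    The quotient for [g = h = z^j] is a product of
      [R_k = Gamma(k+1) / (Gamma(pk/2+1)^(1/p) Gamma(p'k/2+1)^(1/p'))]
    up to powers of [p/2] and [p'/2]. Let [D x = ln Gamma(x+1) - (x ln x - x + ln x / 2)] be
    the error in Stirling's formula; then
      [ln R_k = D k - D(pk/2)/p - D(p'k/2)/p' + ln C_p / 2].
    The error [D] is convex and converges at infinity, since [D x - D (x+1)] is Binet's
    function, which is convex and summable. Hence [R_k <= C_p^(1/2)], with equality in the
    limit [k -> oo].
    The Gamma function only enters as a Gaussian moment, through its functional equation and
    its log-convexity. *)

Require Import Defs.
From HB Require Import structures.
From mathcomp Require Import all_boot all_order all_algebra.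
From mathcomp Require Import complex ring lra.
From mathcomp Require Import all_classical all_reals all_analysis.
From mathcomp Require Import measurable_realfun.
Set Implicit Arguments. Unset Strict Implicit. Unset Printing Implicit Defensive.
Import Order.TTheory GRing.Theory Num.Theory.
Import numFieldNormedType.Exports.
Local Open Scope classical_set_scope.
Local Open Scope ring_scope.

(** * Iterated Gaussian integrals *)

(** The Gaussian integrals are iterated line integrals, and the real ones apply [fine] at every
    level, so that even additivity is not free. Measure theory is therefore done on nonnegative
    extended-valued functions, where Tonelli applies, and real integrals are recovered as
    differences of two finite ones. Iteration also dictates an induction on [n]: only the first
    coordinate is directly accessible to a rotation, and the induction carries not holomorphy but a
    homogeneity of circle averages, which survives the averaging of one coordinate. The constant [c]
    of the torus reduction does not depend on the Gaussian parameter. This is decisive: the pairing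
    has parameter [alpha], the norm of [g] has parameter [alpha p / 2], and [c] links them without
    the loss of Hölder's inequality, which serves for absolute convergence only. Convexity of [D]
    gives the upper bound because [k] is the mean of [p k / 2] and [p' k / 2] with weights [1/p] and
    [1/p']. The value of the limit of [D] cancels, as it enters with total weight zero. *)

Section LebesgueAffine.
Variable R : realType.
Local Notation mu := (@lebesgue_measure R).
Local Open Scope ereal_scope.

(** Lebesgue measure is determined by its values on half-open intervals, and [a] times its image
    under the affine map takes the same values there. *)
Lemma ge0_integral_affine (f : R -> \bar R) (a b : R) : (0 < a)%R ->
  measurable_fun setT f -> (forall x, 0 <= f x) ->
  \int[mu]_x f (a * x + b)%R = (a^-1)%:E * \int[mu]_x f x.
Proof.
move=> a0 mf f0.
pose phi : measurableTypeR R -> measurableTypeR R := fun x => (a * x + b)%R.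
have mphi : measurable_fun setT phi.
  by apply: measurable_funD => //; apply: measurable_funM.
have ai : (0 <= a)%R := ltW a0.
have muE A : measurable A ->
    mu A = mscale (NngNum ai) (pushforward mu phi) A.
  apply: lebesgue_measure_unique => _ [[c d] _ <-].
  rewrite /= /mscale/= /pushforward/=.
  have -> : phi @^-1` `]c, d]%classic = `]((c - b) / a)%R, ((d - b) / a)%R]%classic.
    apply/seteqP; split => x /=; rewrite !in_itv/= /phi.
      by move=> /andP[? ?]; rewrite ltr_pdivrMr// ler_pdivlMr//; apply/andP; split; lra.
    by rewrite ltr_pdivrMr// ler_pdivlMr// => /andP[? ?]; apply/andP; split; lra.
  rewrite !lebesgue_measure_itv/= !lte_fin ltr_pM2r ?invr_gt0// ltrD2r.
  case: ifPn => _; last by rewrite mule0.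
  by rewrite -!EFinD -EFinM; congr EFin; field; rewrite gt_eqF.
have E : \int[pushforward mu phi]_x f x = \int[mu]_x f (a * x + b)%R.
  by rewrite (ge0_integral_pushforward mphi)// preimage_setT.
have -> : \int[mu]_x f x = a%:E * \int[pushforward mu phi]_x f x.
  rewrite -(@ge0_integral_mscale _ _ _ (pushforward mu phi) setT measurableT (NngNum ai) f)//.
  by apply: eq_measure_integral => A mA _; exact: muE.
by rewrite E muleA -EFinM mulVf ?gt_eqF// mul1e.
Qed.

Lemma ge0_integral_translate (f : R -> \bar R) (b : R) :
  measurable_fun setT f -> (forall x, 0 <= f x) ->
  \int[mu]_x f (x + b)%R = \int[mu]_x f x.
Proof.
move=> mf f0; rewrite -[RHS]mul1e -[1]/(1%:E) -[1%R]invr1 -(@ge0_integral_affine f 1 b)//.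
by apply: eq_integral => x _; rewrite mul1r.
Qed.

End LebesgueAffine.

(** * Rotation invariance of the plane integral *)

Section Rotation.
Variable R : realType.
Local Notation mu := (@lebesgue_measure R).
Local Notation RR := (measurableTypeR R * measurableTypeR R)%type.
Local Open Scope ereal_scope.
Implicit Type K : RR -> \bar R.

Let shear_y K (b : R) : measurable_fun setT K -> (forall p, 0 <= K p) ->
  \int[mu]_x \int[mu]_y K (x, y + b * x)%R = \int[mu]_x \int[mu]_y K (x, y).
Proof.
move=> mK K0; apply: eq_integral => x _.
by rewrite (@ge0_integral_translate _ (fun y => K (x, y)))//; exact: measurableT_comp.
Qed.

Let shear_x K (a : R) : measurable_fun setT K -> (forall p, 0 <= K p) ->
  \int[mu]_x \int[mu]_y K (x + a * y, y)%R = \int[mu]_x \int[mu]_y K (x, y).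
Proof.
move=> mK K0; rewrite (fubini_tonelli K)//.
rewrite (fubini_tonelli (fun p : RR => K (p.1 + a * p.2, p.2)%R))//=; last first.
  apply: measurableT_comp => //; apply: measurable_fun_pair => //.
  by apply: measurable_funD => //; apply: measurable_funM.
apply: eq_integral => y _.
by rewrite (@ge0_integral_translate _ (fun x => K (x, y)))//; exact: measurableT_comp.
Qed.

(** A rotation is a product of three shears, and each shear is a translation in one variable when
    the other is fixed. With [c = cos t] and [s = sin t], the outer shears have slope
    [a = - tan (t / 2)] and the middle one has slope [s]; this excludes the half turn. *)
Let rot_generic K (c s : R) : (c ^+ 2 + s ^+ 2 = 1)%R -> (1 + c != 0)%R ->
  measurable_fun setT K -> (forall p, 0 <= K p) ->
  \int[mu]_x \int[mu]_y K (c * x - s * y, s * x + c * y)%R =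
  \int[mu]_x \int[mu]_y K (x, y).
Proof.
move=> cs c1 mK K0; pose a := (- s / (1 + c))%R.
have sE : (a * (1 + c) = - s)%R by rewrite /a divfK.
have abE : (a * s = c - 1)%R.
  apply: (mulfI c1); rewrite mulrA [(_ * a)%R]mulrC sE.
  by rewrite mulNr -expr2 -(addrK (c ^+ 2) (s ^+ 2))%R [(_ + c ^+ 2)%R]addrC cs; ring.
have m1 : measurable_fun setT (fun p : RR => K (p.1 + a * p.2, p.2)%R).
  apply: measurableT_comp => //; apply: measurable_fun_pair => //.
  by apply: measurable_funD => //; apply: measurable_funM.
have m2 : measurable_fun setT (fun p : RR =>
    K (p.1 + a * (p.2 + s * p.1), p.2 + s * p.1)%R).
  apply: (measurableT_comp m1 (g := fun p : RR => (p.1, p.2 + s * p.1)%R)).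
  apply: measurable_fun_pair => //.
  by apply: measurable_funD => //; apply: measurable_funM.
rewrite -(shear_x a mK K0) -(shear_y s m1)//= -(shear_x a m2)//=.
apply: eq_integral => x _; apply: eq_integral => y _; congr (K (_, _)).
  rewrite -[(- (s * y))%R]mulNr -sE (_ : c = 1 + a * s)%R; last by rewrite abE; ring.
  ring.
by rewrite (_ : c = 1 + a * s)%R; [ring | rewrite abE; ring].
Qed.

Lemma ge0_integral_rotation K (c s : R) : (c ^+ 2 + s ^+ 2 = 1)%R ->
  measurable_fun setT K -> (forall p, 0 <= K p) ->
  \int[mu]_x \int[mu]_y K (c * x - s * y, s * x + c * y)%R =
  \int[mu]_x \int[mu]_y K (x, y).
Proof.
move=> cs mK K0; have [c1|c1] := eqVneq (1 + c)%R 0%R; last exact: rot_generic.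
have cN : c = (-1)%R by lra.
have s0 : s = 0%R by apply/eqP; rewrite -sqrf_eq0; apply/eqP; move: cs; rewrite cN; lra.
(* For the half turn the slope [a] is undefined; it is obtained as two quarter turns. *)
have q1 : (0 ^+ 2 + 1 ^+ 2 = 1 :> R)%R by rewrite expr0n expr1n add0r.
have n1 : (1 + 0 != 0 :> R)%R by rewrite addr0 oner_eq0.
rewrite -(rot_generic q1 n1 mK K0) -(rot_generic q1 n1 (K := fun p : RR =>
   K (0 * p.1 - 1 * p.2, 1 * p.1 + 0 * p.2)%R))//=; last first.
  apply: measurableT_comp => //; apply: measurable_fun_pair => //.
    by apply: measurable_funB => //; apply: measurable_funM.
  by apply: measurable_funD => //; apply: measurable_funM.
apply: eq_integral => x _; apply: eq_integral => y _; congr (K (_, _)); rewrite s0 cN; ring.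
Qed.

End Rotation.

Local Open Scope complex_scope.
Local Open Scope ring_scope.

(** * Measurability along families of coordinates *)

Section JointMeasurability.
Variable R : realType.
Local Notation RT := (measurableTypeR R).
Local Notation RR := (RT * RT)%type.

(* The sigma-algebra on C^n is never constructed: a function on C^n is called
   measurable when it is so along all measurable families of coordinates. *)
Definition pmeasurable n d0 (S0 : measurableType d0) d (T : measurableType d)
    (K : S0 -> ('I_n -> R[i]) -> T) : Prop :=
  forall d' (S : measurableType d') (phi : S -> S0) (x y : 'I_n -> S -> RT),
    measurable_fun setT phi ->
    (forall i, measurable_fun setT (x i)) ->
    (forall i, measurable_fun setT (y i)) ->
    measurable_fun setT (fun s => K (phi s) (fun i => x i s +i* y i s)).

Definition cmeasurable n d (T : measurableType d) (F : ('I_n -> R[i]) -> T) :=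
  forall d' (S : measurableType d') (x y : 'I_n -> S -> RT),
    (forall i, measurable_fun setT (x i)) ->
    (forall i, measurable_fun setT (y i)) ->
    measurable_fun setT (fun s => F (fun i => x i s +i* y i s)).

Definition zpair (p : RR) : R[i] := p.1 +i* p.2.

Lemma ccons_coord n (S : Type) (x0 y0 : S -> R) (x y : 'I_n -> S -> R) (s : S) :
  ccons (x0 s +i* y0 s) (fun i => x i s +i* y i s) =
  (fun i => (if unlift ord0 i is Some j then x j else x0) s +i*
            (if unlift ord0 i is Some j then y j else y0) s).
Proof. by apply/funext => i; rewrite /ccons; case: (unlift ord0 i). Qed.

(** Moves the first coordinate into the parameter, which is what an induction on [n] requires. *)
Lemma pmeasurable_slice n d0 (S0 : measurableType d0) d (T : measurableType d)
    (K : S0 -> ('I_n.+1 -> R[i]) -> T) :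
  pmeasurable K ->
  pmeasurable (fun (sp : (S0 * RR)%type) w => K sp.1 (ccons (zpair sp.2) w)).
Proof.
move=> mK d' S phi x y mphi mx my.
have m1 : measurable_fun setT (fst \o phi) by exact: measurableT_comp.
have m2 : measurable_fun setT (fst \o (snd \o phi)).
  by apply: measurableT_comp => //; exact: measurableT_comp.
have m3 : measurable_fun setT (snd \o (snd \o phi)).
  by apply: measurableT_comp => //; exact: measurableT_comp.
under eq_fun do rewrite /zpair (ccons_coord (fst \o (snd \o phi)) (snd \o (snd \o phi))).
by apply: (mK _ S (fst \o phi)) => // i; case: (unlift ord0 i).
Qed.

Lemma pmeasurable_slice_at n d0 (S0 : measurableType d0) d (T : measurableType d)
    (K : S0 -> ('I_n.+1 -> R[i]) -> T) (p : RR) :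
  pmeasurable K -> pmeasurable (fun s w => K s (ccons (zpair p) w)).
Proof.
move=> mK d' S phi x y mphi mx my.
apply: (pmeasurable_slice mK (phi := fun s => (phi s, p))) => //.
exact: measurable_fun_pair.
Qed.

Lemma cmeasurable_slice n d (T : measurableType d) (F : ('I_n.+1 -> R[i]) -> T) :
  cmeasurable F -> pmeasurable (fun p w => F (ccons (zpair p) w)).
Proof.
move=> mF d' S phi x y mphi mx my.
have m2 : measurable_fun setT (fst \o phi) by exact: measurableT_comp.
have m3 : measurable_fun setT (snd \o phi) by exact: measurableT_comp.
under eq_fun do rewrite /zpair (ccons_coord (fst \o phi) (snd \o phi)).
by apply: (mF _ S) => // i; case: (unlift ord0 i).
Qed.

Lemma pmeasurable_at n d0 (S0 : measurableType d0) d (T : measurableType d)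
    (K : S0 -> ('I_n -> R[i]) -> T) s : pmeasurable K -> cmeasurable (K s).
Proof. by move=> mK d' S x y mx my; exact: (mK _ S (cst s)). Qed.

End JointMeasurability.

(** The integral over the pair is unfolded into iterated integrals; then [m3] is exchanged first
    with [m2], then with [m1], by the two-variable theorem. *)
Lemma tonelli_prod (R : realType) d1 d2 d3 (T1 : measurableType d1)
    (T2 : measurableType d2) (T3 : measurableType d3)
    (m1 : {sigma_finite_measure set T1 -> \bar R})
    (m2 : {sigma_finite_measure set T2 -> \bar R})
    (m3 : {sigma_finite_measure set T3 -> \bar R})
    (f : (T1 * T2) * T3 -> \bar R) :
  measurable_fun setT f -> (forall q, 0 <= f q)%E ->
  (\int[m1 \x m2]_p \int[m3]_t f (p, t) = \int[m3]_t \int[m1 \x m2]_p f (p, t))%E.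
Proof.
move=> mf f0.
have mpt : measurable_fun setT (fun p => \int[m3]_t f (p, t))%E.
  exact: measurable_fun_fubini_tonelli_F.
have mft t : measurable_fun setT (fun p => f (p, t)).
  by apply: measurableT_comp => //; exact: measurable_fun_pair.
have mg1 x : measurable_fun setT (fun q : T2 * T3 => f ((x, q.1), q.2)).
  apply: (measurableT_comp mf (g := fun q : T2 * T3 => ((x, q.1), q.2))).
  by apply: measurable_fun_pair => //; exact: measurable_fun_pair.
have mg2 : measurable_fun setT (fun q : (T1 * T3) * T2 => f ((q.1.1, q.2), q.1.2)).
  apply: (measurableT_comp mf (g := fun q : (T1 * T3) * T2 => ((q.1.1, q.2), q.1.2))).
  apply: measurable_fun_pair; last exact: measurableT_comp.
  by apply: measurable_fun_pair => //; exact: measurableT_comp.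
have mg3 := measurable_fun_fubini_tonelli_F (m2 := m2) _ mg2 (fun q => f0 _).
rewrite (fubini_tonelli1 (m1 := m1) (m2 := m2) _ mpt); last first.
  by move=> p; exact: integral_ge0.
transitivity (\int[m1]_x \int[m3]_t \int[m2]_y f ((x, y), t))%E.
  apply: eq_integral => x _.
  exact: (fubini_tonelli (m1 := m2) (m2 := m3) _ (mg1 x) (fun q => f0 _)).
transitivity (\int[m3]_t \int[m1]_x \int[m2]_y f ((x, y), t))%E.
  apply: (fubini_tonelli (m1 := m1) (m2 := m3) _ mg3) => q.
  by apply: integral_ge0 => y _; exact: f0.
apply: eq_integral => t _.
by rewrite (fubini_tonelli1 (m1 := m1) (m2 := m2) _ (mft t)).
Qed.

(** * Calculus of the extended-valued Gaussian integral *)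

Section GaussianIntegral.
Variables (R : realType) (a : R).
Hypothesis a0 : 0 < a.
Local Notation RT := (measurableTypeR R).
Local Notation RR := (RT * RT)%type.
Local Notation mu := (@lebesgue_measure R).
Local Notation m2 := (mu \x mu)%E.
Local Notation dens p := (gdens a p.1 p.2).

Lemma gdens_gt0 (x y : R) : 0 < gdens a x y.
Proof. by rewrite /gdens mulr_gt0 ?divr_gt0 ?pi_gt0 ?expR_gt0. Qed.

Lemma gdens_ge0 (x y : R) : 0 <= gdens a x y.
Proof. exact/ltW/gdens_gt0. Qed.

Lemma measurable_gdens : measurable_fun setT (fun p : RR => dens p).
Proof.
apply: measurable_funM => //; apply: measurableT_comp => //.
by apply: measurable_funM => //; apply: measurable_funD; apply: measurable_funX.
Qed.

Lemma gintE_ge0 n (F : ('I_n -> R[i]) -> \bar R) :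
  (forall z, 0 <= F z)%E -> (0 <= gintE a F)%E.
Proof.
elim: n F => [|n IH] F F0 /=; first exact: F0.
apply: integral_ge0 => x _; apply: integral_ge0 => y _.
by rewrite mule_ge0 ?lee_fin ?gdens_ge0// IH.
Qed.

(** The parameter space must be general in the induction, since the first coordinate joins it at
    each step. *)
Lemma pmeasurable_gintE n d0 (S0 : measurableType d0)
    (K : S0 -> ('I_n -> R[i]) -> \bar R) :
  pmeasurable K -> (forall s z, 0 <= K s z)%E ->
  measurable_fun setT (fun s => gintE a (K s)).
Proof.
elim: n d0 S0 K => [|n IH] d0 S0 K mK K0 /=.
  have := mK _ S0 id (fun _ => cst 0) (fun _ => cst 0) (@measurable_id _ _ _).
  move=> /(_ (fun=> measurable_cst _) (fun=> measurable_cst _)).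
  by apply: eq_measurable_fun => s _ /=; congr (K s _); apply/funext => -[].
have mJ : measurable_fun setT (fun q : S0 * RR =>
    ((dens q.2)%:E * gintE a (fun w => K q.1 (ccons (zpair q.2) w)))%E).
  apply: emeasurable_funM.
    apply/measurable_EFinP; apply: (measurableT_comp measurable_gdens).
    exact: measurable_snd.
  by apply: IH => //; exact: pmeasurable_slice.
have J0 q : (0 <= (dens q.2)%:E * gintE a (fun w => K q.1 (ccons (zpair q.2) w)))%E.
  by rewrite mule_ge0 ?lee_fin ?gdens_ge0// gintE_ge0.
pose f1 (q : (S0 * RT) * RT) := ((gdens a q.1.2 q.2)%:E *
   gintE a (fun w => K q.1.1 (ccons (zpair (q.1.2, q.2)) w)))%E.
have mf1 : measurable_fun setT f1.
  apply: (measurableT_comp mJ (g := fun q : (S0 * RT) * RT => (q.1.1, (q.1.2, q.2)))).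
  apply: measurable_fun_pair; first exact: measurableT_comp.
  by apply: measurable_fun_pair => //; exact: measurableT_comp.
have f10 q : (0 <= f1 q)%E by exact: (J0 (q.1.1, (q.1.2, q.2))).
have mf2 := measurable_fun_fubini_tonelli_F (m2 := mu) f1 mf1 f10.
apply: (measurable_fun_fubini_tonelli_F (m2 := mu) _ mf2) => q.
by apply: integral_ge0 => y _; exact: f10.
Qed.

Lemma cmeasurable_gintE_slice n (F : ('I_n.+1 -> R[i]) -> \bar R) :
  cmeasurable F -> (forall z, 0 <= F z)%E ->
  measurable_fun setT (fun p : RR => (dens p)%:E * gintE a (fun w => F (ccons (zpair p) w)))%E.
Proof.
move=> mF F0; apply: emeasurable_funM; first by apply/measurable_EFinP; exact: measurable_gdens.
by apply: pmeasurable_gintE => //; exact: cmeasurable_slice.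
Qed.

(** Merges the two line integrals of a coordinate into one plane integral, so that the inductions
    below treat one integral per coordinate. *)
Lemma gintES n (F : ('I_n.+1 -> R[i]) -> \bar R) :
  cmeasurable F -> (forall z, 0 <= F z)%E ->
  gintE a F = (\int[m2]_p ((dens p)%:E * gintE a (fun w => F (ccons (zpair p) w))))%E.
Proof.
move=> mF F0.
apply/esym/(fubini_tonelli1 (fun p : RR => (dens p)%:E * _)%E).
  exact: cmeasurable_gintE_slice.
by move=> p; rewrite mule_ge0 ?lee_fin ?gdens_ge0// gintE_ge0.
Qed.

Lemma le_gintE n (F G : ('I_n -> R[i]) -> \bar R) :
  cmeasurable F -> cmeasurable G -> (forall z, 0 <= F z)%E ->
  (forall z, F z <= G z)%E -> (gintE a F <= gintE a G)%E.
Proof.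
elim: n F G => [|n IH] F G mF mG F0 FG; first exact: FG.
have G0 z : (0 <= G z)%E by exact: le_trans (FG z).
rewrite gintES// gintES//; apply: ge0_le_integral => //.
- by move=> p _; rewrite mule_ge0 ?lee_fin ?gdens_ge0// gintE_ge0.
- exact: cmeasurable_gintE_slice.
- exact: cmeasurable_gintE_slice.
move=> p _; rewrite lee_wpmul2l ?lee_fin ?gdens_ge0// IH//.
  by apply: pmeasurable_at (cmeasurable_slice mF).
by apply: pmeasurable_at (cmeasurable_slice mG).
Qed.

Lemma gintED n (F G : ('I_n -> R[i]) -> \bar R) :
  cmeasurable F -> cmeasurable G -> (forall z, 0 <= F z)%E ->
  (forall z, 0 <= G z)%E -> gintE a (fun z => F z + G z)%E = (gintE a F + gintE a G)%E.
Proof.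
elim: n F G => [//|n IH] F G mF mG F0 G0.
have mFG : cmeasurable (fun z => F z + G z)%E.
  move=> d' S x y mx my; apply: emeasurable_funD; [exact: mF|exact: mG].
rewrite gintES//; last by move=> z; rewrite adde_ge0.
rewrite [gintE a F]gintES// [gintE a G]gintES// -ge0_integralD//.
- apply: eq_integral => p _; rewrite -ge0_muleDr ?gintE_ge0//; congr (_ * _)%E.
  apply: IH => //; first by apply: pmeasurable_at (cmeasurable_slice mF).
  by apply: pmeasurable_at (cmeasurable_slice mG).
- by move=> p _; rewrite mule_ge0 ?lee_fin ?gdens_ge0// gintE_ge0.
- exact: cmeasurable_gintE_slice.
- by move=> p _; rewrite mule_ge0 ?lee_fin ?gdens_ge0// gintE_ge0.
- exact: cmeasurable_gintE_slice.
Qed.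

Lemma gintEZ n (F : ('I_n -> R[i]) -> \bar R) (k : R) : 0 <= k ->
  cmeasurable F -> (forall z, 0 <= F z)%E ->
  gintE a (fun z => k%:E * F z)%E = (k%:E * gintE a F)%E.
Proof.
move=> k0; elim: n F => [//|n IH] F mF F0.
have mkF : cmeasurable (fun z => k%:E * F z)%E.
  by move=> d' S x y mx my; apply: emeasurable_funM => //; exact: mF.
rewrite gintES//; last by move=> z; rewrite mule_ge0.
rewrite gintES// -ge0_integralZl//.
- apply: eq_integral => p _; rewrite muleCA; congr (_ * _)%E.
  by apply: IH => //; apply: pmeasurable_at (cmeasurable_slice mF).
- exact: cmeasurable_gintE_slice.
- by move=> p _; rewrite mule_ge0 ?lee_fin ?gdens_ge0// gintE_ge0.
Qed.

Lemma gintE_tonelli n d (Th : measurableType d)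
    (nu : {sigma_finite_measure set Th -> \bar R})
    (K : Th -> ('I_n -> R[i]) -> \bar R) :
  pmeasurable K -> (forall t z, 0 <= K t z)%E ->
  gintE a (fun z => \int[nu]_t K t z)%E = (\int[nu]_t gintE a (K t))%E.
Proof.
elim: n K => [//|n IH] K mK K0.
have mI : cmeasurable (fun z => \int[nu]_t K t z)%E.
  move=> d' S x y mx my.
  apply: (measurable_fun_fubini_tonelli_F (m2 := nu)
    (fun q : S * Th => K q.2 (fun i => x i q.1 +i* y i q.1))) => //.
  by apply: (mK _ _ _ (fun i q => x i q.1) (fun i q => y i q.1)) => // i;
    exact: measurableT_comp.
rewrite gintES//; last by move=> z; exact: integral_ge0.
have -> : (\int[nu]_t gintE a (K t) = \int[nu]_t \int[m2]_p
   ((dens p)%:E * gintE a (fun w => K t (ccons (zpair p) w))))%E.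
  apply: eq_integral => t _; rewrite gintES//; exact: pmeasurable_at mK.
have mJ : measurable_fun setT (fun q : RR * Th =>
    ((dens q.1)%:E * gintE a (fun w => K q.2 (ccons (zpair q.1) w)))%E).
  apply: emeasurable_funM.
    apply/measurable_EFinP; apply: (measurableT_comp measurable_gdens).
    exact: measurable_fst.
  have mH : measurable_fun setT (fun q : Th * RR =>
       gintE a (fun w => K q.1 (ccons (zpair q.2) w))).
    by apply: pmeasurable_gintE => //; exact: pmeasurable_slice.
  apply: (measurableT_comp mH (g := fun q : RR * Th => (q.2, q.1))).
  exact: measurable_fun_pair.
have J0 (q : RR * Th) : (0 <= (dens q.1)%:E * gintE a (fun w => K q.2 (ccons (zpair q.1) w)))%E.
  by rewrite mule_ge0 ?lee_fin ?gdens_ge0// gintE_ge0.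
have /= <- := tonelli_prod mu mu nu mJ J0.
apply: eq_integral => p _ /=; rewrite ge0_integralZl//=.
- congr (_ * _)%E; apply: (IH (fun t w => K t (ccons (zpair p) w))) => //.
  exact: pmeasurable_slice_at.
- by apply: pmeasurable_gintE => //; exact: pmeasurable_slice_at.
- by move=> t _; rewrite gintE_ge0.
- by rewrite lee_fin gdens_ge0.
Qed.

Lemma gintE_prod n (k : R[i] -> R) (F : ('I_n -> R[i]) -> \bar R) :
  measurable_fun setT (fun p : RR => k (zpair p)) -> (forall c, 0 <= k c) ->
  cmeasurable F -> (forall z, 0 <= F z)%E ->
  gintE a (fun z => (k (z ord0))%:E * F (z \o lift ord0))%E =
  ((\int[m2]_p (dens p * k (zpair p))%:E) * gintE a F)%E.
Proof.
move=> mk k0 mF F0.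
have mkF : cmeasurable (fun z : 'I_n.+1 -> R[i] => (k (z ord0))%:E * F (z \o lift ord0))%E.
  move=> d' S x y mx my; apply: emeasurable_funM.
    apply/measurable_EFinP.
    apply: (measurableT_comp mk (g := fun s => (x ord0 s, y ord0 s))).
    exact: measurable_fun_pair.
  exact: (mF _ S (fun i => x (lift ord0 i)) (fun i => y (lift ord0 i))).
rewrite gintES//; last by move=> z; rewrite mule_ge0 ?lee_fin.
rewrite -ge0_integralZr//=; last by rewrite gintE_ge0.
- apply: eq_integral => p _.
  rewrite [in RHS]EFinM -[in RHS]muleA; congr (_ * _)%E.
  rewrite -gintEZ//; congr gintE; apply/funext => w.
  rewrite /ccons unlift_none; congr (_ * F _)%E.
  by apply/funext => i /=; rewrite liftK.
- by apply/measurable_EFinP; apply: measurable_funM => //; exact: measurable_gdens.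
- by move=> p _; rewrite lee_fin mulr_ge0 ?gdens_ge0.
Qed.

End GaussianIntegral.

(** * From nonnegative integrals to signed ones *)

Section RealIteratedIntegral.
Variable R : realType.
Local Notation RT := (measurableTypeR R).
Local Notation RR := (RT * RT)%type.
Local Notation mu := (@lebesgue_measure R).

(** No integrability is assumed: the real integral is [fine] of the difference of the integrals of
    the positive and negative parts, and each of these is measurable by Tonelli. *)
Lemma measurable_Rintegral_snd d (S : measurableType d) d' (T : measurableType d')
    (m : {sigma_finite_measure set T -> \bar R}) (f : S * T -> R) :
  measurable_fun setT f ->
  measurable_fun setT (fun s => Rintegral m setT (fun y => f (s, y))).
Proof.
move=> mf; apply: (measurableT_comp (f := @fine R)); first exact: fine_measurable.
have mEf : measurable_fun setT (EFin \o f) by apply/measurable_EFinP.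
have -> : (fun s => \int[m]_y (f (s, y))%:E)%E =
  (fun s => \int[m]_y ((EFin \o f)^\+ (s, y)) - \int[m]_y ((EFin \o f)^\- (s, y)))%E.
  apply/funext => s; rewrite [LHS]integralE.
  by congr (_ - _)%E; apply: eq_integral => y _; rewrite ?funeposE ?funenegE.
apply: emeasurable_funB; apply: measurable_fun_fubini_tonelli_F => //.
- exact: measurable_funepos.
- exact: measurable_funeneg.
Qed.

Lemma pmeasurable_gintR (a : R) n d0 (S0 : measurableType d0)
    (K : S0 -> ('I_n -> R[i]) -> RT) :
  pmeasurable K -> measurable_fun setT (fun s => gintR a (K s) : RT).
Proof.
elim: n d0 S0 K => [|n IH] d0 S0 K mK /=.
  have := mK _ S0 id (fun _ => cst 0) (fun _ => cst 0) (@measurable_id _ _ _).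
  move=> /(_ (fun=> measurable_cst _) (fun=> measurable_cst _)).
  by apply: eq_measurable_fun => s _ /=; congr (K s _); apply/funext => -[].
have mJ : measurable_fun setT (fun q : S0 * RR =>
    gdens a q.2.1 q.2.2 * gintR a (fun w => K q.1 (ccons (zpair q.2) w))).
  apply: measurable_funM.
    apply: (measurableT_comp (measurable_gdens a)); exact: measurable_snd.
  by apply: (IH _ (S0 * RR)%type) => //; exact: pmeasurable_slice.
pose f1 (q : (S0 * RT) * RT) : R := gdens a q.1.2 q.2 *
   gintR a (fun w => K q.1.1 (ccons (zpair (q.1.2, q.2)) w)).
have mf1 : measurable_fun setT f1.
  apply: (measurableT_comp mJ (g := fun q : (S0 * RT) * RT => (q.1.1, (q.1.2, q.2)))).
  apply: measurable_fun_pair; first exact: measurableT_comp.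
  by apply: measurable_fun_pair => //; exact: measurableT_comp.
exact: (measurable_Rintegral_snd mu (measurable_Rintegral_snd mu mf1)).
Qed.

(** Finiteness of an iterated integral makes its inner integrals finite only almost everywhere.
    Hence [k] is prescribed only at the points where [P] and [N] are both finite. *)
Lemma Rintegral_sub_ae (P N : RT -> \bar R) (k : RT -> R) :
  measurable_fun setT P -> measurable_fun setT N -> measurable_fun setT k ->
  (forall y, 0 <= P y)%E -> (forall y, 0 <= N y)%E ->
  (\int[mu]_y P y < +oo)%E -> (\int[mu]_y N y < +oo)%E ->
  (forall y, (P y < +oo)%E -> (N y < +oo)%E -> k y = fine (P y) - fine (N y)) ->
  Rintegral mu setT k = fine (\int[mu]_y P y)%E - fine (\int[mu]_y N y)%E.
Proof.
move=> mP mN mk P0 N0 iP iN kE.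
have intP : mu.-integrable setT P.
  by apply/integrableP; split => //; under eq_integral do rewrite gee0_abs//.
have intN : mu.-integrable setT N.
  by apply/integrableP; split => //; under eq_integral do rewrite gee0_abs//.
rewrite /Rintegral -fineB; last 2 first.
- by rewrite ge0_fin_numE// integral_ge0.
- by rewrite ge0_fin_numE// integral_ge0.
rewrite -integralB//; congr fine; apply: ae_eq_integral => //.
- exact/measurable_EFinP.
- exact: emeasurable_funB.
have := integrable_ae measurableT intP.
have := integrable_ae measurableT intN.
apply: filterS2 => y /(_ I) fN /(_ I) fP _.
rewrite kE ?ltey_eq ?fP ?fN// EFinB !fineK//.
Qed.

Variable a : R.
Hypothesis a0 : 0 < a.

(** The bridge between the two integrals. As [gintR] takes [fine] after each line integral,
    [Rintegral_sub_ae] is applied twice per coordinate, and the induction hypothesis holds only at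
    the points where the inner integrals are finite. *)
Lemma gintR_sub n (P N : ('I_n -> R[i]) -> RT) :
  cmeasurable P -> cmeasurable N -> (forall z, 0 <= P z) -> (forall z, 0 <= N z) ->
  (gintE a (EFin \o P) < +oo)%E -> (gintE a (EFin \o N) < +oo)%E ->
  gintR a (fun z => P z - N z) = fine (gintE a (EFin \o P)) - fine (gintE a (EFin \o N)).
Proof.
elim: n P N => [//|n IH] P N mP mN P0 N0 iP iN /=.
have cmE (F : ('I_n.+1 -> R[i]) -> RT) : cmeasurable F -> cmeasurable ((EFin \o F) : ('I_n.+1 -> R[i]) -> \bar R).
  by move=> mF d' S x y mx my; apply/measurable_EFinP; exact: mF.
have mPN : cmeasurable (fun z => P z - N z : RT).
  by move=> d' S x y mx my; apply: measurable_funB; [exact: mP|exact: mN].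
pose K (F : ('I_n.+1 -> R[i]) -> RT) (p : RR) : \bar R :=
  ((gdens a p.1 p.2)%:E * gintE a (fun w => (F (ccons (zpair p) w))%:E))%E.
have mK (F : ('I_n.+1 -> R[i]) -> RT) : cmeasurable F -> (forall z, 0 <= F z) -> measurable_fun setT (K F).
  by move=> mF F0; apply: (cmeasurable_gintE_slice a0 (cmE _ mF)) => z; rewrite lee_fin.
have K0 (F : ('I_n.+1 -> R[i]) -> RT) p : (forall z, 0 <= F z) -> (0 <= K F p)%E.
  by move=> F0; rewrite mule_ge0 ?lee_fin ?gdens_ge0// gintE_ge0// => z; rewrite lee_fin.
pose k (p : RR) : R := gdens a p.1 p.2 *
    gintR a (fun w => P (ccons (zpair p) w) - N (ccons (zpair p) w)).
have mk : measurable_fun setT k.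
  apply: measurable_funM; first exact: measurable_gdens.
  exact: (pmeasurable_gintR a (cmeasurable_slice mPN)).
(* The density is strictly positive, so an infinite inner integral would make the weighted one
   infinite too. *)
have fin (F : ('I_n.+1 -> R[i]) -> RT) p : (forall z, 0 <= F z) -> (K F p < +oo)%E ->
    (gintE a (fun w => (F (ccons (zpair p) w))%:E) < +oo)%E.
  move=> F0; rewrite /K => h.
  have : (0 <= gintE a (fun w => (F (ccons (zpair p) w))%:E))%E.
    by apply: gintE_ge0 => // z; rewrite lee_fin.
  case: (gintE _ _) h => [r _ _|//|//]; first by rewrite ltry.
  by rewrite gt0_muley ?lte_fin ?gdens_gt0.
have iterK (F : ('I_n.+1 -> R[i]) -> RT) : cmeasurable F -> (forall z, 0 <= F z) ->
    measurable_fun setT (fun x => \int[mu]_y K F (x, y))%E.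
  move=> mF F0; apply: measurable_fun_fubini_tonelli_F; first exact: mK.
  by move=> q; exact: K0.
pose KP x : \bar R := (\int[mu]_y K P (x, y))%E.
pose KN x : \bar R := (\int[mu]_y K N (x, y))%E.
pose k1 x : R := Rintegral mu setT (fun y => k (x, y)).
have mxy (x : RT) : measurable_fun setT (fun y : RT => (x, y)) by exact: measurable_fun_pair.
apply: (@Rintegral_sub_ae KP KN k1).
- exact: iterK.
- exact: iterK.
- exact: (measurable_Rintegral_snd mu mk).
- by move=> x; apply: integral_ge0 => y _; exact: K0.
- by move=> x; apply: integral_ge0 => y _; exact: K0.
- exact: iP.
- exact: iN.
move=> x fPx fNx.
apply: (@Rintegral_sub_ae (fun y => K P (x, y)) (fun y => K N (x, y)) (fun y => k (x, y))).
- exact: measurableT_comp (mK _ mP P0) (mxy x).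
- exact: measurableT_comp (mK _ mN N0) (mxy x).
- exact: measurableT_comp mk (mxy x).
- by move=> y; exact: K0.
- by move=> y; exact: K0.
- exact: fPx.
- exact: fNx.
move=> y fP fN.
have hP := fin _ (x, y) P0 fP; have hN := fin _ (x, y) N0 fN.
have f0 (F : ('I_n.+1 -> R[i]) -> RT) p : (forall z, 0 <= F z) -> (gintE a (fun w => (F (ccons (zpair p) w))%:E) < +oo)%E ->
    gintE a (fun w => (F (ccons (zpair p) w))%:E) \is a fin_num.
  by move=> F0 h; rewrite ge0_fin_numE// gintE_ge0// => z; rewrite lee_fin.
rewrite /k (IH (fun w => P (ccons (zpair (x, y)) w)) (fun w => N (ccons (zpair (x, y)) w)))//.
- by rewrite mulrBr !fineM// ; [exact: (f0 N)|exact: (f0 P)].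
- exact: pmeasurable_at (cmeasurable_slice mP).
- exact: pmeasurable_at (cmeasurable_slice mN).
Qed.

End RealIteratedIntegral.

Section Cabs.
Variable R : realType.
Implicit Types z w : R[i].

Lemma cabsE z : (cabs z)%:C = `|z|.
Proof. by rewrite normc_def. Qed.

Lemma cabs_ge0 z : 0 <= cabs z.
Proof. exact: sqrtr_ge0. Qed.

Lemma cabsM z w : cabs (z * w) = cabs z * cabs w.
Proof. by apply: (@complexI R); rewrite [RHS]rmorphM/= !cabsE normrM. Qed.

Lemma cabsD z w : cabs (z + w) <= cabs z + cabs w.
Proof. by rewrite -lecR rmorphD/= !cabsE ler_normD. Qed.

Lemma cabsN z : cabs (- z) = cabs z.
Proof. by apply: (@complexI R); rewrite !cabsE normrN. Qed.

Lemma cabsB z w : cabs (z - w) = cabs (w - z).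
Proof. by rewrite -cabsN opprB. Qed.

Lemma cabs0 : cabs (0 : R[i]) = 0.
Proof. by apply: (@complexI R); rewrite cabsE normr0. Qed.

Lemma cabs1 : cabs (1 : R[i]) = 1.
Proof. by apply: (@complexI R); rewrite cabsE normr1. Qed.

Lemma cabsX z k : cabs (z ^+ k) = cabs z ^+ k.
Proof. by elim: k => [|k IH]; rewrite ?expr0 ?cabs1// !exprS cabsM IH. Qed.

Lemma cabsJ z : cabs z^* = cabs z.
Proof. by case: z => x y; rewrite /cabs/= sqrrN. Qed.

Lemma cabs_eq0 z : (cabs z == 0) = (z == 0).
Proof. by rewrite -(inj_eq (@complexI R)) cabsE normr_eq0. Qed.

Lemma ler_cabsB z w : `|cabs z - cabs w| <= cabs (z - w).
Proof.
have h (u v : R[i]) : cabs u - cabs v <= cabs (u - v).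
  by rewrite lerBlDr; apply: le_trans (cabsD _ _); rewrite subrK.
by rewrite ler_norml h lerNl opprB cabsB h.
Qed.

Lemma normr_Re_cabs z : `|complex.Re z| <= cabs z.
Proof. by rewrite -sqrtr_sqr ler_sqrt ?addr_ge0 ?sqr_ge0// lerDl sqr_ge0. Qed.

Lemma normr_Im_cabs z : `|complex.Im z| <= cabs z.
Proof. by rewrite -sqrtr_sqr ler_sqrt ?addr_ge0 ?sqr_ge0// lerDr sqr_ge0. Qed.

Lemma cabs_le_ReIm z : cabs z <= `|complex.Re z| + `|complex.Im z|.
Proof.
rewrite -[leRHS]ger0_norm ?addr_ge0// -sqrtr_sqr ler_sqrt ?sqr_ge0//.
rewrite sqrrD !real_normK ?num_real//.
by rewrite addrAC lerDl mulrn_wge0// mulr_ge0.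
Qed.

Lemma sqr_cabs z : cabs z ^+ 2 = complex.Re z ^+ 2 + complex.Im z ^+ 2.
Proof. by rewrite sqr_sqrtr ?addr_ge0 ?sqr_ge0. Qed.

End Cabs.

(** * Continuous functions are measurable and locally bounded *)

Section Continuity.
Variables (R : realType) (n : nat).
Local Notation RT := (measurableTypeR R).

Definition ccontinuous (u : ('I_n -> R[i]) -> R) :=
  forall z (eps : R), 0 < eps -> exists2 delta : R, 0 < delta &
    forall w, (forall i, cabs (w i - z i) < delta) -> `|u w - u z| < eps.

Let rnd (k : nat) (x : R) : R := (Num.floor (k.+1%:R * x))%:~R / k.+1%:R.

Let rndP k x : `|rnd k x - x| <= k.+1%:R^-1.
Proof.
have k0 : 0 < k.+1%:R :> R by rewrite ltr0n.
have := floor_itv (k.+1%:R * x); rewrite intrD => /andP[h1 h2].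
rewrite -(ler_pM2l k0) -[X in X * _ <= _](gtr0_norm k0) -normrM mulfV ?gt_eqF//.
rewrite mulrBr /rnd mulrCA mulfV ?gt_eqF// mulr1 ler_norml.
by apply/andP; split; lra.
Qed.

(** Rounding the coordinates down to multiples of [1 / (k + 1)] gives functions of [s] with
    countably many values, each taken on a measurable set; by continuity they converge pointwise to
    [u]. *)
Lemma ccontinuous_cmeasurable (u : ('I_n -> R[i]) -> RT) :
  ccontinuous u -> cmeasurable u.
Proof.
move=> cu d' S x y mx my.
pose h k s : R := u (fun i => rnd k (x i s) +i* rnd k (y i s)).
apply: (@measurable_fun_cvg _ S R setT h) => [k|s _]; last first.
  apply/cvgrPdist_lt => e e0.
  have [dl dl0 H] := cu (fun i => x i s +i* y i s) e e0.
  have dl20 : 0 < dl / 2 by rewrite divr_gt0.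
  near=> k; rewrite distrC; apply: H => i.
  apply: le_lt_trans (cabs_le_ReIm _) _; rewrite /=.
  have kd : k.+1%:R^-1 < dl / 2.
    by near: k; exact: near_infty_natSinv_lt (PosNum dl20).
  rewrite [ltRHS]splitr ltrD//.
    exact: le_lt_trans (rndP _ _) kd.
  exact: le_lt_trans (rndP _ _) kd.
pose v k s : {ffun 'I_n -> int * int} :=
  [ffun i => (Num.floor (k.+1%:R * x i s), Num.floor (k.+1%:R * y i s))].
pose g k (f : {ffun 'I_n -> int * int}) : R :=
  u (fun i => ((f i).1%:~R / k.+1%:R) +i* ((f i).2%:~R / k.+1%:R)).
have hE s : h k s = g k (v k s).
  by congr (u _); apply/funext => i; rewrite /v ffunE.
have mfl (m : int) (t : S -> RT) : measurable_fun setT t ->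
    measurable [set s | Num.floor (k.+1%:R * t s) = m].
  move=> mt.
  have mkt : measurable_fun setT (fun s => k.+1%:R * t s : RT).
    by apply: measurable_funM.
  have := mkt measurableT `[m%:~R, (m + 1)%:~R[%classic (measurable_itv _).
  rewrite setTI; congr measurable; apply/seteqP; split => s /=; rewrite in_itv/=.
    exact: floor_def.
  by move=> <-; exact: floor_itv.
have mv f : measurable [set s | v k s = f].
  have -> : [set s | v k s = f] = \bigcap_(i in [set` 'I_n])
     ([set s | Num.floor (k.+1%:R * x i s) = (f i).1] `&`
      [set s | Num.floor (k.+1%:R * y i s) = (f i).2]).
    apply/seteqP; split => s /=.
      by move=> <- i _; rewrite /v ffunE.
    move=> H; apply/ffunP => i; rewrite ffunE; have [/= -> ->] := H i erefl.
    by case: (f i).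
  apply: fin_bigcap_measurable => // i _; apply: measurableI; exact: mfl.
move=> _ B mB; rewrite setTI.
(* The grid points form a countable type, so the preimage is a union over their codes, which are
   natural numbers. *)
have -> : h k @^-1` B = \bigcup_(m in [set m | exists2 f, pickle f = m & B (g k f)])
    [set s | pickle (v k s) = m].
  apply/seteqP; split => s /=.
    by move=> Bs; exists (pickle (v k s)) => //=; exists (v k s); rewrite // -hE.
  by move=> [m /= [f <- Bf]] /(pcan_inj pickleK) vf; rewrite hE vf.
apply: bigcup_measurable => m /= [f <- _].
have -> : [set s | pickle (v k s) = pickle f] = [set s | v k s = f]; last exact: mv.
by apply/seteqP; split => s /= => [/(pcan_inj pickleK)|->].
Unshelve. all: by end_near. Qed.

Definition locally_bounded (u : ('I_n -> R[i]) -> R) :=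
  forall r, exists M, forall z, (forall i, cabs (z i) <= r) -> `|u z| <= M.

(** Points bounded by [r] in each coordinate lie in a product of squares, which is compact by
    Tychonoff; [u] is continuous for the product topology because there are finitely many
    coordinates. *)
Lemma ccontinuous_locally_bounded u : ccontinuous u -> locally_bounded u.
Proof.
move=> cu r.
pose box : set (R * R) := `[- r, r]%classic `*` `[- r, r]%classic.
have cbox : compact box by apply: compact_setX; exact: segment_compact.
pose zf (f : prod_topology (fun _ : 'I_n => (R * R)%type)) : 'I_n -> R[i] :=
  fun i => (f i).1 +i* (f i).2.
have ct : compact [set f : prod_topology (fun _ : 'I_n => (R * R)%type) |
    forall i, box (f i)] by exact: (@tychonoff _ (fun _ : 'I_n => (R * R)%type) (fun=> box)).
have cuz : continuous (u \o zf).
  move=> f B /nbhs_ballP[e /= e0 Be].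
  have [dl dl0 H] := cu (zf f) e e0.
  have dl20 : 0 < dl / 2 by rewrite divr_gt0.
  have Hi (i : 'I_n) : \forall g \near f, ball (f i) (dl / 2) (g i).
    have := @proj_continuous _ (fun _ : 'I_n => (R * R)%type) i f.
    by move=> /(_ (ball (f i) (dl / 2))); apply; exact: nbhsx_ballx.
  have FF : Filter (nbhs f) :=
    @nbhs_filter (prod_topology (fun _ : 'I_n => (R * R)%type)) f.
  have := filter_forall FF Hi; apply: (@filterS _ _ FF) => g Hg.
  apply: Be; rewrite /ball/= distrC; apply: H => i; apply: le_lt_trans (cabs_le_ReIm _) _ => /=.
  have [h1 h2] := Hg i.
  by rewrite [ltRHS]splitr ltrD// distrC.
have := compact_bounded (continuous_compact (continuous_subspaceT cuz) ct).
move=> [M [_ HM]]; exists (M + 1) => z zr.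
have /(HM (M + 1)) : M < M + 1 by rewrite ltrDl.
apply; exists (fun i => (complex.Re (z i), complex.Im (z i))); last first.
  by rewrite /= /zf/=; congr (u _); apply/funext => i /=; case: (z i).
move=> i; split => /=; rewrite in_itv/= -ler_norml.
  exact: le_trans (normr_Re_cabs _) (zr i).
exact: le_trans (normr_Im_cabs _) (zr i).
Qed.

End Continuity.

(** * Gaussian moments *)

Section Moments.
Variable R : realType.
Local Notation RT := (measurableTypeR R).
Local Notation RR := (RT * RT)%type.
Local Notation mu := (@lebesgue_measure R).
Local Notation m2 := (mu \x mu)%E.
Implicit Types (a q : R).

(** The absolute moment of order [q] of a complex Gaussian variable, equal to
    [a^(-q/2) Gamma(q/2 + 1)]. *)
Definition cmoment a q : \bar R :=
  (\int[m2]_p (gdens a p.1 p.2 * cabs (zpair p) `^ q)%:E)%E.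

Lemma measurable_cabs_zpair : measurable_fun setT (fun p : RR => cabs (zpair p)).
Proof.
apply: (measurableT_comp (f := @Num.sqrt R)).
  by apply: continuous_measurable_fun; exact: sqrt_continuous.
by rewrite /=; apply: measurable_funD; apply: measurable_funX.
Qed.

Lemma measurable_cabs_powR q : measurable_fun setT (fun p : RR => cabs (zpair p) `^ q).
Proof. exact: (measurableT_comp (measurable_powR q) measurable_cabs_zpair). Qed.

Lemma measurable_gdens_cabs a q :
  measurable_fun setT (fun p : RR => gdens a p.1 p.2 * cabs (zpair p) `^ q).
Proof. by apply: measurable_funM; [exact: measurable_gdens|exact: measurable_cabs_powR]. Qed.

Lemma ge0_integral_scale2 (K : RR -> \bar R) (c : R) : 0 < c ->
  measurable_fun setT K -> (forall p, 0 <= K p)%E ->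
  (\int[m2]_p K (c * p.1, c * p.2)%R = (c ^- 2)%:E * \int[m2]_p K p)%E.
Proof.
move=> c0 mK K0.
have mKc : measurable_fun setT (fun p : RR => K (c * p.1, c * p.2)).
  by apply: measurableT_comp => //; apply: measurable_fun_pair; apply: measurable_funM.
have mKx x : measurable_fun setT (fun y : RT => K (x, y)).
  by apply: measurableT_comp => //; exact: measurable_fun_pair.
have mI : measurable_fun setT (fun x : RT => \int[mu]_y K (x, y))%E.
  exact: measurable_fun_fubini_tonelli_F.
rewrite (fubini_tonelli1 (m1 := mu) (m2 := mu) _ mKc)//.
rewrite (fubini_tonelli1 (m1 := mu) (m2 := mu) _ mK)// /fubini_F/=.
transitivity (\int[mu]_x ((c^-1)%:E * \int[mu]_y K ((c * x)%R, y)))%E.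
  apply: eq_integral => x _.
  rewrite -(@ge0_integral_affine _ _ c 0)//; last exact: mKx.
  by apply: eq_integral => y _; rewrite addr0.
rewrite ge0_integralZl//; last first.
- by rewrite lee_fin invr_ge0 ltW.
- by move=> x _; exact: integral_ge0.
- by apply: (measurableT_comp mI); apply: measurable_funM.
have /= E := @ge0_integral_affine _ _ c 0 c0 mI (fun x => integral_ge0 _ (fun y _ => K0 _)).
transitivity ((c^-1)%:E * (c^-1)%:E * \int[mu]_x \int[mu]_y K (x, y))%E.
  rewrite -muleA -E; congr (_ * _)%E.
  by apply: eq_integral => x _; rewrite addr0.
by rewrite -EFinM -expr2 exprVn.
Qed.

Lemma gdens_rad a (p : RR) : gdens a p.1 p.2 = a / pi * expR (- a * cabs (zpair p) ^+ 2).
Proof. by rewrite sqr_cabs. Qed.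

Lemma cabs_zpair_scale (c : R) (p : RR) : 0 <= c ->
  cabs (zpair (c * p.1, c * p.2)) = c * cabs (zpair p).
Proof.
move=> c0; rewrite /cabs/= !exprMn -mulrDr sqrtrM ?sqr_ge0// sqrtr_sqr ger0_norm//.
Qed.

(** Dilation by [sqrt a] carries the density of parameter [1] to that of parameter [a]. *)
Lemma cmoment_scale a q : 0 < a -> cmoment a q = ((a `^ (- (q / 2)))%:E * cmoment 1 q)%E.
Proof.
move=> a0; pose c := Num.sqrt a.
have c0 : 0 < c by rewrite sqrtr_gt0.
have c2 : c ^+ 2 = a by rewrite sqr_sqrtr// ltW.
have g0 b p : 0 < b -> (0 <= (gdens b p.1 p.2 * cabs (zpair p) `^ q)%:E)%E.
  by move=> b0; rewrite lee_fin mulr_ge0 ?powR_ge0// gdens_ge0.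
have mE b : measurable_fun setT (fun p : RR => (gdens b p.1 p.2 * cabs (zpair p) `^ q)%:E).
  by apply/measurable_EFinP; exact: measurable_gdens_cabs.
have := ge0_integral_scale2 c0 (mE 1) (fun p => g0 1 p ltr01).
have -> : (fun p : RR => ((gdens 1 (c * p.1, c * p.2).1 (c * p.1, c * p.2).2 *
     cabs (zpair (c * p.1, c * p.2)) `^ q)%:E)) =
   (fun p : RR => (a^-1 * c `^ q)%:E * (gdens a p.1 p.2 * cabs (zpair p) `^ q)%:E)%E.
  apply/funext => p.
  rewrite -EFinM (gdens_rad a p) (gdens_rad 1 (c * p.1, c * p.2)) !cabs_zpair_scale ?(ltW c0)//.
  rewrite powRM ?cabs_ge0 ?(ltW c0)// exprMn c2 mulN1r mulNr.
  have := gt_eqF (@pi_gt0 R); move: (pi : R) => P P0; congr EFin; field.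
  by rewrite P0 gt_eqF.
rewrite ge0_integralZl//; last first.
- by rewrite lee_fin mulr_ge0 ?powR_ge0// invr_ge0 ltW.
- by move=> p _; exact: g0.
rewrite -/(cmoment a q) -/(cmoment 1 q) c2 => E.
have -> : cmoment a q = ((a * c `^ (- q))%:E * ((a^-1 * c `^ q)%:E * cmoment a q))%E.
  rewrite muleA -EFinM powRN mulrACA divff ?gt_eqF// mul1r.
  by rewrite mulVf ?mul1e// gt_eqF// powR_gt0.
rewrite E muleA -EFinM mulrAC mulfV ?gt_eqF// mul1r.
by rewrite /c -powR12_sqrt ?(ltW a0)// -powRrM; congr ((_ `^ _)%:E * _)%E; field.
Qed.

Lemma cmoment_ge0 a q : 0 < a -> (0 <= cmoment a q)%E.
Proof.
by move=> a0; apply: integral_ge0 => p _; rewrite lee_fin mulr_ge0 ?powR_ge0// gdens_ge0.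
Qed.

Lemma cmoment0 a : 0 < a -> cmoment a 0 = 1%E.
Proof.
move=> a0; rewrite cmoment_scale// mul0r oppr0 powRr0 mul1e.
have mg := @measurable_gauss_fun R.
rewrite /cmoment (fubini_tonelli1 (m1 := mu) (m2 := mu))//; last first.
- by move=> p; rewrite lee_fin mulr_ge0 ?powR_ge0// gdens_ge0.
- by apply/measurable_EFinP; exact: measurable_gdens_cabs.
have s0 : 0 <= (pi^-1 : R) by rewrite invr_ge0 pi_ge0.
transitivity (\int[mu]_x ((pi^-1 * Num.sqrt pi)%:E * (gauss_fun x)%:E))%E.
  apply: eq_integral => x _; rewrite /fubini_F/=.
  transitivity (\int[mu]_y ((pi^-1 * gauss_fun x)%:E * (gauss_fun y)%:E))%E.
    apply: eq_integral => y _; rewrite powRr0 mulr1 -EFinM /gdens /gauss_fun mulN1r.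
    by rewrite opprD expRD div1r mulrA.
  rewrite ge0_integralZl//; last first.
  - by rewrite lee_fin mulr_ge0 ?gauss_fun_ge0.
  - by move=> y _; rewrite lee_fin gauss_fun_ge0.
  - exact/measurable_EFinP.
  by rewrite integralT_gauss -!EFinM mulrAC.
rewrite ge0_integralZl//; last first.
- by rewrite lee_fin mulr_ge0.
- by move=> y _; rewrite lee_fin gauss_fun_ge0.
- exact/measurable_EFinP.
by rewrite integralT_gauss -EFinM -mulrA -expr2 sqr_sqrtr ?pi_ge0// mulVf// gt_eqF ?pi_gt0.
Qed.

(** The constant is the exact maximum of [q ln r - r^2 / 2], attained at [r^2 = q]; the inequality
    is [ln (1 + x) <= x] at [x = r^2 / q - 1]. *)
Lemma powR_le_exp_sqr (q r : R) : 0 <= q -> 0 <= r ->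
  r `^ q <= expR (q / 2 * (ln q - 1)) * expR (r ^+ 2 / 2).
Proof.
rewrite le_eqVlt => /predU1P[<-|q0] r0.
  rewrite powRr0 !mul0r expR0 mul1r -expR0 ler_expR.
  by rewrite divr_ge0// sqr_ge0.
move: r0; rewrite le_eqVlt => /predU1P[<-|r0].
  by rewrite powR0 ?gt_eqF// mulr_ge0 ?expR_ge0.
rewrite /powR gt_eqF// -expRD ler_expR.
have r2 : 0 < r ^+ 2 / q by rewrite divr_gt0 ?exprn_gt0.
have := le_ln1Dx (x := r ^+ 2 / q - 1); rewrite ltrBrDl subrr => /(_ r2).
rewrite subrKC ln_div ?posrE ?exprn_gt0// lnXn// => h.
have -> : q * ln r = q / 2 * (2 * ln r) by field.
have -> : q / 2 * (ln q - 1) + r ^+ 2 / 2 = q / 2 * (ln q - 1 + r ^+ 2 / q).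
  by field; rewrite gt_eqF.
by rewrite ler_pM2l ?divr_gt0//; lra.
Qed.

Lemma cmoment_lty a q : 0 < a -> 0 <= q -> (cmoment a q < +oo)%E.
Proof.
move=> a0 q0; rewrite cmoment_scale//.
suff : (cmoment 1 q < +oo)%E.
  move=> h; rewrite lte_mul_pinfty ?lee_fin ?powR_ge0//.
(* Half of the Gaussian exponent absorbs [r^q] and leaves the density of parameter [1/2]; the factor
   [2] corrects its normalisation. *)
pose C := expR (q / 2 * (ln q - 1)) * 2.
have C0 : 0 <= C by rewrite mulr_ge0 ?expR_ge0.
have h0 : 0 < 2^-1 :> R by rewrite invr_gt0.
apply: (@le_lt_trans _ _ (C%:E * cmoment 2^-1 0)%E); last by rewrite cmoment0// mule1 ltry.
rewrite -ge0_integralZl//; last 2 first.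
- by apply/measurable_EFinP; exact: measurable_gdens_cabs.
- by move=> p _; rewrite lee_fin mulr_ge0 ?powR_ge0// gdens_ge0.
apply: ge0_le_integral => //.
- by move=> p _; rewrite lee_fin mulr_ge0 ?powR_ge0// gdens_ge0.
- by apply/measurable_EFinP; exact: measurable_gdens_cabs.
- apply: emeasurable_funM => //.
  by apply/measurable_EFinP; exact: measurable_gdens_cabs.
move=> p _; rewrite -EFinM lee_fin powRr0 mulr1 !gdens_rad.
apply: (@le_trans _ _ (1 / pi * expR (- 1 * cabs (zpair p) ^+ 2) *
  (expR (q / 2 * (ln q - 1)) * expR (cabs (zpair p) ^+ 2 / 2)))).
  by rewrite ler_pM2l ?powR_le_exp_sqr ?cabs_ge0// mulr_gt0 ?divr_gt0 ?pi_gt0 ?expR_gt0.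
rewrite le_eqVlt; apply/orP; left; apply/eqP; rewrite /C.
have -> : expR (- 2^-1 * cabs (zpair p) ^+ 2) =
    expR (- 1 * cabs (zpair p) ^+ 2) * expR (cabs (zpair p) ^+ 2 / 2).
  by rewrite -expRD; congr expR; field.
by have := gt_eqF (@pi_gt0 R); move: (pi : R) => P P0; field; rewrite P0.
Qed.

(** On the rectangle [[1, 2] x [0, 1]] the modulus is at least [1] and the density is at least its
    value at the corner [(2, 1)]. *)
Lemma cmoment_gt0 a q : 0 < a -> 0 <= q -> (0 < cmoment a q)%E.
Proof.
move=> a0 q0.
pose A : set RT := `[1, 2]%classic; pose B : set RT := `[0, 1]%classic.
have mAB : measurable (A `*` B) by apply: measurableX; exact: measurable_itv.
pose k := gdens a 2 1; have k0 : 0 < k by exact: gdens_gt0.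
apply: (@lt_le_trans _ _ (\int[m2]_p (k%:E * (\1_(A `*` B) p)%:E))%E).
  rewrite ge0_integralZl//; last first.
  - by rewrite lee_fin ltW.
  - exact/measurable_EFinP.
  have -> : (\int[m2]_p (\1_(A `*` B) p)%:E = mu A * mu B)%E.
    by rewrite integral_indic// setIT; apply: product_measure1E; exact: measurable_itv.
  have l12 : (1 : R) < 2 by lra.
  rewrite !lebesgue_measure_itv/= !lte_fin ltr01 l12 -!EFinB -!EFinM lte_fin.
  by rewrite mulr_gt0// subr0 mulr1 subr_gt0.
apply: ge0_le_integral => //.
- by move=> p _; rewrite mule_ge0// lee_fin// ltW.
- by apply: emeasurable_funM => //; exact/measurable_EFinP.
- by apply/measurable_EFinP; exact: measurable_gdens_cabs.
move=> p _; rewrite -EFinM lee_fin indicE; case: (boolP (p \in _)) => [|_]; last first.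
  by rewrite mulr0 mulr_ge0 ?powR_ge0// gdens_ge0.
rewrite inE => -[]; rewrite /A /B /= !in_itv/= => /andP[x1 x2] /andP[y0 y1].
rewrite ler_pM// ?(ltW k0)//.
  rewrite /k /gdens ler_pM2l ?divr_gt0 ?pi_gt0// ler_expR !mulNr lerN2 ler_pM2l// lerD//.
    by rewrite ler_sqr ?nnegrE//; lra.
  by rewrite ler_sqr ?nnegrE//; lra.
rewrite -[leLHS](powRr0 (cabs (zpair p))); apply: ler_powR => //.
rewrite -[leLHS]sqrtr1 ler_sqrt ?addr_ge0 ?sqr_ge0//=.
have : 1 <= p.1 ^+ 2 by rewrite expr_ge1//; lra.
by have := sqr_ge0 p.2; lra.
Qed.

Lemma cmoment_fin a q : 0 < a -> 0 <= q -> cmoment a q \is a fin_num.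
Proof. by move=> a0 q0; rewrite ge0_fin_numE ?cmoment_ge0 ?cmoment_lty. Qed.

End Moments.

(** * Functional equation and log-convexity of the moments *)

Section MomentRecurrence.
Variable R : realType.
Local Notation RT := (measurableTypeR R).
Local Notation RR := (RT * RT)%type.
Local Notation mu := (@lebesgue_measure R).
Local Notation m2 := (mu \x mu)%E.
Implicit Types (a q : R).

(** Read [m'] as minus the derivative at [b = 1] of [b^(-s) m]. The two families of inequalities
    bound it from both sides by difference quotients, which replaces a differentiation under the
    integral sign. *)
Lemma powR_difference_quotient (s m m' : R) : 0 < s -> 0 <= m -> 0 <= m' ->
  (forall h, 0 < h -> h < 1 -> m + h * m' <= (1 - h) `^ (- s) * m) ->
  (forall h, 0 < h -> m <= (1 + h) `^ (- s) * m + h * m') -> m' = s * m.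
Proof.
move=> s0 m0 m'0 key2 key.
have up h : 0 < h -> (1 + s) * h < 1 -> m' <= s * m + h * ((1 + s) * m').
  move=> h0 h1; have sh0 : 0 < s * h by rewrite mulr_gt0.
  have b0 : 0 < 1 - h by lra.
  have h11 : h < 1 by lra.
  have := key2 h h0 h11.
  have -> : (1 - h) `^ (- s) = expR (- s * ln (1 - h)) by rewrite /powR gt_eqF.
  move=> H.
  (* The power is bounded by a rational function: [- ln (1 - h) <= h / (1 - h)], then
     [e^y <= 1 / (1 - y)]. *)
  pose y := s * h / (1 - h).
  have y1 : y < 1 by rewrite /y ltr_pdivrMr//; lra.
  have ey : expR (- s * ln (1 - h)) <= (1 - y)^-1.
    apply: (@le_trans _ _ (expR y)).
      rewrite ler_expR mulNr -mulrN /y -mulrA ler_pM2l// -lnV ?posrE//.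
      have := le_ln1Dx (x := (1 - h)^-1 - 1); rewrite subrKC.
      have -> : h / (1 - h) = (1 - h)^-1 - 1 by field; rewrite gt_eqF.
      by apply; rewrite ltrBrDl subrr invr_gt0.
    rewrite -[leLHS]invrK -expRN lef_pV2 ?posrE ?expR_gt0 ?subr_gt0//.
    exact: expR_ge1Dx.
  have H2 : m + h * m' <= (1 - y)^-1 * m by apply: (le_trans H); rewrite ler_wpM2r.
  have yE : (1 - y)^-1 = (1 - h) / (1 - h - s * h).
    by rewrite /y; field; rewrite !gt_eqF//; lra.
  move: H2; rewrite yE mulrAC ler_pdivlMr => [H2|]; last lra.
  have : h * m' * (1 - h - s * h) <= h * (s * m) by lra.
  by rewrite -mulrA ler_pM2l// => H4; lra.
have lo h : 0 < h -> s * m <= m' + h * ((1 + s) * m').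
  move=> h0; have sh0 : 0 < s * h by rewrite mulr_gt0.
  have b0 : 0 < 1 + h by lra.
  have := key h h0.
  have -> : (1 + h) `^ (- s) = expR (- s * ln (1 + h)) by rewrite /powR gt_eqF.
  move=> H.
  (* Likewise from [h / (1 + h) <= ln (1 + h)] and [1 + y <= e^y]. *)
  pose y := s * h / (1 + h).
  have y0 : 0 <= y by rewrite divr_ge0// ltW.
  have ey : expR (- s * ln (1 + h)) <= (1 + y)^-1.
    rewrite mulNr expRN lef_pV2 ?posrE ?expR_gt0 ?ltr_pwDl//.
    apply: le_trans (expR_ge1Dx _) _; rewrite ler_expR /y -mulrA ler_pM2l//.
    have := le_ln1Dx (x := (1 + h)^-1 - 1); rewrite subrKC lnV ?posrE//.
    have -> : h / (1 + h) = 1 - (1 + h)^-1 by field; rewrite gt_eqF.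
    by rewrite ltrBrDl subrr invr_gt0 => /(_ b0); lra.
  have H2 : m <= (1 + y)^-1 * m + h * m'.
    by apply: (le_trans H); rewrite lerD2r ler_wpM2r.
  have yE : (1 + y)^-1 = (1 + h) / (1 + h + s * h).
    by rewrite /y; field; rewrite !gt_eqF//; lra.
  have d0 : 0 < 1 + h + s * h by lra.
  have H3 : m * (1 + h + s * h) <= (1 + h) * m + h * m' * (1 + h + s * h).
    have := ler_wpM2r (ltW d0) H2; rewrite yE => /le_trans; apply.
    rewrite le_eqVlt; apply/orP; left; apply/eqP.
    by field; rewrite gt_eqF.
  have : h * (s * m) <= h * m' * (1 + h + s * h) by lra.
  by rewrite -mulrA ler_pM2l// => H4; lra.
have d0 e : 0 < e -> exists h, [/\ 0 < h, (1 + s) * h < 1 & h * ((1 + s) * m') <= e].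
  move=> e0; have k0 : 0 < (1 + s) * (m' + 1) by rewrite mulr_gt0//; lra.
  exists (Num.min ((1 + s)^-1 / 2) (e / ((1 + s) * (m' + 1)))); split.
  - by rewrite lt_min !divr_gt0// invr_gt0; lra.
  - rewrite mulrC -ltr_pdivlMr; last lra.
    by rewrite mul1r gt_min; apply/orP; left; rewrite ltr_pdivrMr// ltr_pMr ?invr_gt0; lra.
  - apply: (@le_trans _ _ (e / ((1 + s) * (m' + 1)) * ((1 + s) * m'))).
      by rewrite ler_wpM2r ?mulr_ge0// ?ge_min ?lexx ?orbT//; lra.
    rewrite mulrAC ler_pdivrMr// ler_pM2l// ler_pM2l; lra.
apply/eqP; rewrite eq_le; apply/andP; split; apply/ler_addgt0Pr => e e0.
  by have [h [h0 h1 h2]] := d0 e e0; apply: le_trans (up h h0 h1) _; rewrite lerD2l.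
by have [h [h0 h1 h2]] := d0 e e0; apply: le_trans (lo h h0) _; rewrite lerD2l.
Qed.

(* Evaluates [pi^-1 * int r^q exp (- a r^2)] in terms of the moment at [a = 1]. *)
Let exp_moment a q : 0 < a ->
  (\int[m2]_p ((pi^-1 * expR (- a * cabs (zpair p) ^+ 2)) * cabs (zpair p) `^ q)%:E =
   (a `^ (- (q / 2 + 1)))%:E * cmoment 1 q)%E.
Proof.
move=> a0; transitivity ((a^-1)%:E * cmoment a q)%E.
  rewrite /cmoment -ge0_integralZl//; last first.
  - by rewrite lee_fin invr_ge0 ltW.
  - by move=> p _; rewrite lee_fin mulr_ge0 ?powR_ge0// gdens_ge0.
  - by apply/measurable_EFinP; exact: measurable_gdens_cabs.
  apply: eq_integral => p _; rewrite -EFinM gdens_rad !mulrA; congr (_ * _ * _)%:E.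
  by rewrite mulVf ?gt_eqF// mul1r.
rewrite cmoment_scale// muleA -EFinM; congr (_%:E * _)%E.
by rewrite opprD powRD ?(gt_eqF a0) ?implybT// powR_inv1 ?(ltW a0)// mulrC.
Qed.

(** The functional equation of Gamma. By scaling, the integral of [r^q e^(- b r^2)] against [1/pi]
    is [b^(-s)] times its value at [b = 1], with [s = q/2 + 1], and the moment of order [q + 2] is
    minus its derivative there. *)
Lemma cmoment_step q : 0 <= q ->
  fine (cmoment 1 (q + 2)) = (q / 2 + 1) * fine (cmoment 1 q).
Proof.
move=> q0; have q20 : 0 <= q + 2 by rewrite addr_ge0.
pose m := fine (cmoment 1 q); pose m' := fine (cmoment 1 (q + 2)).
pose s := q / 2 + 1.
have s0 : 0 < s by rewrite /s; apply: ltr_wpDl => //; rewrite divr_ge0.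
have m0 : 0 <= m by rewrite fine_ge0 ?cmoment_ge0.
have m'0 : 0 <= m' by rewrite fine_ge0 ?cmoment_ge0.
have mE : cmoment 1 q = m%:E by rewrite fineK// cmoment_fin.
have m'E : cmoment 1 (q + 2) = m'%:E by rewrite fineK// cmoment_fin.
pose I b (p : RR) := (pi^-1 * expR (- b * cabs (zpair p) ^+ 2)) * cabs (zpair p) `^ q.
have I0 b p : 0 <= I b p by rewrite !mulr_ge0 ?powR_ge0 ?expR_ge0 ?invr_ge0 ?pi_ge0.
have mI b : measurable_fun setT (I b).
  apply: measurable_funM; last exact: measurable_cabs_powR.
  apply: measurable_funM => //; apply: measurableT_comp => //.
  by apply: measurable_funM => //; apply: measurable_funX; exact: measurable_cabs_zpair.
have intI b : 0 < b -> (\int[m2]_p (I b p)%:E = (b `^ (- s) * m)%:E)%E.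
  by move=> b0; rewrite exp_moment// mE EFinM.
have g1 p : gdens 1 p.1 p.2 * cabs (zpair p) `^ (q + 2) = I 1 p * cabs (zpair p) ^+ 2.
  rewrite /I gdens_rad div1r powRD ?powR_mulrn ?cabs_ge0 ?mulrA//.
  by apply/implyP => /eqP; lra.
have key b h : 0 < b -> 0 <= h -> (forall p, I 1 p <= I b p + h * (I 1 p * cabs (zpair p) ^+ 2)) ->
    m <= b `^ (- s) * m + h * m'.
  move=> b0 h0 H; rewrite -lee_fin EFinD (EFinM h) -m'E -intI//.
  have -> : m = 1 `^ (- s) * m by rewrite powR1 mul1r.
  rewrite -intI// -ge0_integralZl//; last 2 first.
  - by apply/measurable_EFinP; exact: measurable_gdens_cabs.
  - by move=> p _; rewrite lee_fin mulr_ge0 ?powR_ge0// gdens_ge0.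
  have mh : measurable_fun setT (fun p : RR => (h%:E * (gdens 1 p.1 p.2 * cabs (zpair p) `^ (q + 2))%:E)%E).
    by apply: emeasurable_funM => //; apply/measurable_EFinP; exact: measurable_gdens_cabs.
  rewrite -ge0_integralD//; last 3 first.
  - by move=> p _; rewrite lee_fin.
  - exact/measurable_EFinP.
  - by move=> p _; rewrite mule_ge0 ?lee_fin// mulr_ge0 ?powR_ge0// gdens_ge0.
  apply: ge0_le_integral => //.
  - by move=> p _; rewrite lee_fin.
  - exact/measurable_EFinP.
  - by apply: emeasurable_funD => //; exact/measurable_EFinP.
  by move=> p _; rewrite -EFinM -EFinD lee_fin g1 H.
have key2 b h : 0 < b -> 0 <= h -> (forall p, I 1 p + h * (I 1 p * cabs (zpair p) ^+ 2) <= I b p) ->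
    m + h * m' <= b `^ (- s) * m.
  move=> b0 h0 H; rewrite -lee_fin EFinD (EFinM h) -m'E -intI//.
  have -> : m = 1 `^ (- s) * m by rewrite powR1 mul1r.
  rewrite -intI// -ge0_integralZl//; last 2 first.
  - by apply/measurable_EFinP; exact: measurable_gdens_cabs.
  - by move=> p _; rewrite lee_fin mulr_ge0 ?powR_ge0// gdens_ge0.
  have mh : measurable_fun setT (fun p : RR => (h%:E * (gdens 1 p.1 p.2 * cabs (zpair p) `^ (q + 2))%:E)%E).
    by apply: emeasurable_funM => //; apply/measurable_EFinP; exact: measurable_gdens_cabs.
  rewrite -ge0_integralD//; last 3 first.
  - by move=> p _; rewrite lee_fin.
  - exact/measurable_EFinP.
  - by move=> p _; rewrite mule_ge0 ?lee_fin// mulr_ge0 ?powR_ge0// gdens_ge0.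
  apply: ge0_le_integral => //.
  - by move=> p _; rewrite adde_ge0 ?mule_ge0 ?lee_fin// mulr_ge0 ?powR_ge0// gdens_ge0.
  - by apply: emeasurable_funD => //; exact/measurable_EFinP.
  - exact/measurable_EFinP.
  by move=> p _; rewrite -EFinM -EFinD lee_fin g1 H.
have Ib b p : I b p = I 1 p * expR ((1 - b) * cabs (zpair p) ^+ 2).
  rewrite /I; have -> : expR (- b * cabs (zpair p) ^+ 2) =
      expR (- 1 * cabs (zpair p) ^+ 2) * expR ((1 - b) * cabs (zpair p) ^+ 2).
    by rewrite -expRD; congr expR; ring.
  by rewrite mulrA mulrAC.
(* [up] and [lo] are [1 + x <= e^x] at [x = h |z|^2] and [x = - h |z|^2]. *)
have up p h : I 1 p + h * (I 1 p * cabs (zpair p) ^+ 2) <= I (1 - h) p.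
  rewrite (Ib (1 - h)) -{1}[I 1 p]mulr1 mulrCA -mulrDr ler_wpM2l//.
  by rewrite opprB subrKC; exact: expR_ge1Dx.
have lo p h : I 1 p <= I (1 + h) p + h * (I 1 p * cabs (zpair p) ^+ 2).
  rewrite (Ib (1 + h)) -{1}[I 1 p]mulr1 [X in _ + X]mulrCA -mulrDr ler_wpM2l//.
  by rewrite opprD addrA subrr add0r mulNr -lerBlDr; exact: expR_ge1Dx.
rewrite -/m -/m' -/s.
apply: (powR_difference_quotient s0 m0 m'0) => [h h0 h1|h h0].
  by apply: key2; [rewrite subr_gt0|exact: ltW|move=> p; exact: up].
by apply: key; [rewrite addr_gt0|exact: ltW|move=> p; exact: lo].
Qed.

Lemma powR_amgm (t A B : R) : 0 < t -> t < 1 -> 0 <= A -> 0 <= B ->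
  A `^ t * B `^ (1 - t) <= t * A + (1 - t) * B.
Proof.
move=> t0 t1 A0 B0; have t10 : 0 < 1 - t by rewrite subr_gt0.
have ti : 0 < t^-1 by rewrite invr_gt0.
have t1i : 0 < (1 - t)^-1 by rewrite invr_gt0.
have e1 : t^-1^-1 + (1 - t)^-1^-1 = 1 by rewrite !invrK subrKC.
have := conjugate_powR (powR_ge0 A t) (powR_ge0 B (1 - t)) ti t1i e1.
rewrite -!powRrM !mulfV ?(gt_eqF t0) ?(gt_eqF t10)// !invrK !powRr1//.
by rewrite [A * t]mulrC [B * _]mulrC.
Qed.

Lemma powR_convex_comb (t q1 q2 r : R) : 0 < t -> t < 1 -> 0 <= q1 -> 0 <= q2 ->
  r `^ (t * q1 + (1 - t) * q2) = (r `^ q1) `^ t * (r `^ q2) `^ (1 - t).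
Proof.
move=> t0 t1 q10 q20; have t10 : 0 < 1 - t by rewrite subr_gt0.
rewrite -!powRrM [q1 * t]mulrC [q2 * _]mulrC.
have h1 : 0 <= t * q1 by rewrite mulr_ge0// ltW.
have h2 : 0 <= (1 - t) * q2 by rewrite mulr_ge0// ltW.
have [s0|s0] := eqVneq (t * q1 + (1 - t) * q2) 0; last by rewrite powRD// (negPf s0).
have -> : t * q1 = 0 by lra.
have -> : (1 - t) * q2 = 0 by lra.
by rewrite addr0 powRr0 mulr1.
Qed.

(** Weighted arithmetic-geometric mean of [r^q1 / m1] and [r^q2 / m2]. When [m1] and [m2] are the
    moments of orders [q1] and [q2], the last factor integrates to [t + (1 - t) = 1], which gives
    Hölder's inequality. *)
Lemma weighted_young (t m1 m2 q1 q2 r : R) : 0 < t -> t < 1 -> 0 < m1 -> 0 < m2 ->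
  0 <= q1 -> 0 <= q2 ->
  r `^ (t * q1 + (1 - t) * q2) <=
  m1 `^ t * m2 `^ (1 - t) * (t / m1 * r `^ q1 + (1 - t) / m2 * r `^ q2).
Proof.
move=> t0 t1 m10 m20 q10 q20.
have i1 : 0 <= m1^-1 by rewrite invr_ge0 ltW.
have i2 : 0 <= m2^-1 by rewrite invr_ge0 ltW.
have A0 : 0 <= r `^ q1 / m1 by rewrite mulr_ge0 ?powR_ge0.
have B0 : 0 <= r `^ q2 / m2 by rewrite mulr_ge0 ?powR_ge0.
have := powR_amgm t0 t1 A0 B0.
have k0 : 0 < m1 `^ t * m2 `^ (1 - t) by rewrite mulr_gt0 ?powR_gt0.
rewrite -(ler_pM2l k0).
rewrite powR_convex_comb//.
have -> : m1 `^ t * m2 `^ (1 - t) * ((r `^ q1 / m1) `^ t * (r `^ q2 / m2) `^ (1 - t)) =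
    (r `^ q1) `^ t * (r `^ q2) `^ (1 - t).
  rewrite mulrACA -(powRM t (ltW m10) A0) -(powRM (1 - t) (ltW m20) B0).
  by rewrite !(mulrC m1) !(mulrC m2) !divfK ?(gt_eqF m10) ?(gt_eqF m20).
move=> /le_trans; apply; rewrite ler_pM2l// le_eqVlt; apply/orP; left; apply/eqP.
by ring.
Qed.

Lemma cmoment_logconvex (t q1 q2 : R) : 0 < t -> t < 1 -> 0 <= q1 -> 0 <= q2 ->
  fine (cmoment 1 (t * q1 + (1 - t) * q2)) <=
  fine (cmoment 1 q1) `^ t * fine (cmoment 1 q2) `^ (1 - t).
Proof.
move=> t0 t1 q10 q20; have t10 : 0 < 1 - t by rewrite subr_gt0.
have q0 : 0 <= t * q1 + (1 - t) * q2 by rewrite addr_ge0 ?mulr_ge0// ltW.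
have pos q : 0 <= q -> exists2 m, 0 < m & cmoment 1 q = m%:E.
  move=> q'0; exists (fine (cmoment 1 q)); last by rewrite fineK// cmoment_fin.
  by rewrite fine_gt0// cmoment_gt0//= cmoment_lty.
have [m1 m10 m1E] := pos q1 q10; have [m2' m20 m2E] := pos q2 q20.
have young r := @weighted_young t m1 m2' q1 q2 r t0 t1 m10 m20 q10 q20.
rewrite -lee_fin fineK ?cmoment_fin// m1E m2E /=.
have mq b : measurable_fun setT (fun p : RR => (gdens 1 p.1 p.2 * cabs (zpair p) `^ b)%:E).
  by apply/measurable_EFinP; exact: measurable_gdens_cabs.
have gq b (p : RR) : (0 <= (gdens 1 p.1 p.2 * cabs (zpair p) `^ b)%:E)%E.
  by rewrite lee_fin mulr_ge0 ?powR_ge0// gdens_ge0.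
have A0 : 0 < m1 `^ t * m2' `^ (1 - t) by rewrite mulr_gt0 ?powR_gt0.
move: (m1 `^ t * m2' `^ (1 - t)) A0 young => A A0 young.
have c1 : 0 <= A * (t / m1) by rewrite mulr_ge0 ?divr_ge0// ltW.
have c2 : 0 <= A * ((1 - t) / m2') by rewrite mulr_ge0 ?divr_ge0// ltW.
have -> : A = A * (t / m1) * m1 + A * ((1 - t) / m2') * m2'.
  by field; rewrite (gt_eqF m10) (gt_eqF m20).
rewrite EFinD (EFinM _ m1) (EFinM _ m2') -m1E -m2E.
have I1 : ((A * (t / m1))%:E * cmoment 1 q1 =
    \int[m2]_p ((A * (t / m1))%:E * (gdens 1 p.1 p.2 * cabs (zpair p) `^ q1)%:E))%E.
  by rewrite ge0_integralZl.
have I2 : ((A * ((1 - t) / m2'))%:E * cmoment 1 q2 =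
    \int[m2]_p ((A * ((1 - t) / m2'))%:E * (gdens 1 p.1 p.2 * cabs (zpair p) `^ q2)%:E))%E.
  by rewrite ge0_integralZl.
rewrite I1 I2 -ge0_integralD//; last 4 first.
- by move=> p _; rewrite mule_ge0.
- by apply: emeasurable_funM.
- by move=> p _; rewrite mule_ge0.
- by apply: emeasurable_funM.
apply: ge0_le_integral => //.
- by apply: emeasurable_funD; apply: emeasurable_funM.
move=> p _; rewrite -!EFinM -EFinD lee_fin.
have -> : A * (t / m1) * (gdens 1 p.1 p.2 * cabs (zpair p) `^ q1) +
     A * ((1 - t) / m2') * (gdens 1 p.1 p.2 * cabs (zpair p) `^ q2) =
   gdens 1 p.1 p.2 * (A * (t / m1 * cabs (zpair p) `^ q1 + (1 - t) / m2' * cabs (zpair p) `^ q2)).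
  by move: (gdens _ _ _) => g; ring.
by rewrite ler_wpM2l ?gdens_ge0//; exact: young.
Qed.

End MomentRecurrence.

(** * Averages over circles *)

Section TorusAverage.
Variable R : realType.
Local Notation RT := (measurableTypeR R).
Local Notation RR := (RT * RT)%type.
Local Notation mu := (@lebesgue_measure R).
Local Notation m2 := (mu \x mu)%E.

Definition cis (t : R) : R[i] := cos t +i* sin t.

Definition rotc n (i : 'I_n) (c : R[i]) (z : 'I_n -> R[i]) : 'I_n -> R[i] :=
  fun k => if k == i then c * z k else z k.

Definition setc n (i : 'I_n) (c : R[i]) (z : 'I_n -> R[i]) : 'I_n -> R[i] :=
  fun k => if k == i then c else z k.

Lemma cabs_cis t : cabs (cis t) = 1.
Proof. by rewrite /cabs/= cos2Dsin2 sqrtr1. Qed.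

Lemma ccons0 n c (w : 'I_n -> R[i]) : ccons c w ord0 = c.
Proof. by rewrite /ccons unlift_none. Qed.

Lemma cconsS n c (w : 'I_n -> R[i]) i : ccons c w (lift ord0 i) = w i.
Proof. by rewrite /ccons liftK. Qed.

Lemma ccons_eta n (z : 'I_n.+1 -> R[i]) : ccons (z ord0) (z \o lift ord0) = z.
Proof.
apply/funext => i; case: (unliftP ord0 i) => [j|] ->; first by rewrite cconsS.
by rewrite ccons0.
Qed.

Lemma rotc_ccons0 n c d (w : 'I_n -> R[i]) : rotc ord0 c (ccons d w) = ccons (c * d) w.
Proof.
apply/funext => i; rewrite /rotc; case: (unliftP ord0 i) => [j|] ->.
  by rewrite !cconsS.
by rewrite !ccons0 eqxx.
Qed.

Lemma rotc_cconsS n i c d (w : 'I_n -> R[i]) :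
  rotc (lift ord0 i) c (ccons d w) = ccons d (rotc i c w).
Proof.
apply/funext => k; rewrite /rotc; case: (unliftP ord0 k) => [j|] ->.
  by rewrite !cconsS (inj_eq lift_inj).
by rewrite !ccons0.
Qed.

Lemma setc_ccons0 n c d (w : 'I_n -> R[i]) : setc ord0 c (ccons d w) = ccons c w.
Proof.
apply/funext => i; rewrite /setc; case: (unliftP ord0 i) => [j|] ->.
  by rewrite !cconsS.
by rewrite !ccons0 eqxx.
Qed.

Lemma setc_cconsS n i c d (w : 'I_n -> R[i]) :
  setc (lift ord0 i) c (ccons d w) = ccons d (setc i c w).
Proof.
apply/funext => k; rewrite /setc; case: (unliftP ord0 k) => [j|] ->.
  by rewrite !cconsS (inj_eq lift_inj).
by rewrite !ccons0.
Qed.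

Lemma measurable_cos : measurable_fun setT (cos : RT -> RT).
Proof. by apply: continuous_measurable_fun => x; exact: continuous_cos. Qed.

Lemma measurable_sin : measurable_fun setT (sin : RT -> RT).
Proof. by apply: continuous_measurable_fun => x; exact: continuous_sin. Qed.

Lemma pmeasurable_rotc n (i : 'I_n) d (T : measurableType d) (F : ('I_n -> R[i]) -> T) :
  cmeasurable F -> pmeasurable (fun t : RT => fun z => F (rotc i (cis t) z)).
Proof.
move=> mF d' S phi x y mphi mx my.
have mc : measurable_fun setT (fun s => cos (phi s) : RT) by exact: measurableT_comp measurable_cos mphi.
have ms : measurable_fun setT (fun s => sin (phi s) : RT) by exact: measurableT_comp measurable_sin mphi.
pose X k s : RT := if k == i then cos (phi s) * x k s - sin (phi s) * y k s else x k s.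
pose Y k s : RT := if k == i then cos (phi s) * y k s + sin (phi s) * x k s else y k s.
have -> : (fun s => F (rotc i (cis (phi s)) (fun k => x k s +i* y k s))) =
    (fun s => F (fun k => X k s +i* Y k s)).
  apply/funext => s; congr F; apply/funext => k; rewrite /rotc /X /Y.
  by case: (k == i).
apply: mF => k; rewrite /X /Y; case: (k == i) => //=.
  apply: measurable_funB; apply: measurable_funM => //; [exact: mx|exact: my].
apply: measurable_funD; apply: measurable_funM => //; [exact: my|exact: mx].
Qed.

(** The density is radial. Only the first coordinate is rotated: it is the outermost variable of the
    iterated integral, and the others are reached by induction. *)
Lemma gintE_rotc0 (a : R) n t (F : ('I_n.+1 -> R[i]) -> \bar R) : 0 < a ->
  cmeasurable F -> (forall z, 0 <= F z)%E ->
  gintE a (fun z => F (rotc ord0 (cis t) z)) = gintE a F.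
Proof.
move=> a0 mF F0 /=.
have mK := cmeasurable_gintE_slice a0 mF F0.
have K0 (p : RR) : (0 <= (gdens a p.1 p.2)%:E * gintE a (fun w => F (ccons (zpair p) w)))%E.
  by rewrite mule_ge0 ?lee_fin ?gdens_ge0// gintE_ge0.
have := ge0_integral_rotation (cos2Dsin2 t) mK K0.
move=> <-; apply: eq_integral => x _; apply: eq_integral => y _ /=.
congr (_ * _)%E; last first.
  congr gintE; apply/funext => w; rewrite rotc_ccons0; congr (F (ccons _ w)).
  by rewrite /zpair /cis/=; congr (_ +i* _); rewrite addrC.
congr EFin; rewrite /gdens; congr (_ * expR (- a * _)).
transitivity ((cos t ^+ 2 + sin t ^+ 2) * (x ^+ 2 + y ^+ 2)); last by ring.
by rewrite cos2Dsin2 mul1r.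
Qed.

(** The law of the angle, kept abstract until it becomes uniform on [[0, 2 pi]] in [circle_prob]. *)
Variable nu : probability RT R.

Let nu1 : nu setT = 1%E := probability_setT nu.

Lemma gintE_avg (a : R) n (F : ('I_n.+1 -> R[i]) -> \bar R) : 0 < a ->
  cmeasurable F -> (forall z, 0 <= F z)%E ->
  gintE a (fun z => \int[nu]_t F (rotc ord0 (cis t) z))%E = gintE a F.
Proof.
move=> a0 mF F0.
rewrite (gintE_tonelli a0 nu (pmeasurable_rotc ord0 mF))//.
have -> : (\int[nu]_t gintE a (fun z => F (rotc ord0 (cis t) z)) =
    \int[nu]_t (cst (gintE a F)) t)%E.
  by apply: eq_integral => t _; rewrite gintE_rotc0.
by rewrite integral_cst//= nu1 mule1.
Qed.

Lemma bounded_integrable (f : RT -> R) (M : R) : measurable_fun setT f ->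
  (forall t, `|f t| <= M) -> nu.-integrable setT (EFin \o f).
Proof.
move=> mf fM; apply: measurable_bounded_integrable => //.
  by rewrite /= nu1 ltry.
exists M; split; first exact: num_real.
by move=> x Mx t _; exact: le_trans (fM t) (ltW Mx).
Qed.

Lemma EFin_Rintegral (f : RT -> R) (M : R) : measurable_fun setT f ->
  (forall t, `|f t| <= M) -> (Rintegral nu setT f)%:E = (\int[nu]_t (f t)%:E)%E.
Proof.
move=> mf fM; rewrite /Rintegral fineK//.
exact: (integrable_fin_num measurableT (bounded_integrable mf fM)).
Qed.

Lemma Rintegral_bound (f : RT -> R) (M : R) : measurable_fun setT f ->
  (forall t, `|f t| <= M) -> `|Rintegral nu setT f| <= M.
Proof.
move=> mf fM; apply: le_trans (le_normr_Rintegral measurableT (bounded_integrable mf fM)) _.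
apply: (@le_trans _ _ (Rintegral nu setT (cst M))); last first.
  by rewrite Rintegral_cst//= nu1 mulr1.
apply: le_Rintegral => //.
- apply: (@bounded_integrable _ M); first exact: measurableT_comp.
  by move=> t; rewrite normr_id.
- by apply: (@bounded_integrable _ `|M|).
Qed.

Lemma Rintegral_swap (f : RR -> R) (M : R) : measurable_fun setT f ->
  (forall p, `|f p| <= M) ->
  Rintegral nu setT (fun s => Rintegral nu setT (fun t => f (s, t))) =
  Rintegral nu setT (fun t => Rintegral nu setT (fun s => f (s, t))).
Proof.
move=> mf fM.
have m1 s : measurable_fun setT (fun t : RT => f (s, t)).
  by apply: measurableT_comp => //; exact: measurable_fun_pair.
have m2' t : measurable_fun setT (fun s : RT => f (s, t)).
  by apply: measurableT_comp => //; exact: measurable_fun_pair.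
have mE : measurable_fun setT (EFin \o f) by apply/measurable_EFinP.
congr fine.
under eq_integral => s _ do rewrite (EFin_Rintegral (m1 s) (fun t => fM (s, t))).
under [RHS]eq_integral => t _ do rewrite (EFin_Rintegral (m2' t) (fun s => fM (s, t))).
apply: (@Fubini _ _ _ _ R nu nu (EFin \o f)).
apply/integrable12ltyP => //.
apply: (@le_lt_trans _ _ (\int[nu]_x \int[nu]_y (cst M%:E (x, y))))%E; last first.
  under eq_integral do rewrite integral_cst//= nu1 mule1.
  by rewrite integral_cst//= nu1 mule1 ltry.
have mA : measurable_fun setT (fun p : RR => `|(f p)%:E|%E).
  by apply: measurableT_comp.
apply: ge0_le_integral => //.
- by move=> x _; exact: integral_ge0.
- exact: (measurable_fun_fubini_tonelli_F (m2 := nu) _ mA (fun=> abse_ge0 _)).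
- rewrite (_ : (fun x => _) = cst M%:E); first exact: measurable_cst.
  by apply/funext => x; rewrite integral_cst//= nu1 mule1.
- move=> x _; apply: ge0_le_integral => //.
  + by apply: measurableT_comp => //; apply/measurable_EFinP; exact: m1.
  + by move=> y _; rewrite /= lee_fin.
Qed.

(** The graph of [x^p] lies above its tangent at the mean [m]; this tangent inequality is Young's
    inequality for [f t] and [m^(p-1)], and it is then integrated. *)
Lemma jensen_powR (f : RT -> R) (M p : R) : 1 < p -> measurable_fun setT f ->
  (forall t, 0 <= f t) -> (forall t, f t <= M) ->
  (((Rintegral nu setT f) `^ p)%:E <= \int[nu]_t (f t `^ p)%:E)%E.
Proof.
move=> p1 mf f0 fM; set m := Rintegral nu setT f.
have p0 : 0 < p by lra.
have fM' t : `|f t| <= M by rewrite ger0_norm.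
have m0 : 0 <= m by exact: Rintegral_ge0.
have mfp : measurable_fun setT (fun t => f t `^ p).
  exact: (measurableT_comp (measurable_powR p) mf).
have fpM t : `|f t `^ p| <= M `^ p.
  rewrite ger0_norm ?powR_ge0// ge0_ler_powR ?nnegrE ?f0 ?(ltW p0)//.
  exact: le_trans (fM t).
rewrite -(EFin_Rintegral mfp fpM) lee_fin.
have q0 : 0 < p / (p - 1) by rewrite divr_gt0//; lra.
have pq : p^-1 + (p / (p - 1))^-1 = 1 by field; rewrite !gt_eqF//; lra.
have yg t : p * m `^ (p - 1) * f t <= f t `^ p + (p - 1) * m `^ p.
  have := conjugate_powR (f0 t) (powR_ge0 m (p - 1)) p0 q0 pq.
  rewrite -powRrM (_ : (p - 1) * (p / (p - 1)) = p); last by field; rewrite gt_eqF//; lra.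
  rewrite -(ler_pM2l p0) mulrDr.
  rewrite (_ : p * (f t `^ p / p) = f t `^ p); last by field; rewrite gt_eqF.
  rewrite (_ : p * (m `^ p / (p / (p - 1))) = (p - 1) * m `^ p); last first.
    by field; rewrite !gt_eqF//; lra.
  by rewrite mulrAC -mulrA.
have if_ := bounded_integrable mf fM'; have ifp := bounded_integrable mfp fpM.
have icst (k : R) : nu.-integrable setT (EFin \o (cst k : RT -> R)).
  by apply: (@bounded_integrable _ `|k|).
have : Rintegral nu setT (fun t => p * m `^ (p - 1) * f t) <=
       Rintegral nu setT (fun t => f t `^ p + (cst ((p - 1) * m `^ p) : RT -> R) t).
  apply: le_Rintegral => //.
  - apply: (@bounded_integrable _ (`|p * m `^ (p - 1)| * M)).
      by apply: measurable_funM.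
    by move=> t; rewrite normrM ler_wpM2l.
  - apply: (@bounded_integrable _ (M `^ p + `|(p - 1) * m `^ p|)).
      by apply: measurable_funD.
    by move=> t; apply: le_trans (ler_normD _ _) _; rewrite lerD.
rewrite RintegralZl// RintegralD// Rintegral_cst//= -/m nu1 mulr1.
rewrite -mulrA [m `^ _ * m]mulrC mulr_powRB1//; lra.
Qed.

End TorusAverage.

(** * Stirling's formula *)

Section Stirling.
Variable R : realType.
Implicit Types x y t : R.

Lemma ge0_derive_le (f f' : R -> R) (a b : R) : a <= b ->
  (forall x, a <= x <= b -> is_derive x 1 f (f' x)) ->
  (forall x, a <= x <= b -> 0 <= f' x) -> f a <= f b.
Proof.
move=> ab df f'0.
have dv x : a <= x <= b -> derivable f x 1 by move=> /df[].
apply: (@ger0_derive1_le_cc _ f a b) => //; rewrite ?in_itv/= ?lexx ?ab//.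
- by move=> x; rewrite in_itv/= => /andP[ax xb]; apply: dv; rewrite !ltW.
- move=> x; rewrite in_itv/= => /andP[ax xb]; rewrite derive1E.
  have axb : a <= x <= b by rewrite !ltW.
  by have [_ ->] := df x axb; exact: f'0.
apply: derivable_within_continuous => x; rewrite in_itv/= => axb; exact: dv.
Qed.

(** The general term of Gudermann's series for the remainder in Stirling's formula. *)
Definition binet x : R := (x + 2^-1) * (ln (x + 1) - ln x) - 1.
Definition binet' x : R := ln (x + 1) - ln x - (x + 2^-1) * (x^-1 - (x + 1)^-1).

Lemma is_derive_lnD x (c : R) : 0 < x + c -> is_derive x 1 (fun x => ln (x + c)) (x + c)^-1.
Proof.
move=> xc; have h := is_derive1_ln xc.
have h2 : is_derive x 1 (fun x => x + c) (1 + 0).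
  by apply: is_deriveD.
have := @is_derive1_comp _ (@ln R) (fun x => x + c) x _ _ h h2.
by move=> H; apply: (is_derive_eq H); rewrite addr0 mulr1.
Qed.

Lemma is_derive_binet x : 0 < x -> is_derive x 1 binet (binet' x).
Proof.
move=> x0.
have h1 : is_derive x 1 (fun x => ln (x + 1)) (x + 1)^-1 by apply: is_derive_lnD; lra.
have h0 := is_derive1_ln x0.
have h2 : is_derive x 1 (fun x => x + 2^-1) (1 + 0) by apply: is_deriveD.
have := is_deriveB (is_deriveM h2 (is_deriveB h1 h0)) (is_derive_cst (1 : R) x 1).
move=> H; apply: (is_derive_eq H); rewrite /binet' !fctE /GRing.scale/=; ring.
Qed.

(** The sign of this second derivative is the convexity of [binet]. *)
Lemma is_derive_binet' x : 0 < x ->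
  is_derive x 1 binet' ((2 * x ^+ 2 * (x + 1) ^+ 2)^-1).
Proof.
move=> x0.
have h1 : is_derive x 1 (fun x => ln (x + 1)) (x + 1)^-1 by apply: is_derive_lnD; lra.
have h0 := is_derive1_ln x0.
have h2 : is_derive x 1 (fun x => x + 2^-1) (1 + 0) by apply: is_deriveD.
have h3 : is_derive x 1 (fun x => x + 1) (1 + 0) by apply: is_deriveD.
have x1 : x + 1 != 0 by rewrite gt_eqF//; lra.
have xn0 : x != 0 by rewrite gt_eqF.
have h4 := is_deriveV (xn0 : id x != 0) (is_derive_id x 1).
have h5 := is_deriveV (x1 : (fun x => x + 1) x != 0) h3.
have := is_deriveB (is_deriveB h1 h0) (is_deriveM h2 (is_deriveB h4 h5)).
move=> H; apply: (is_derive_eq H); rewrite ?fctE /GRing.scale/= ?exprVn.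
by field; rewrite x1 gt_eqF.
Qed.

Lemma binet'_le x y : 0 < x -> x <= y -> binet' x <= binet' y.
Proof.
move=> x0 xy; apply: (ge0_derive_le xy) => s /andP[xs _].
  by apply: is_derive_binet'; lra.
by rewrite invr_ge0 mulr_ge0 ?sqr_ge0// mulr_ge0 ?sqr_ge0.
Qed.

Lemma binet_tangent x y : 0 < x -> 0 < y -> binet x + binet' x * (y - x) <= binet y.
Proof.
move=> x0 y0; have [xy|yx] := leP x y.
  have d s : x <= s <= y ->
      is_derive s 1 (fun s => binet s - binet' x * s) (binet' s - binet' x).
    move=> /andP[xs sy]; have h := is_derive_binet (lt_le_trans x0 xs).
    have := is_deriveB h (is_deriveM (is_derive_cst (binet' x) s 1) (is_derive_id s 1)).
    by move=> H; apply: (is_derive_eq H); rewrite ?fctE /GRing.scale/=; ring.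
  have := ge0_derive_le xy d _; move=> /(_ _)/wrap[s /andP[xs _]|]; last lra.
  by rewrite subr_ge0 binet'_le.
have d s : y <= s <= x ->
    is_derive s 1 (fun s => binet' x * s - binet s) (binet' x - binet' s).
  move=> /andP[ys sx]; have h := is_derive_binet (lt_le_trans y0 ys).
  have := is_deriveB (is_deriveM (is_derive_cst (binet' x) s 1) (is_derive_id s 1)) h.
  by move=> H; apply: (is_derive_eq H); rewrite ?fctE /GRing.scale/=; ring.
have := ge0_derive_le (ltW yx) d _; move=> /(_ _)/wrap[s /andP[ys sx]|]; last lra.
by rewrite subr_ge0 binet'_le// (lt_le_trans y0).
Qed.

Lemma binet_convex t x y : 0 < t -> t < 1 -> 0 < x -> 0 < y ->
  binet (t * x + (1 - t) * y) <= t * binet x + (1 - t) * binet y.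
Proof.
move=> t0 t1 x0 y0; set m := t * x + (1 - t) * y.
have t10 : 0 < 1 - t by lra.
have m0 : 0 < m by rewrite addr_gt0 ?mulr_gt0.
have h1 := ler_wpM2l (ltW t0) (binet_tangent m0 x0).
have h2 := ler_wpM2l (ltW t10) (binet_tangent m0 y0).
have : t * (binet m + binet' m * (x - m)) + (1 - t) * (binet m + binet' m * (y - m)) = binet m.
  by rewrite /m; ring.
by move=> <-; exact: lerD.
Qed.

(** For [y = e^u] this reads [u <= sinh u]; the difference of the two sides has derivative
    [(1 - 1/y)^2 / 2] and vanishes at [1]. *)
Lemma ln_le_sinh y : 1 <= y -> ln y <= (y - y^-1) / 2.
Proof.
move=> y1.
have d s : 1 <= s <= y ->
    is_derive s 1 (fun s => (s - s^-1) / 2 - ln s) ((1 - s^-1) ^+ 2 / 2).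
  move=> /andP[s1 _]; have s0 : 0 < s by lra.
  have h := is_derive1_ln s0.
  have sn0 : s != 0 by rewrite gt_eqF.
  have h4 := is_deriveV (sn0 : id s != 0) (is_derive_id s 1).
  have := is_deriveB (is_deriveM (is_deriveB (is_derive_id s 1) h4) (is_derive_cst (2^-1 : R) s 1)) h.
  by move=> H; apply: (is_derive_eq H); rewrite ?fctE /GRing.scale/= ?exprVn; field; rewrite gt_eqF.
have := ge0_derive_le y1 d _; move=> /(_ _)/wrap[s _|].
  by rewrite divr_ge0// sqr_ge0.
by rewrite invr1 ln1; lra.
Qed.

(** The left side is the first diagonal Padé approximant of [ln] at [1]. At [y = 1 + 1/x] it equals
    [1 / (x + 1/2)], exactly what nonnegativity of [binet] requires. *)
Lemma ln_ge_pade y : 1 <= y -> 2 * (y - 1) / (y + 1) <= ln y.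
Proof.
move=> y1.
have d s : 1 <= s <= y ->
    is_derive s 1 (fun s => ln s + 4 * (s + 1)^-1) ((s - 1) ^+ 2 / (s * (s + 1) ^+ 2)).
  move=> /andP[s1 _]; have s0 : 0 < s by lra.
  have h := is_derive1_ln s0.
  have h3 : is_derive s 1 (fun x => x + 1) (1 + 0) by apply: is_deriveD.
  have x1 : s + 1 != 0 by rewrite gt_eqF//; lra.
  have h5 := is_deriveV (x1 : (fun x => x + 1) s != 0) h3.
  have := is_deriveD h (is_deriveM (is_derive_cst (4 : R) s 1) h5).
  by move=> H; apply: (is_derive_eq H); rewrite ?fctE /GRing.scale/= ?exprVn; field; rewrite x1 gt_eqF.
have := ge0_derive_le y1 d _; move=> /(_ _)/wrap[s /andP[s1 _]|].
  by rewrite divr_ge0 ?sqr_ge0// mulr_ge0 ?sqr_ge0//; lra.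
rewrite ln1; have -> : 2 * (y - 1) / (y + 1) = 2 - 4 * (y + 1)^-1.
  by field; rewrite gt_eqF//; lra.
have -> : (4 * (1 + 1)^-1 = 2 :> R) by field; lra.
lra.
Qed.

Lemma binet_ge0 x : 0 < x -> 0 <= binet x.
Proof.
move=> x0; have y1 : 1 <= (x + 1) / x by rewrite ler_pdivlMr//; lra.
have := ln_ge_pade y1; rewrite ln_div ?posrE//; last lra.
have -> : 2 * ((x + 1) / x - 1) / ((x + 1) / x + 1) = (x + 2^-1)^-1.
  by field; rewrite !gt_eqF//; lra.
have h : 0 < x + 2^-1 by lra.
rewrite -(ler_pM2l h) mulfV ?gt_eqF// /binet; lra.
Qed.

(** [ln_le_sinh] at [1 + 1/x] yields a quarter of this bound; the form matters because it telescopes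
    over unit steps. *)
Lemma binet_le x : 0 < x -> binet x <= x^-1 - (x + 1)^-1.
Proof.
move=> x0; have y1 : 1 <= (x + 1) / x by rewrite ler_pdivlMr//; lra.
have := ln_le_sinh y1; rewrite ln_div ?posrE//; last lra.
have h : 0 < x + 2^-1 by lra.
rewrite -(ler_pM2l h).
have -> : (x + 2^-1) * (((x + 1) / x - ((x + 1) / x)^-1) / 2) = 1 + 4^-1 * (x^-1 - (x + 1)^-1).
  by field; rewrite !gt_eqF//; lra.
have : 0 <= x^-1 - (x + 1)^-1 by rewrite subr_ge0 lef_pV2 ?posrE//; lra.
rewrite /binet; lra.
Qed.

(** The three hypotheses are those of Bohr and Mollerup for [Gamma (x + 1)], up to a constant
    factor. *)
Variable G : R -> R.
Hypothesis G_gt0 : forall x, 0 <= x -> 0 < G x.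
Hypothesis G_step : forall x, 0 <= x -> G (x + 1) = (x + 1) * G x.
Hypothesis G_logconvex : forall t x y, 0 < t -> t < 1 -> 0 <= x -> 0 <= y ->
  G (t * x + (1 - t) * y) <= G x `^ t * G y `^ (1 - t).

(** The term [ln (2 pi) / 2] of Stirling's formula is not subtracted: it would be a constant shift,
    invisible to convexity and to differences. *)
Definition stirling_err x := ln (G x) - (x * ln x - x + ln x / 2).
Local Notation D := stirling_err.

Let L x := ln (G x).

Let L_step x : 0 <= x -> L (x + 1) = ln (x + 1) + L x.
Proof. by move=> x0; rewrite /L G_step// lnM// ?posrE ?G_gt0//; lra. Qed.

Let L_convex t x y : 0 < t -> t < 1 -> 0 <= x -> 0 <= y ->
  L (t * x + (1 - t) * y) <= t * L x + (1 - t) * L y.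
Proof.
move=> t0 t1 x0 y0; have t10 : 0 < 1 - t by lra.
rewrite /L -!ln_powR -lnM ?posrE ?powR_gt0 ?G_gt0//.
by rewrite ler_ln ?posrE ?mulr_gt0 ?powR_gt0 ?G_gt0 ?G_logconvex// addr_ge0// mulr_ge0// ltW.
Qed.

Lemma stirling_err_step x : 0 < x -> D x = D (x + 1) + binet x.
Proof.
by move=> x0; rewrite /D -/(L (x + 1)) -/(L x) L_step ?ltW// /binet; field.
Qed.

Lemma stirling_errDn x k : 0 < x ->
  D (x + k%:R) <= D x /\ D x <= D (x + k%:R) + (x^-1 - (x + k%:R)^-1).
Proof.
move=> x0; elim: k => [|k [IH1 IH2]]; first by rewrite addr0 subrr addr0.
have xk : 0 < x + k%:R by rewrite ltr_wpDr.
have := stirling_err_step xk; have := binet_ge0 xk; have := binet_le xk.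
by rewrite -natr1 (addrA x); split; lra.
Qed.

(** The Bohr-Mollerup argument: convexity and the recurrence keep the slopes of [L] from [x] between
    [ln x] and [ln (x + 1)]. This handles the fractional increments, which [stirling_errDn] does not
    reach. *)
Lemma stirling_err_unit x t : 1 < x -> 0 <= t -> t <= 1 ->
  `|D (x + t) - D x| <= 2 / (x - 1).
Proof.
move=> x1 t0 t1; have x0 : 0 < x by lra.
have xt0 : 0 < x + t by lra.
(* [L] lies between its chords over [x - 1, x] and [x, x + 1] *)
have [h1 h2] : t * ln x <= L (x + t) - L x /\ L (x + t) - L x <= t * ln (x + 1).
  have Lx1 := L_step (ltW x0).
  have Lx : L x = ln x + L (x - 1).
    by have := @L_step (x - 1) _; rewrite subrK; apply; lra.
  move: t0; rewrite le_eqVlt => /predU1P[<-|t0]; first by rewrite addr0 subrr !mul0r.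
  split.
    have d0 : 0 < 1 + t by lra.
    have := @L_convex (t / (1 + t)) (x - 1) (x + t).
    have -> : t / (1 + t) * (x - 1) + (1 - t / (1 + t)) * (x + t) = x.
      by field; rewrite gt_eqF.
    move=> /(_ _ _ _ _)/wrap[||||]; rewrite ?divr_gt0 ?ltr_pdivrMr//; try lra.
    rewrite -(ler_pM2l d0).
    have -> : (1 + t) * (t / (1 + t) * L (x - 1) + (1 - t / (1 + t)) * L (x + t)) =
       t * L (x - 1) + L (x + t) by field; rewrite gt_eqF.
    by rewrite (_ : L (x - 1) = L x - ln x); [lra|rewrite Lx; ring].
  move: t1; rewrite le_eqVlt => /predU1P[->|t1]; first by rewrite Lx1; lra.
  have := @L_convex t (x + 1) x t0 t1 _ _.
  have -> : t * (x + 1) + (1 - t) * x = x + t by ring.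
  by rewrite Lx1 => /(_ _ _)/wrap[||]; lra.
have lnle (u v : R) : 0 < u -> 0 < v -> ln u - ln v <= (u - v) / v.
  move=> u0 v0; have := @le_ln1Dx R (u / v - 1); rewrite subrKC ln_div ?posrE//.
  have -> : (u - v) / v = u / v - 1 by field; rewrite gt_eqF.
  by apply; rewrite ltrBrDl subrr divr_gt0.
have e1 := lnle (x + t) x xt0 x0; have e2 := lnle x (x + t) x0 xt0.
have e3 := lnle (x + 1) x _ x0.
have i1 : x^-1 <= (x - 1)^-1 by rewrite lef_pV2 ?posrE; lra.
have i0 : 0 < x^-1 by rewrite invr_gt0.
have l0 : 0 <= ln (x + t) - ln x by rewrite subr_ge0 ler_ln ?posrE//; lra.
have l1 : ln (x + t) - ln x <= x^-1.
  apply: le_trans e1 _; rewrite -[leRHS]mul1r; rewrite ler_pM2r//; lra.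
have l2 : ln (x + 1) - ln x <= x^-1.
  by apply: le_trans (e3 _) _; [lra|rewrite -[leRHS]mul1r ler_pM2r//; lra].
(* [s ln s - s] has slope between [ln x] and [ln (x + t)] *)
have c1 : (x + t) * ln (x + t) - (x + t) - (x * ln x - x) <= t * ln (x + t).
  have : x * (ln (x + t) - ln x) <= t.
    by apply: le_trans (ler_wpM2l (ltW x0) e1) _; rewrite mulrCA mulfV ?gt_eqF//; lra.
  lra.
have c2 : t * ln x <= (x + t) * ln (x + t) - (x + t) - (x * ln x - x).
  have : (x + t) * (ln x - ln (x + t)) <= - t.
    by apply: le_trans (ler_wpM2l (ltW xt0) e2) _; rewrite mulrCA mulfV ?gt_eqF//; lra.
  lra.
have c3 : t * (ln (x + t) - ln x) <= x^-1.
  apply: le_trans l1; rewrite -[leRHS]mul1r ler_wpM2r//.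
have c4 : t * (ln (x + 1) - ln x) <= x^-1.
  apply: le_trans l2; rewrite -[leRHS]mul1r ler_wpM2r// subr_ge0 ler_ln ?posrE//; lra.
rewrite ler_norml /D -/(L x) -/(L (x + t)); apply/andP; split; lra.
Qed.

(** Any [x] beyond the integer [n0] is reached from it by whole unit steps, controlled by
    telescoping, and one fractional step. *)
Lemma stirling_err_cauchy e : 0 < e ->
  exists2 X, 0 < X & forall x y, X <= x -> X <= y -> `|D x - D y| <= e.
Proof.
move=> e0.
(* With [n0 - 1 > 10 / e], the errors [2 / (y - 1)] and [1 / n0] are each at most [e / 5], which
   fits into [e / 2]. *)
pose n0 := (Num.truncn (10 / e)).+2.
have n0e : 10 / e < n0%:R - 1.
  have -> : n0%:R = (Num.truncn (10 / e)).+1%:R + 1 :> R by rewrite natr1.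
  by rewrite addrK; exact: truncnS_gt.
have n01 : 1 < n0%:R :> R by rewrite ltr1n.
have near x : n0%:R <= x -> `|D x - D n0%:R| <= e / 2.
  move=> nx; pose k := Num.truncn (x - n0%:R).
  have xn : 0 <= x - n0%:R by rewrite subr_ge0.
  have /andP[k1 k2] := truncn_itv xn.
  have kS : k.+1%:R = k%:R + 1 :> R by rewrite natr1.
  rewrite -/k kS in k1 k2.
  have [y yE] : exists y, y = n0%:R + k%:R :> R by exists (n0%:R + k%:R).
  have y0 : n0%:R <= y by rewrite yE lerDl.
  have n00 : 0 < n0%:R :> R by rewrite ltr0n.
  have [s1 s2] := stirling_errDn k n00.
  have := @stirling_err_unit y (x - y) _ _ _.
  rewrite subrKC => /(_ _ _ _)/wrap[|||u]; try lra.
  have b1 : 2 / (y - 1) <= e / 5.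
    rewrite ler_pdivrMr; last lra.
    have : e * (10 / e) < e * (n0%:R - 1) by rewrite ltr_pM2l.
    rewrite mulrCA mulfV ?gt_eqF// mulr1 => h.
    have : e * (n0%:R - 1) <= e * (y - 1) by rewrite ler_pM2l//; lra.
    lra.
  have b2 : (n0%:R : R)^-1 <= e / 5.
    rewrite -[leLHS]mul1r ler_pdivrMr//.
    have : e * (10 / e) < e * (n0%:R - 1) by rewrite ltr_pM2l.
    rewrite mulrCA mulfV ?gt_eqF// mulr1 => h; lra.
  have b3 : 0 <= y^-1 by rewrite invr_ge0; lra.
  move: u; rewrite !ler_norml => /andP[u1 u2].
  by move: s1 s2; rewrite -yE => s1 s2; apply/andP; split; lra.
exists n0%:R; first lra.
move=> x y /near hx /near hy; move: hx hy; rewrite !ler_norml => /andP[? ?] /andP[? ?].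
by apply/andP; split; lra.
Qed.

(** After [k] unit shifts, [D] is a sum of [k] values of the convex [binet] plus its value at the
    shifted point. By the Cauchy property the three shifted values agree up to an arbitrarily small
    error. *)
Lemma stirling_err_convex t x y : 0 < t -> t < 1 -> 0 < x -> 0 < y ->
  D (t * x + (1 - t) * y) <= t * D x + (1 - t) * D y.
Proof.
move=> t0 t1 x0 y0; have t10 : 0 < 1 - t by lra.
(* The triple [B] collects the partial sums of [binet] started at [x], at [y] and at their
   barycentre. *)
have sh k : exists B, [/\ D x = D (x + k%:R) + B.1.1, D y = D (y + k%:R) + B.1.2,
    D (t * x + (1 - t) * y) = D (t * x + (1 - t) * y + k%:R) + B.2 &
    B.2 <= t * B.1.1 + (1 - t) * B.1.2].
  elim: k => [|k [[[b1 b2] b3] /= [h1 h2 h3 h4]]].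
    by exists (0, 0, 0); rewrite !addr0 !mulr0 addr0.
  have xk : 0 < x + k%:R by rewrite ltr_wpDr.
  have yk : 0 < y + k%:R by rewrite ltr_wpDr.
  have mE : t * x + (1 - t) * y + k%:R = t * (x + k%:R) + (1 - t) * (y + k%:R) by ring.
  have mk : 0 < t * x + (1 - t) * y + k%:R by rewrite mE addr_gt0 ?mulr_gt0.
  exists (b1 + binet (x + k%:R), b2 + binet (y + k%:R), b3 + binet (t * x + (1 - t) * y + k%:R)).
  rewrite /= -natr1 (addrA x) (addrA y) (addrA (t * x + (1 - t) * y)); split.
  - by rewrite h1 (stirling_err_step xk); ring.
  - by rewrite h2 (stirling_err_step yk); ring.
  - by rewrite h3 (stirling_err_step mk); ring.
  have := binet_convex t0 t1 xk yk; rewrite -mE; lra.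
apply/ler_addgt0Pr => e e0.
have e20 : 0 < e / 2 by rewrite divr_gt0.
have [X X0 HX] := stirling_err_cauchy e20.
pose k := (Num.truncn X).+1.
have Xk : X <= k%:R by exact/ltW/truncnS_gt.
have [[[b1 b2] b3] /= [-> -> -> h4]] := sh k.
set m := t * x + (1 - t) * y.
have m0 : 0 < m by rewrite addr_gt0 ?mulr_gt0.
have := HX (m + k%:R) (x + k%:R); have := HX (m + k%:R) (y + k%:R).
move=> /(_ _ _)/wrap[||]; try lra; move=> /ler_normlP[_ u1].
move=> /(_ _ _)/wrap[||]; try lra; move=> /ler_normlP[_ u2].
have := ler_wpM2l (ltW t0) u2; have := ler_wpM2l (ltW t10) u1; lra.
Qed.

End Stirling.

(** * Torus reduction *)

Section TorusReduction.
Variable R : realType.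
Local Notation RT := (measurableTypeR R).
Local Notation RR := (RT * RT)%type.
Local Notation mu := (@lebesgue_measure R).
Local Notation m2 := (mu \x mu)%E.
Variable nu : probability RT R.

Definition avg n (i : 'I_n) (u : ('I_n -> R[i]) -> R) (z : 'I_n -> R[i]) : R :=
  Rintegral nu setT (fun t => u (rotc i (cis t) z)).

Definition hmod n (j : 'I_n -> nat) (z : 'I_n -> R[i]) : R :=
  \prod_(i < n) cabs (z i) ^+ j i.

(* The averages of [u] over the [i]-th circle scale like the squared modulus of
   the monomial of exponent [j]; this is all that is used of holomorphy. *)
Definition circle_homogeneous n (j : 'I_n -> nat) (u : ('I_n -> R[i]) -> R) :=
  [/\ cmeasurable (u : ('I_n -> R[i]) -> RT), locally_bounded u &
      forall i z, avg i u z = cabs (z i) ^+ (2 * j i) * avg i u (setc i 1 z)].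

Lemma hmod_ge0 n (j : 'I_n -> nat) z : 0 <= hmod j z.
Proof. by apply: prodr_ge0 => i _; rewrite exprn_ge0 ?cabs_ge0. Qed.

Lemma hmod_ccons n (j : 'I_n.+1 -> nat) c w :
  hmod j (ccons c w) = cabs c ^+ j ord0 * hmod (j \o lift ord0) w.
Proof.
rewrite /hmod big_ord_recl ccons0; congr (_ * _).
by apply: eq_bigr => i _; rewrite cconsS.
Qed.

Lemma cabs_rotc_cis n (i k : 'I_n) t (z : 'I_n -> R[i]) :
  cabs (rotc i (cis t) z k) = cabs (z k).
Proof. by rewrite /rotc; case: ifP => // _; rewrite cabsM cabs_cis mul1r. Qed.

Lemma coord_bounded n (z : 'I_n -> R[i]) : exists r, forall i, cabs (z i) <= r.
Proof.
exists (\sum_i cabs (z i)) => i; rewrite (bigD1 i)//= lerDl.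
by apply: sumr_ge0 => k _; exact: cabs_ge0.
Qed.

Lemma rot_bounded n (i : 'I_n) (u : ('I_n -> R[i]) -> R) z : locally_bounded u ->
  exists M, forall t, `|u (rotc i (cis t) z)| <= M.
Proof.
move=> lu; have [r zr] := coord_bounded z; have [M HM] := lu r.
by exists M => t; apply: HM => k; rewrite cabs_rotc_cis.
Qed.

Lemma pmeasurable_fix n d0 (S0 : measurableType d0) d (T : measurableType d)
    (K : S0 -> ('I_n -> R[i]) -> T) z :
  pmeasurable K -> measurable_fun setT (fun s => K s z).
Proof.
move=> mK.
have := mK _ S0 id (fun i => cst (complex.Re (z i))) (fun i => cst (complex.Im (z i))).
move=> /(_ (@measurable_id _ _ _) (fun=> measurable_cst _) (fun=> measurable_cst _)).
apply: eq_measurable_fun => s _ /=; congr (K s _); apply/funext => i /=.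
by case: (z i).
Qed.

Lemma measurable_rot n (i : 'I_n) (u : ('I_n -> R[i]) -> RT) z : cmeasurable u ->
  measurable_fun setT (fun t : RT => u (rotc i (cis t) z)).
Proof. by move=> mu'; exact: (pmeasurable_fix z (pmeasurable_rotc i mu')). Qed.

Lemma EFin_avg n (i : 'I_n) (u : ('I_n -> R[i]) -> RT) z :
  cmeasurable u -> locally_bounded u ->
  (avg i u z)%:E = (\int[nu]_t (u (rotc i (cis t) z))%:E)%E.
Proof.
move=> mu' lu; have [M HM] := rot_bounded i z lu.
exact: (EFin_Rintegral nu (measurable_rot i z mu') HM).
Qed.

Lemma cmeasurable_avg n (i : 'I_n) (u : ('I_n -> R[i]) -> RT) :
  cmeasurable u -> cmeasurable (avg i u : _ -> RT).
Proof.
move=> mu' d' S x y mx my.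
apply: (measurable_Rintegral_snd nu
  (f := fun q : S * RT => u (rotc i (cis q.2) (fun k => x k q.1 +i* y k q.1)))).
apply: (pmeasurable_rotc i mu' (phi := snd)
   (x := fun k q => x k q.1) (y := fun k q => y k q.1)) => // k.
  exact: measurableT_comp.
exact: measurableT_comp.
Qed.

Lemma locally_bounded_avg n (i : 'I_n) (u : ('I_n -> R[i]) -> RT) :
  cmeasurable u -> locally_bounded u -> locally_bounded (avg i u).
Proof.
move=> mu' lu r; have [M HM] := lu r; exists M => z zr.
apply: Rintegral_bound; first exact: measurable_rot.
by move=> t; apply: HM => k; rewrite cabs_rotc_cis.
Qed.

Lemma cmeasurable_EFin n (u : ('I_n -> R[i]) -> RT) :
  cmeasurable u -> cmeasurable (EFin \o u : _ -> \bar R).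
Proof. by move=> mu' d' S x y mx my; apply/measurable_EFinP; exact: mu'. Qed.

Definition upos n (u : ('I_n -> R[i]) -> R) z := Num.max (u z) 0.
Definition uneg n (u : ('I_n -> R[i]) -> R) z := Num.max (- u z) 0.

Lemma upos_uneg n (u : ('I_n -> R[i]) -> R) z : u z = upos u z - uneg u z.
Proof. by rewrite /upos /uneg; case: (leP (u z) 0) => h; case: (leP (- u z) 0); lra. Qed.

Lemma upos_le n (u : ('I_n -> R[i]) -> R) z : 0 <= upos u z <= `|u z|.
Proof.
by rewrite /upos; case: (leP (u z) 0) => h; rewrite ?lexx ?normr_ge0//= ler_norm ltW.
Qed.

Lemma uneg_le n (u : ('I_n -> R[i]) -> R) z : 0 <= uneg u z <= `|u z|.
Proof. by have := upos_le (fun z => - u z) z; rewrite normrN. Qed.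

Lemma cmeasurable_upos n (u : ('I_n -> R[i]) -> RT) : cmeasurable u ->
  cmeasurable (upos u : _ -> RT).
Proof. by move=> mu' d' S x y mx my; apply: measurable_maxr => //; exact: mu'. Qed.

Lemma cmeasurable_uneg n (u : ('I_n -> R[i]) -> RT) : cmeasurable u ->
  cmeasurable (uneg u : _ -> RT).
Proof.
move=> mu' d' S x y mx my; apply: measurable_maxr => //.
by apply: measurableT_comp => //; exact: mu'.
Qed.

Lemma cmeasurable_norm n (u : ('I_n -> R[i]) -> RT) : cmeasurable u ->
  cmeasurable (fun z => `|u z| : RT).
Proof. by move=> mu' d' S x y mx my; apply: measurableT_comp => //; exact: mu'. Qed.

Lemma locally_bounded_le n (u v : ('I_n -> R[i]) -> R) :
  locally_bounded u -> (forall z, `|v z| <= `|u z|) -> locally_bounded v.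
Proof.
by move=> lu vu r; have [M HM] := lu r; exists M => z /HM; exact: le_trans.
Qed.

Variable a : R.
Hypothesis a0 : 0 < a.

Lemma gintE_pos_lty n (u P : ('I_n -> R[i]) -> RT) : cmeasurable u -> cmeasurable P ->
  (forall z, 0 <= P z <= `|u z|) -> (gintE a (fun z => `|u z|%:E) < +oo)%E ->
  (gintE a (EFin \o P) < +oo)%E.
Proof.
move=> mu' mP Pu; apply: le_lt_trans; apply: le_gintE => //.
- exact: cmeasurable_EFin.
- exact/cmeasurable_EFin/cmeasurable_norm.
- by move=> z; rewrite lee_fin; have /andP[] := Pu z.
- by move=> z; rewrite lee_fin; have /andP[] := Pu z.
Qed.

Lemma gintR_avg0 n (u : ('I_n.+1 -> R[i]) -> RT) :
  cmeasurable u -> locally_bounded u -> (gintE a (fun z => `|u z|%:E) < +oo)%E ->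
  gintR a u = gintR a (avg ord0 u).
Proof.
move=> mu' lu iu.
have mP := cmeasurable_upos mu'; have mN := cmeasurable_uneg mu'.
have P0 z : 0 <= upos u z by have /andP[] := upos_le u z.
have N0 z : 0 <= uneg u z by have /andP[] := uneg_le u z.
have lP : locally_bounded (upos u).
  by apply: locally_bounded_le lu _ => z; rewrite ger0_norm//; have /andP[] := upos_le u z.
have lN : locally_bounded (uneg u).
  by apply: locally_bounded_le lu _ => z; rewrite ger0_norm//; have /andP[] := uneg_le u z.
have iP := gintE_pos_lty mu' mP (upos_le u) iu.
have iN := gintE_pos_lty mu' mN (uneg_le u) iu.
have E (F : ('I_n.+1 -> R[i]) -> RT) : cmeasurable F -> locally_bounded F ->
    (forall z, 0 <= F z) -> gintE a (EFin \o avg ord0 F) = gintE a (EFin \o F).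
  move=> mF lF F0; rewrite -[RHS](gintE_avg nu a0); last 2 first.
  - exact: cmeasurable_EFin.
  - by move=> z; rewrite lee_fin.
  by congr gintE; apply/funext => z; exact: EFin_avg.
have -> : (u : _ -> R) = (fun z => upos u z - uneg u z) by apply/funext => z; exact: upos_uneg.
rewrite (gintR_sub a0 mP mN P0 N0 iP iN).
have -> : avg ord0 (fun z => upos u z - uneg u z) =
   (fun z => avg ord0 (upos u) z - avg ord0 (uneg u) z).
  apply/funext => z; rewrite /avg RintegralB//.
    have [M HM] := rot_bounded ord0 z lP.
    by apply: bounded_integrable HM; exact: measurable_rot.
  have [M HM] := rot_bounded ord0 z lN.
  by apply: bounded_integrable HM; exact: measurable_rot.
rewrite gintR_sub ?E//; try exact: cmeasurable_avg.
- by move=> z; exact: Rintegral_ge0.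
- by move=> z; exact: Rintegral_ge0.
Qed.

Lemma gintR_prod n (k : R[i] -> R) (K : R) (v : ('I_n -> R[i]) -> RT) :
  measurable_fun setT (fun p : RR => k (zpair p)) -> (forall c, 0 <= k c) ->
  (\int[m2]_p (gdens a p.1 p.2 * k (zpair p))%:E = K%:E)%E ->
  cmeasurable v -> (gintE a (fun z => `|v z|%:E) < +oo)%E ->
  gintR a (fun z => k (z ord0) * v (z \o lift ord0)) = K * gintR a v.
Proof.
move=> mk k0 kK mv iv.
have mP := cmeasurable_upos mv; have mN := cmeasurable_uneg mv.
have P0 z : 0 <= upos v z by have /andP[] := upos_le v z.
have N0 z : 0 <= uneg v z by have /andP[] := uneg_le v z.
have iP := gintE_pos_lty mv mP (upos_le v) iv.
have iN := gintE_pos_lty mv mN (uneg_le v) iv.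
have mkF (F : ('I_n -> R[i]) -> RT) : cmeasurable F ->
    cmeasurable (fun z : 'I_n.+1 -> R[i] => k (z ord0) * F (z \o lift ord0) : RT).
  move=> mF d' S x y mx my; apply: measurable_funM.
    apply: (measurableT_comp mk (g := fun s => (x ord0 s, y ord0 s))).
    exact: measurable_fun_pair.
  exact: (mF _ S (fun i => x (lift ord0 i)) (fun i => y (lift ord0 i))).
have E (F : ('I_n -> R[i]) -> RT) : cmeasurable F -> (forall z, 0 <= F z) ->
    gintE a (EFin \o (fun z => k (z ord0) * F (z \o lift ord0))) = (K%:E * gintE a (EFin \o F))%E.
  move=> mF F0; have F0' z : (0 <= (EFin \o F) z)%E by rewrite lee_fin.
  by rewrite -kK -(gintE_prod a0 mk k0 (cmeasurable_EFin mF) F0').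
have fin (F : ('I_n -> R[i]) -> RT) : (forall z, 0 <= F z) ->
    (gintE a (EFin \o F) < +oo)%E -> gintE a (EFin \o F) \is a fin_num.
  by move=> F0 h; rewrite ge0_fin_numE// gintE_ge0// => z; rewrite lee_fin.
have -> : (fun z : 'I_n.+1 -> R[i] => k (z ord0) * v (z \o lift ord0)) =
   (fun z => k (z ord0) * upos v (z \o lift ord0) - k (z ord0) * uneg v (z \o lift ord0)).
  by apply/funext => z; rewrite -mulrBr -upos_uneg.
rewrite (gintR_sub a0 (mkF _ mP) (mkF _ mN)); last 4 first.
- by move=> z; rewrite mulr_ge0.
- by move=> z; rewrite mulr_ge0.
- by rewrite E// -(fineK (fin _ P0 iP)) -EFinM ltry.
- by rewrite E// -(fineK (fin _ N0 iN)) -EFinM ltry.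
rewrite !E// !fineM ?fin// -mulrBr; congr (_ * _).
rewrite -(gintR_sub a0 mP mN P0 N0 iP iN); congr gintR.
by apply/funext => z; rewrite -upos_uneg.
Qed.

End TorusReduction.

(** * Induction over the coordinates *)

Section TorusInduction.
Variable R : realType.
Local Notation RT := (measurableTypeR R).
Local Notation RR := (RT * RT)%type.
Local Notation mu := (@lebesgue_measure R).
Local Notation m2 := (mu \x mu)%E.
Variable nu : probability RT R.

Lemma cmeasurable_family n d (T : measurableType d) (F : ('I_n -> R[i]) -> T)
    d' (S : measurableType d') (zeta : S -> 'I_n -> R[i]) : cmeasurable F ->
  (forall i, measurable_fun setT (fun s => complex.Re (zeta s i) : RT)) ->
  (forall i, measurable_fun setT (fun s => complex.Im (zeta s i) : RT)) ->
  measurable_fun setT (fun s => F (zeta s)).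
Proof.
move=> mF mx my; have := mF _ S _ _ mx my.
apply: eq_measurable_fun => s _; congr F; apply/funext => i.
by case: (zeta s i).
Qed.

Lemma setc0_eta n (z : 'I_n.+1 -> R[i]) c : setc ord0 c z = ccons c (z \o lift ord0).
Proof. by rewrite -{1}(ccons_eta z) setc_ccons0. Qed.

(** The mean over the unit circle of the first coordinate; by homogeneity it determines the means
    over all the other circles. *)
Definition circle_slice n (u : ('I_n.+1 -> R[i]) -> R) w := avg nu ord0 u (ccons 1 w).

Lemma avg_ccons0 n (u : ('I_n.+1 -> R[i]) -> R) c w :
  avg nu ord0 u (ccons c w) = Rintegral nu setT (fun t => u (ccons (cis t * c) w)).
Proof. by apply: eq_Rintegral => t _; rewrite rotc_ccons0. Qed.

(** Fubini for the angles of the first coordinate and of a later one, so that averaging in the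
    latter commutes with slicing. *)
Lemma circle_slice_avg n (i : 'I_n) (u : ('I_n.+1 -> R[i]) -> RT) w :
  cmeasurable u -> locally_bounded u ->
  avg nu i (circle_slice u) w =
  Rintegral nu setT (fun t => avg nu (lift ord0 i) u (ccons (cis t) w)).
Proof.
move=> mu' lu; pose F (q : RR) : R := u (ccons (cis q.2) (rotc i (cis q.1) w)).
have mc1 : measurable_fun setT (fun q : RR => cos q.1 : RT).
  exact: measurableT_comp (@measurable_cos R) measurable_fst.
have ms1 : measurable_fun setT (fun q : RR => sin q.1 : RT).
  exact: measurableT_comp (@measurable_sin R) measurable_fst.
have mc2 : measurable_fun setT (fun q : RR => cos q.2 : RT).
  exact: measurableT_comp (@measurable_cos R) measurable_snd.
have ms2 : measurable_fun setT (fun q : RR => sin q.2 : RT).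
  exact: measurableT_comp (@measurable_sin R) measurable_snd.
have mF : measurable_fun setT F.
  apply: (cmeasurable_family mu') => l; case: (unliftP ord0 l) => [m|] -> /=.
  - under eq_fun do rewrite cconsS /rotc; case: (m == i) => /=; last exact: measurable_cst.
    case: (w m) => x y /=.
    by apply: measurable_funB; apply: measurable_funM.
  - by under eq_fun do rewrite ccons0.
  - under eq_fun do rewrite cconsS /rotc; case: (m == i) => /=; last exact: measurable_cst.
    case: (w m) => x y /=.
    by apply: measurable_funD; apply: measurable_funM.
  - by under eq_fun do rewrite ccons0.
have [r wr] := coord_bounded w; have [M HM] := lu (Num.max r 1).
have FM q : `|F q| <= M.
  apply: HM => l; case: (unliftP ord0 l) => [m|] ->.
    by rewrite cconsS cabs_rotc_cis le_max wr.
  by rewrite ccons0 cabs_cis le_max lexx orbT.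
transitivity (Rintegral nu setT (fun s => Rintegral nu setT (fun t => F (s, t)))).
  apply: eq_Rintegral => s _; rewrite /circle_slice avg_ccons0.
  by apply: eq_Rintegral => t _; rewrite mulr1.
rewrite (Rintegral_swap nu mF FM); apply: eq_Rintegral => t _.
by apply: eq_Rintegral => s _; rewrite rotc_cconsS.
Qed.

Lemma circle_homogeneous_slice n (j : 'I_n.+1 -> nat) (u : ('I_n.+1 -> R[i]) -> R) :
  circle_homogeneous nu j u ->
  circle_homogeneous nu (j \o lift ord0) (circle_slice u).
Proof.
move=> [mu' lu hu].
have mav (i : 'I_n.+1) := cmeasurable_avg nu i mu'.
have lav (i : 'I_n.+1) := locally_bounded_avg nu i mu' lu.
split.
- exact: (pmeasurable_at ((1 : RT), (0 : RT)) (cmeasurable_slice (mav ord0))).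
- move=> r; have [M HM] := lav ord0 (Num.max r 1); exists M => w wr.
  apply: HM => l; case: (unliftP ord0 l) => [m|] ->.
    by rewrite cconsS le_max wr.
  by rewrite ccons0 cabs1 le_max lexx orbT.
move=> i w; rewrite circle_slice_avg// circle_slice_avg//.
rewrite -RintegralZl//; last first.
  have [M HM] := rot_bounded ord0 (ccons 1 (setc i 1 w)) (lav (lift ord0 i)).
  apply: (@bounded_integrable _ nu _ M).
    have := measurable_rot ord0 (ccons 1 (setc i 1 w)) (mav (lift ord0 i)).
    by apply: eq_measurable_fun => t _; rewrite rotc_ccons0 mulr1.
  by move=> t; have := HM t; rewrite rotc_ccons0 mulr1.
by apply: eq_Rintegral => t _; rewrite hu cconsS setc_cconsS.
Qed.

Lemma avg0_slice n (j : 'I_n.+1 -> nat) (u : ('I_n.+1 -> R[i]) -> R) z :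
  circle_homogeneous nu j u ->
  avg nu ord0 u z = cabs (z ord0) ^+ (2 * j ord0) * circle_slice u (z \o lift ord0).
Proof. by move=> [_ _ ->]; rewrite setc0_eta. Qed.

Lemma cmoment_nat (a : R) k :
  cmoment a (2 * k%:R) = (\int[m2]_p (gdens a p.1 p.2 * cabs (zpair p) ^+ (2 * k))%:E)%E.
Proof.
apply: eq_integral => p _; congr (_ * _)%:E.
by rewrite -natrM powR_mulrn// cabs_ge0.
Qed.

(** The witness [c] is the iterated mean of [u] over the unit torus. It is chosen before [a] and
    [b], so that an identity at one Gaussian parameter and an inequality at another share it. In the
    application [G] is [|g|], hence the majorant [G * hmod j] of [u]. *)
Theorem torus_reduction n (j : 'I_n -> nat) (u : ('I_n -> R[i]) -> R) :
  circle_homogeneous nu j u -> exists c : R,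
  (forall a, 0 < a -> (gintE a (fun z => `|u z|%:E) < +oo)%E ->
    gintR a u = c * \prod_i fine (cmoment a (2 * (j i)%:R))) /\
  (forall b p (G : ('I_n -> R[i]) -> RT), 0 < b -> 1 < p ->
    cmeasurable G -> locally_bounded G -> (forall z, 0 <= G z) ->
    (forall z, `|u z| <= G z * hmod j z) ->
    ((`|c| `^ p * \prod_i fine (cmoment b (p * (j i)%:R)))%:E <=
     gintE b (fun z => (G z `^ p)%:E))%E).
Proof.
elim: n j u => [|n IH] j u hju.
  exists (u (fun=> 0)); split; first by move=> a a0 _; rewrite big_ord0 mulr1.
  move=> b p G b0 p1 mG lG G0 uG; rewrite big_ord0 mulr1 /= lee_fin.
  rewrite ge0_ler_powR ?nnegrE//; first lra.
  by have := uG (fun=> 0); rewrite /hmod big_ord0 mulr1.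
have [c [c1 c2]] := IH _ _ (circle_homogeneous_slice hju).
have [mv lv _] := circle_homogeneous_slice hju.
have [mu' lu _] := hju.
pose v := circle_slice u; pose j0 := j ord0.
pose k (z : R[i]) : R := cabs z ^+ (2 * j0).
have k0 z : 0 <= k z by rewrite exprn_ge0 ?cabs_ge0.
have mk : measurable_fun setT (fun p : RR => k (zpair p)).
  by apply: measurable_funX; exact: measurable_cabs_zpair.
have j00 : 0 <= 2 * j0%:R :> R by rewrite mulr_ge0.
exists c; split.
  move=> a a0 iu.
  have kK : (\int[m2]_p (gdens a p.1 p.2 * k (zpair p))%:E =
      (fine (cmoment a (2 * j0%:R)))%:E)%E.
    by rewrite fineK ?cmoment_fin// cmoment_nat.
  (* Integrability passes from [u] to its slice: the modulus of a circle mean is at most the mean of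
     the modulus, the variables then separate, and the moment in front is positive. *)
  have iv : (gintE a (fun w => `|v w|%:E) < +oo)%E.
    have lN : locally_bounded (fun z => `|u z|).
      by apply: locally_bounded_le lu _ => z; rewrite normr_id.
    have mN := cmeasurable_norm mu'.
    have mEv := cmeasurable_EFin (cmeasurable_norm mv).
    have Ev0 w : (0 <= `|v w|%:E)%E by rewrite lee_fin.
    have : (gintE a (fun z => (k (z ord0))%:E * `|v (z \o lift ord0)|%:E) < +oo)%E.
      apply: le_lt_trans iu; rewrite -[leRHS](gintE_avg nu a0)//; last first.
        exact: cmeasurable_EFin.
      apply: le_gintE => //.
      - move=> d' S x y mx my; apply: emeasurable_funM.
          apply/measurable_EFinP.
          apply: (measurableT_comp mk (g := fun s => (x ord0 s, y ord0 s))).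
          exact: measurable_fun_pair.
        exact: (mEv _ S (fun i => x (lift ord0 i)) (fun i => y (lift ord0 i))).
      - have := cmeasurable_EFin (cmeasurable_avg nu ord0 mN).
        by congr cmeasurable; apply/funext => z; rewrite /= EFin_avg.
      - by move=> z; rewrite mule_ge0// lee_fin.
      move=> z; rewrite -(EFin_avg nu ord0 z mN lN) -EFinM lee_fin.
      rewrite -[k _]ger0_norm// -normrM -(avg0_slice z hju).
      have [M HM] := rot_bounded ord0 z lu.
      exact: (le_normr_Rintegral measurableT (bounded_integrable nu (measurable_rot ord0 z mu') HM)).
    rewrite (gintE_prod a0 mk k0 mEv Ev0) kK.
    have K0 : (0 < (fine (cmoment a (2 * j0%:R)))%:E)%E.
      by rewrite fineK ?cmoment_fin// cmoment_gt0.
    have : (0 <= gintE a (fun w => `|v w|%:E))%E by exact: gintE_ge0.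
    by case: (gintE a _) => [r _ _|_|//]; rewrite ?ltry// gt0_muley.
  rewrite (gintR_avg0 nu a0 mu' lu iu).
  have -> : avg nu ord0 u = (fun z => k (z ord0) * v (z \o lift ord0)).
    by apply/funext => z; rewrite (avg0_slice z hju).
  rewrite (gintR_prod a0 mk k0 kK mv iv) (c1 a a0 iv) big_ord_recl mulrCA.
  by [].
move=> b p G b0 p1 mG lG G0 uG; have p0 : 0 < p by lra.
pose Gp z : \bar R := (G z `^ p)%:E.
have mGp : cmeasurable Gp.
  move=> d' S x y mx my; apply/measurable_EFinP.
  exact: (measurableT_comp (measurable_powR p) (mG _ S x y mx my)).
have Gp0 z : (0 <= Gp z)%E by rewrite lee_fin powR_ge0.
have mI : cmeasurable (fun z => \int[nu]_t Gp (rotc ord0 (cis t) z))%E.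
  move=> d' S x y mx my.
  apply: (measurable_fun_fubini_tonelli_F (m2 := nu)
    (fun q : S * RT => Gp (rotc ord0 (cis q.2) (fun i => x i q.1 +i* y i q.1)))) => //.
  by apply: (pmeasurable_rotc ord0 mGp (phi := snd)
    (x := fun i q => x i q.1) (y := fun i q => y i q.1)) => // i; exact: measurableT_comp.
have I0 z : (0 <= \int[nu]_t Gp (rotc ord0 (cis t) z))%E by exact: integral_ge0.
(* By rotation invariance [G^p] may be replaced by its mean over the first circle, and the two sides
   can then be compared at each point [q] of the plane. *)
rewrite -[leRHS]/(gintE b Gp) -(gintE_avg nu b0 mGp Gp0) (gintES b0 mI I0).
set A := `|c| `^ p * \prod_(i < n) fine (cmoment b (p * ((j \o lift ord0) i)%:R)).
have A0 : 0 <= A.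
  by rewrite mulr_ge0 ?powR_ge0// prodr_ge0// => i _; rewrite fine_ge0 ?cmoment_ge0.
have -> : ((`|c| `^ p * \prod_(i < n.+1) fine (cmoment b (p * (j i)%:R)))%:E =
   \int[m2]_q (A%:E * (gdens b q.1 q.2 * cabs (zpair q) `^ (p * j0%:R))%:E))%E.
  rewrite ge0_integralZl//; last 2 first.
  - by apply/measurable_EFinP; exact: measurable_gdens_cabs.
  - by move=> q _; rewrite lee_fin mulr_ge0 ?powR_ge0// gdens_ge0.
  rewrite -/(cmoment b (p * j0%:R)) -[cmoment b (p * j0%:R)]fineK; last first.
    by rewrite cmoment_fin// mulr_ge0// ltW.
  by rewrite -EFinM big_ord_recl mulrCA mulrC.
apply: ge0_le_integral => //.
- by move=> q _; rewrite mule_ge0 ?lee_fin// mulr_ge0 ?powR_ge0// gdens_ge0.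
- apply: emeasurable_funM => //.
  by apply/measurable_EFinP; exact: measurable_gdens_cabs.
- exact: (cmeasurable_gintE_slice b0 mI I0).
move=> q _; rewrite (EFinM (gdens b q.1 q.2)) muleCA; apply: lee_wpmul2l; first by rewrite lee_fin gdens_ge0.
(* The induction hypothesis will be used with a division by this power; where it vanishes, so does
   the left side. *)
have [kz|kn0] := eqVneq (cabs (zpair q) ^+ j0) 0.
  have -> : cabs (zpair q) `^ (p * j0%:R) = 0.
    rewrite mulrC powRrM powR_mulrn ?cabs_ge0// kz powR0// gt_eqF//.
  by rewrite mule0; apply: gintE_ge0 => // w; exact: I0.
pose K := cabs (zpair q) ^+ j0.
have K0 : 0 < K by rewrite lt_def kn0 exprn_ge0// cabs_ge0.
pose H w : RT := avg nu ord0 G (ccons (zpair q) w).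
have mav := cmeasurable_avg nu ord0 mG.
have lav := locally_bounded_avg nu ord0 mG lG.
have mH : cmeasurable H by exact: (pmeasurable_at q (cmeasurable_slice mav)).
have lH : locally_bounded H.
  move=> r; have [M HM] := lav (Num.max r (cabs (zpair q))); exists M => w wr.
  apply: HM => l; case: (unliftP ord0 l) => [m|] ->.
    by rewrite cconsS le_max wr.
  by rewrite ccons0 le_max lexx orbT.
have H0 w : 0 <= H w by exact: Rintegral_ge0.
(* Averaging [|u| <= G * hmod j] over the circle through [q] gives [K^2 |v| <= K * hmod * H], with
   [hmod] taken in the remaining coordinates; so [H / K] is the majorant for the slice. *)
have c2' := c2 b p (fun w => K^-1 * H w) b0 p1.
have : ((A)%:E <= gintE b (fun w => ((K^-1 * H w) `^ p)%:E))%E.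
  apply: c2'.
  - by move=> d' S x y mx my; apply: measurable_funM => //; exact: mH.
  - move=> r; have [M HM] := lH r; exists (K^-1 * M) => w wr.
    by rewrite normrM gtr0_norm ?invr_gt0// ler_pM2l ?invr_gt0// HM.
  - by move=> w; rewrite mulr_ge0// invr_ge0 ltW.
  move=> w.
  have vE : `|avg nu ord0 u (ccons (zpair q) w)| = K ^+ 2 * `|circle_slice u w|.
    rewrite (avg0_slice _ hju) ccons0 normrM ger0_norm ?exprn_ge0 ?cabs_ge0//.
    rewrite mulnC exprM; congr (_ * `|circle_slice u _|).
    by apply/funext => i; rewrite /= cconsS.
  have K20 : 0 < K ^+ 2 by rewrite exprn_gt0.
  rewrite -(ler_pM2l K20) -vE.
  have -> : K ^+ 2 * (K^-1 * H w * hmod (j \o lift ord0) w) = (K * hmod (j \o lift ord0) w) * H w.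
    by field; rewrite gt_eqF.
  set z := ccons (zpair q) w.
  have [M HM] := rot_bounded ord0 z lu; have [M' HM'] := rot_bounded ord0 z lG.
  have mru := measurable_rot ord0 z mu'; have mrG := measurable_rot ord0 z mG.
  apply: le_trans (le_normr_Rintegral measurableT (bounded_integrable nu mru HM)) _.
  rewrite /H /avg -RintegralZl//; last exact: bounded_integrable mrG HM'.
  apply: le_Rintegral => //.
  - apply: (@bounded_integrable _ nu _ M); first exact: measurableT_comp.
    by move=> t; rewrite normr_id.
  - apply: (@bounded_integrable _ nu _ (`|K * hmod (j \o lift ord0) w| * M')).
      exact: measurable_funM.
    by move=> t; rewrite normrM ler_wpM2l.
  move=> t _; apply: le_trans (uG _) _; rewrite mulrC ler_wpM2r//.
  by rewrite /z rotc_ccons0 hmod_ccons cabsM cabs_cis mul1r.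
have Kp0 : 0 <= K `^ p by exact: powR_ge0.
move=> AH; rewrite muleC.
have -> : cabs (zpair q) `^ (p * j0%:R) = K `^ p.
  by rewrite mulrC powRrM powR_mulrn ?cabs_ge0.
apply: (@le_trans _ _ ((K `^ p)%:E * gintE b (fun w => ((K^-1 * H w) `^ p)%:E))%E).
  by rewrite lee_wpmul2l// lee_fin.
have mHp : cmeasurable (fun w => ((K^-1 * H w) `^ p)%:E : \bar R).
  move=> d' S x y mx my; apply/measurable_EFinP.
  apply: (measurableT_comp (measurable_powR p)).
  by apply: measurable_funM => //; exact: mH.
rewrite -gintEZ//; last by move=> w; rewrite lee_fin powR_ge0.
apply: le_gintE => //.
- by move=> d' S x y mx my; apply: emeasurable_funM => //; exact: mHp.
- exact: (pmeasurable_at q (cmeasurable_slice mI)).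
- by move=> w; rewrite -EFinM lee_fin mulr_ge0 ?powR_ge0.
move=> w; rewrite -EFinM -powRM ?(ltW K0) ?mulr_ge0 ?invr_ge0 ?(ltW K0)//.
rewrite mulVKf ?gt_eqF//.
(* The factor [K^p] has cancelled the division by [K]; it remains to bound [H^p] by the circle mean
   of [G^p], which is Jensen's inequality. *)
have [M HM] := rot_bounded ord0 (ccons (zpair q) w) lG.
apply: (jensen_powR nu p1 (measurable_rot ord0 (ccons (zpair q) w) mG)).
  by move=> t; exact: G0.
by move=> t; apply: le_trans (HM t); exact: ler_norm.
Qed.

End TorusInduction.

(** * Circle averages of holomorphic functions *)

Section Goursat.
Variable R : realType.
Local Notation mu := (@lebesgue_measure R).

Definition sint (f : R -> R) (a b : R) : R := Rintegral mu `[a, b] f.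

Lemma continuous_sintegrable (f : R -> R) a b : continuous f ->
  mu.-integrable `[a, b] (EFin \o f).
Proof.
move=> cf; apply: continuous_compact_integrable; first exact: segment_compact.
exact: continuous_subspaceT.
Qed.

Lemma sint_cat (f : R -> R) a b c : continuous f -> a <= b -> b <= c ->
  sint f a c = sint f a b + sint f b c.
Proof.
move=> cf ab bc; rewrite /sint.
have i1 := continuous_sintegrable a c cf; have i2 := continuous_sintegrable b c cf.
have := @Rintegral_itvB R f (BLeft a) (BRight c) b i1.
rewrite !bnd_simp => /(_ ab bc) E.
rewrite -(@Rintegral_itv_obnd_cbnd R b (BRight c)) -?E ?subrKC//.
by apply: integrableS i2 => //; apply: subset_itvr; rewrite bnd_simp.
Qed.

Lemma sintD (f g : R -> R) a b : continuous f -> continuous g ->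
  sint (fun x => f x + g x) a b = sint f a b + sint g a b.
Proof. by move=> cf cg; rewrite /sint RintegralD//; exact: continuous_sintegrable. Qed.

Lemma sintB (f g : R -> R) a b : continuous f -> continuous g ->
  sint (fun x => f x - g x) a b = sint f a b - sint g a b.
Proof. by move=> cf cg; rewrite /sint RintegralB//; exact: continuous_sintegrable. Qed.

Lemma sint_cst (k : R) a b : a <= b -> sint (fun=> k) a b = k * (b - a).
Proof.
move=> ab; rewrite /sint Rintegral_cst//= lebesgue_measure_itv/= lte_fin.
by case: ltgtP ab => //= -> _; rewrite subrr.
Qed.

Lemma sint_approx (f : R -> R) (K e a b : R) : continuous f -> a <= b ->
  (forall t, a <= t <= b -> `|f t - K| <= e) -> `|sint f a b - K * (b - a)| <= e * (b - a).
Proof.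
move=> cf ab H.
have cc (k : R) : continuous (fun _ : R => k) by move=> x; exact: cvg_cst.
have up : sint f a b <= (K + e) * (b - a).
  rewrite -sint_cst//; apply: le_Rintegral => //; try exact: continuous_sintegrable.
  by move=> t; rewrite /= in_itv/= => /H; rewrite ler_norml => /andP[]; lra.
have lo : (K - e) * (b - a) <= sint f a b.
  rewrite -sint_cst//; apply: le_Rintegral => //; try exact: continuous_sintegrable.
  by move=> t; rewrite /= in_itv/= => /H; rewrite ler_norml => /andP[]; lra.
by rewrite ler_norml; apply/andP; split; lra.
Qed.

Variables v w : R -> R -> R.

(* [A] is at once the derivative of [v] in the first variable and that of [w] in
   the second one: half of the Cauchy-Riemann equations for [v + i w]. *)
Definition green_pair := forall s t, exists A B C : R, forall eps, 0 < eps ->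
  exists2 delta, 0 < delta & forall h k, `|h| < delta -> `|k| < delta ->
    `|v (s + h) (t + k) - v s t - (A * h + B * k)| <= eps * (`|h| + `|k|) /\
    `|w (s + h) (t + k) - w s t - (C * h + A * k)| <= eps * (`|h| + `|k|).

Hypothesis vw : green_pair.

Let near_cont (f : R -> R -> R) s t (B C : R) :
  (forall eps, 0 < eps -> exists2 delta, 0 < delta & forall h k, `|h| < delta -> `|k| < delta ->
    `|f (s + h) (t + k) - f s t - (B * h + C * k)| <= eps * (`|h| + `|k|)) ->
  {for t, continuous (f s)} /\ {for s, continuous (fun s => f s t)}.
Proof.
move=> H.
have key e : 0 < e -> exists2 delta, 0 < delta & forall h k, `|h| < delta -> `|k| < delta ->
    `|f (s + h) (t + k) - f s t| < e.
  move=> e0; have [d d0 Hd] := H 1 ltr01.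
  have M0 : 0 < 2 * (`|B| + `|C| + 2).
    by have := normr_ge0 B; have := normr_ge0 C; lra.
  exists (Num.min d (e / (2 * (`|B| + `|C| + 2)))).
    by rewrite lt_min d0 divr_gt0.
  move=> h k; rewrite !lt_min => /andP[h1 h2] /andP[k1 k2].
  have := Hd h k h1 k1; rewrite mul1r => E.
  have E2 : `|f (s + h) (t + k) - f s t| <= `|h| + `|k| + (`|B| * `|h| + `|C| * `|k|).
    rewrite -[X in `|X|](subrK (B * h + C * k)); apply: le_trans (ler_normD _ _) _.
    apply: lerD => //; apply: le_trans (ler_normD _ _) _; rewrite !normrM.
    by rewrite lerD.
  apply: (le_lt_trans E2); move: h2 k2; rewrite !ltr_pdivlMr// => h2 k2.
  have : `|B| * `|h| <= (`|B| + `|C| + 2) * `|h| - 2 * `|h|.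
    by have := mulr_ge0 (normr_ge0 C) (normr_ge0 h); lra.
  have : `|C| * `|k| <= (`|B| + `|C| + 2) * `|k| - 2 * `|k|.
    by have := mulr_ge0 (normr_ge0 B) (normr_ge0 k); lra.
  have := normr_ge0 h; have := normr_ge0 k; lra.
split; apply/cvgrPdist_lt => e /key[d d0 Hd].
  apply/nbhs_ballP; exists d => //= t' /=; rewrite /ball/= distrC => tt'.
  rewrite distrC.
  have -> : f s t' = f (s + 0) (t + (t' - t)) by rewrite addr0 subrKC.
  by apply: Hd; rewrite ?normr0.
apply/nbhs_ballP; exists d => //= s' /=; rewrite /ball/= distrC => ss'.
rewrite distrC.
have -> : f s' t = f (s + (s' - s)) (t + 0) by rewrite addr0 subrKC.
by apply: Hd; rewrite ?normr0.
Qed.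

Lemma green_pair_cv s : continuous (v s).
Proof.
move=> t; have [A [B [C H]]] := vw s t.
have [//|] := @near_cont v s t A B; last by [].
by move=> e /H[d d0 Hd]; exists d => // h k /Hd /[apply]-[].
Qed.

Lemma green_pair_cw t : continuous (fun s => w s t).
Proof.
move=> s; have [A [B [C H]]] := vw s t.
have [//|] := @near_cont w s t C A; last by [].
by move=> e /H[d d0 Hd]; exists d => // h k /Hd /[apply]-[].
Qed.

(** The circulation of the form [w ds + v dt] along the boundary of the rectangle; formally the
    integral of [v_s - w_t], which is zero. *)
Let Phi s1 s2 t1 t2 := sint (fun t => v s2 t - v s1 t) t1 t2 -
                       sint (fun s => w s t2 - w s t1) s1 s2.

Let cvB s1 s2 : continuous (fun t => v s2 t - v s1 t).
Proof. by move=> t; apply: cvgB; exact: green_pair_cv. Qed.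

Let cwB t1 t2 : continuous (fun s => w s t2 - w s t1).
Proof. by move=> s; apply: cvgB; exact: green_pair_cw. Qed.

Let Phi_cat_s s1 s2 s3 t1 t2 : s1 <= s2 -> s2 <= s3 ->
  Phi s1 s3 t1 t2 = Phi s1 s2 t1 t2 + Phi s2 s3 t1 t2.
Proof.
move=> s12 s23; rewrite /Phi (sint_cat (@cwB t1 t2) s12 s23).
have -> : (fun t => v s3 t - v s1 t) = (fun t => (v s2 t - v s1 t) + (v s3 t - v s2 t)).
  by apply/funext => t; ring.
by rewrite sintD//; ring.
Qed.

Let Phi_cat_t s1 s2 t1 t2 t3 : t1 <= t2 -> t2 <= t3 ->
  Phi s1 s2 t1 t3 = Phi s1 s2 t1 t2 + Phi s1 s2 t2 t3.
Proof.
move=> t12 t23; rewrite /Phi (sint_cat (@cvB s1 s2) t12 t23).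
have -> : (fun s => w s t3 - w s t1) = (fun s => (w s t2 - w s t1) + (w s t3 - w s t2)).
  by apply/funext => s; ring.
by rewrite sintD//; ring.
Qed.

(** The linear parts contribute [A l m - A m l = 0]. The remainders are [O(e (l + m))] on sides of
    length [l] and [m], hence a bound quadratic in the size. *)
Let Phi_local s t e : 0 < e -> exists2 delta, 0 < delta & forall a b l m,
  0 <= l -> 0 <= m -> l + m < delta -> a <= s <= a + l -> b <= t <= b + m ->
  `|Phi a (a + l) b (b + m)| <= 2 * e * (l + m) ^+ 2.
Proof.
move=> e0; have [A [B [C H]]] := vw s t; have [d d0 Hd] := H e e0.
exists d => // a b l m l0 m0 lmd /andP[as_ sal] /andP[bt tbm].
have near s' t' : a <= s' <= a + l -> b <= t' <= b + m ->
    `|v s' t' - v s t - (A * (s' - s) + B * (t' - t))| <= e * (l + m) /\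
    `|w s' t' - w s t - (C * (s' - s) + A * (t' - t))| <= e * (l + m).
  move=> /andP[as' s'al] /andP[bt' t'bm].
  have hl : `|s' - s| <= l by rewrite ler_norml; apply/andP; split; lra.
  have km : `|t' - t| <= m by rewrite ler_norml; apply/andP; split; lra.
  have := Hd (s' - s) (t' - t); rewrite !subrKC => /(_ _ _)/wrap[||[h1 h2]]; try lra.
  have le1 : e * (`|s' - s| + `|t' - t|) <= e * (l + m) by rewrite ler_pM2l// lerD.
  by split; [apply: le_trans h1 _|apply: le_trans h2 _].
have aal : a <= a <= a + l by rewrite lexx lerDl.
have aal' : a <= a + l <= a + l by rewrite lexx lerDl l0.
have bbm : b <= b <= b + m by rewrite lexx lerDl.
have bbm' : b <= b + m <= b + m by rewrite lexx lerDl m0.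
have h1 : `|sint (fun t => v (a + l) t - v a t) b (b + m) - A * l * (b + m - b)| <=
    2 * e * (l + m) * (b + m - b).
  apply: sint_approx => //; first by rewrite lerDl.
  move=> t' bt'; have [n1 _] := near _ _ aal' bt'; have [n2 _] := near _ _ aal bt'.
  move: n1 n2; rewrite !ler_norml => /andP[? ?] /andP[? ?].
  by apply/andP; split; lra.
have h2 : `|sint (fun s => w s (b + m) - w s b) a (a + l) - A * m * (a + l - a)| <=
    2 * e * (l + m) * (a + l - a).
  apply: sint_approx => //; first by rewrite lerDl.
  move=> s' as'; have [_ n1] := near _ _ as' bbm'; have [_ n2] := near _ _ as' bbm.
  move: n1 n2; rewrite !ler_norml => /andP[? ?] /andP[? ?].
  by apply/andP; split; lra.
rewrite /Phi; move: h1 h2.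
set x := sint _ _ _; set y := sint _ _ _; rewrite !ler_norml => /andP[? ?] /andP[? ?].
by apply/andP; split; lra.
Qed.

Lemma nested_intervals (a b : nat -> R) :
  (forall k, a k <= a k.+1) -> (forall k, b k.+1 <= b k) -> (forall k, a k <= b k) ->
  exists S, forall k, a k <= S <= b k.
Proof.
move=> ai bd ab.
have aij i d : a i <= a (i + d)%N.
  by elim: d => [|d IH]; rewrite ?addn0// addnS (le_trans IH).
have bij i d : b (i + d)%N <= b i.
  by elim: d => [|d IH]; rewrite ?addn0// addnS (le_trans (bd _)).
have ub k i : a i <= b k.
  have [ik|ki] := leqP i k.
    by rewrite -(subnKC ik) in ab *; apply: le_trans (aij _ _) (ab _).
  by rewrite -(subnKC (ltnW ki)); apply: le_trans (ab _) (bij _ _).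
have ne : has_sup (range a).
  split; first by exists (a 0%N); exists 0%N.
  by exists (b 0%N) => _ [i _ <-]; exact: ub.
exists (sup (range a)) => k; apply/andP; split.
  by apply: ub_le_sup; [case: ne|exists k].
by apply: ge_sup; [exists (a 0%N); exists 0%N|move=> _ [i _ <-]; exact: ub].
Qed.

(** Goursat's bisection. The partial derivatives are not known to be continuous, so Green's formula
    cannot be invoked; instead a nonzero circulation is traced through nested quarter rectangles
    down to a point, where it contradicts [Phi_local]. *)
Lemma goursat_rectangle s0 t0 l m : 0 <= l -> 0 <= m ->
  sint (fun t => v (s0 + l) t - v s0 t) t0 (t0 + m) =
  sint (fun s => w s (t0 + m) - w s t0) s0 (s0 + l).
Proof.
move=> l0 m0; apply/eqP; rewrite -subr_eq0 -/(Phi s0 (s0 + l) t0 (t0 + m)).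
apply/negPn/negP => Phi0.
pose L k := l / 2 ^+ k; pose M k := m / 2 ^+ k.
have p2 k : 0 < 2 ^+ k :> R by rewrite exprn_gt0.
have LS k : L k = L k.+1 + L k.+1 by rewrite /L exprS; field; rewrite gt_eqF.
have MS k : M k = M k.+1 + M k.+1 by rewrite /M exprS; field; rewrite gt_eqF.
have L0 k : 0 <= L k by rewrite divr_ge0// ltW.
have M0 k : 0 <= M k by rewrite divr_ge0// ltW.
pose c := `|Phi s0 (s0 + l) t0 (t0 + m)|.
have c0 : 0 < c by rewrite normr_gt0.
(* Each bisection retains at least a quarter of the circulation, while the square of the size is
   divided by exactly four. *)
pose P k (x : R * R) := c / 4 ^+ k <= `|Phi x.1 (x.1 + L k) x.2 (x.2 + M k)|.
have step (kx : nat * (R * R)) : exists y : R * R, P kx.1 kx.2 ->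
    [/\ P kx.1.+1 y, kx.2.1 <= y.1 <= kx.2.1 + L kx.1.+1 &
        kx.2.2 <= y.2 <= kx.2.2 + M kx.1.+1].
  case: kx => k [s t] /=; have [Pk|nP] := pselect (P k (s, t)); last by exists (s, t).
  have := Pk; rewrite /P/= LS MS !addrA.
  rewrite (@Phi_cat_s s (s + L k.+1) (s + L k.+1 + L k.+1)) ?lerDl//.
  rewrite (@Phi_cat_t s (s + L k.+1) t (t + M k.+1) (t + M k.+1 + M k.+1)) ?lerDl//.
  rewrite (@Phi_cat_t (s + L k.+1) (s + L k.+1 + L k.+1) t (t + M k.+1)
    (t + M k.+1 + M k.+1)) ?lerDl//.
  set A1 := Phi s _ t _; set A2 := Phi s _ _ _; set A3 := Phi _ _ t _; set A4 := Phi _ _ _ _.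
  have -> : c / 4 ^+ k = 4 * (c / 4 ^+ k.+1).
    by rewrite exprS; field; rewrite gt_eqF// exprn_gt0.
  move=> H.
  have H4 : 4 * (c / 4 ^+ k.+1) <= `|A1| + `|A2| + (`|A3| + `|A4|).
    by apply: le_trans H _; apply: le_trans (ler_normD _ _) _; rewrite lerD// ler_normD.
  have Lk := L0 k.+1; have Mk := M0 k.+1.
  have [h1|h1] := leP (c / 4 ^+ k.+1) `|A1|.
    by exists (s, t) => _; split => //=; apply/andP; split; lra.
  have [h2|h2] := leP (c / 4 ^+ k.+1) `|A2|.
    by exists (s, t + M k.+1) => _; split => //=; apply/andP; split; lra.
  have [h3|h3] := leP (c / 4 ^+ k.+1) `|A3|.
    by exists (s + L k.+1, t) => _; split => //=; apply/andP; split; lra.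
  have [h4|h4] := leP (c / 4 ^+ k.+1) `|A4|.
    by exists (s + L k.+1, t + M k.+1) => _; split => //=; apply/andP; split; lra.
  exfalso; lra.
have [g Hg] := choice step.
pose f := fix f k := if k is k'.+1 then g (k', f k') else (s0, t0).
have fP k : P k (f k).
  elim: k => [|k IH]; first by rewrite /P/= /L /M expr0 !divr1.
  by have [] := Hg (k, f k) IH.
have fs k : (f k).1 <= (f k.+1).1 <= (f k).1 + L k.+1 by have [] := Hg (k, f k) (fP k).
have ft k : (f k).2 <= (f k.+1).2 <= (f k).2 + M k.+1 by have [] := Hg (k, f k) (fP k).
have [S HS] : exists S, forall k, (f k).1 <= S <= (f k).1 + L k.
  apply: nested_intervals => k; first by have /andP[] := fs k.
    by have /andP[] := fs k; rewrite (LS k); lra.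
  by rewrite lerDl.
have [T HT] : exists T, forall k, (f k).2 <= T <= (f k).2 + M k.
  apply: nested_intervals => k; first by have /andP[] := ft k.
    by have /andP[] := ft k; rewrite (MS k); lra.
  by rewrite lerDl.
(* Chosen so that [2 e (l + m)^2 < c]; the added [1] keeps the denominator positive. *)
pose e := c / (4 * ((l + m) ^+ 2 + 1)).
have q0 : 0 <= (l + m) ^+ 2 by rewrite sqr_ge0.
have e0 : 0 < e by rewrite divr_gt0//; lra.
have [d d0 Hd] := Phi_local S T e0.
have [k kd] : exists k, (l + m) / 2 ^+ k < d.
  exists (Num.truncn ((l + m) / d)).+1.
  rewrite ltr_pdivrMr// mulrC -ltr_pdivrMr//.
  apply: lt_le_trans (truncnS_gt _) _.
  rewrite -natrX ler_nat ltnW// ltn_expl//.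
have lmk : L k + M k = (l + m) / 2 ^+ k by rewrite /L /M mulrDl.
have := Hd (f k).1 (f k).2 (L k) (M k) (L0 k) (M0 k) _ (HS k) (HT k).
rewrite lmk => /(_ kd); have := fP k; rewrite /P => /le_trans h /h.
rewrite expr_div_n -exprM mulnC exprM (_ : 2 ^+ 2 = 4 :> R); last by rewrite expr2; lra.
rewrite mulrA ler_pM2r ?invr_gt0 ?exprn_gt0//.
rewrite /e; have q1 : 0 < 4 * ((l + m) ^+ 2 + 1) by lra.
have -> : 2 * (c / (4 * ((l + m) ^+ 2 + 1))) * (l + m) ^+ 2 =
   c * (2 * (l + m) ^+ 2) / (4 * ((l + m) ^+ 2 + 1)) by field; lra.
rewrite ler_pdivlMr// ler_pM2l//; lra.
Qed.

(** Periodicity of [w] cancels the two sides parallel to the [s] axis. In logarithmic coordinates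
    this is Cauchy's theorem for an annulus. *)
Lemma green_pair_periodic (T : R) : 0 <= T -> (forall s t, w s (t + T) = w s t) ->
  forall s1 s2 t0, sint (v s1) t0 (t0 + T) = sint (v s2) t0 (t0 + T).
Proof.
move=> T0 wT s1 s2 t0.
wlog s12 : s1 s2 / s1 <= s2.
  by move=> H; have [/H//|/ltW/H] := leP s1 s2.
have := @goursat_rectangle s1 t0 (s2 - s1) T; rewrite subr_ge0 subrKC => /(_ s12 T0).
rewrite sintB; [|exact: green_pair_cv|exact: green_pair_cv].
have -> : (fun s => w s (t0 + T) - w s t0) = (fun=> 0).
  by apply/funext => s; rewrite wT subrr.
by rewrite sint_cst// mul0r => /eqP; rewrite subr_eq0 => /eqP.
Qed.

End Goursat.

(** * Complex differentiability and the exponential *)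

Section ComplexDifferentiability.
Variable R : realType.
Implicit Types (F G q r : R[i] -> R[i]) (z h : R[i]).

Definition ccont0 q := forall eps : R, 0 < eps -> exists2 delta : R, 0 < delta &
  forall h, cabs h < delta -> cabs (q h - q 0) <= eps.

(* Caratheodory's form of differentiability: [q] is the difference quotient. *)
Definition cdiff F z := exists2 q, ccont0 q & forall h, F (z + h) = F z + q h * h.

Lemma ccont0_cst (c : R[i]) : ccont0 (fun=> c).
Proof. by move=> e e0; exists 1 => // h _; rewrite subrr cabs0 ltW. Qed.

Lemma ccont0_id : ccont0 id.
Proof. by move=> e e0; exists e => // h he; rewrite subr0 ltW. Qed.

Lemma ccont0D q r : ccont0 q -> ccont0 r -> ccont0 (fun h => q h + r h).
Proof.
move=> cq cr e e0; have e20 : 0 < e / 2 by rewrite divr_gt0.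
have [d1 d10 H1] := cq _ e20; have [d2 d20 H2] := cr _ e20.
exists (Num.min d1 d2); first by rewrite lt_min d10.
move=> h; rewrite lt_min => /andP[h1 h2].
rewrite (_ : _ - _ = (q h - q 0) + (r h - r 0)); last by ring.
by apply: le_trans (cabsD _ _) _; rewrite [leRHS]splitr lerD ?H1 ?H2.
Qed.

Lemma ccont0M q r : ccont0 q -> ccont0 r -> ccont0 (fun h => q h * r h).
Proof.
move=> cq cr e e0.
pose A := cabs (q 0); pose B := cabs (r 0).
have A0 : 0 <= A by exact: cabs_ge0.
have B0 : 0 <= B by exact: cabs_ge0.
pose e1 := Num.min 1 (e / (A + B + 1)).
have AB : 0 < A + B + 1 by lra.
have e10 : 0 < e1 by rewrite lt_min ltr01 divr_gt0.
have [d1 d10 H1] := cq _ e10; have [d2 d20 H2] := cr _ e10.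
exists (Num.min d1 d2); first by rewrite lt_min d10.
move=> h; rewrite lt_min => /andP[/H1 h1 /H2 h2].
rewrite (_ : _ - _ = (q h - q 0) * (r h - r 0) + ((q h - q 0) * r 0 + q 0 * (r h - r 0))); last by ring.
apply: le_trans (cabsD _ _) _; rewrite cabsM.
have l1 : cabs (q h - q 0) * cabs (r h - r 0) <= e1 * 1.
  by rewrite ler_pM ?cabs_ge0//; apply: le_trans h2 _; rewrite ge_min lexx.
have l2 : cabs ((q h - q 0) * r 0 + q 0 * (r h - r 0)) <= e1 * B + A * e1.
  by apply: le_trans (cabsD _ _) _; rewrite !cabsM lerD// ?ler_wpM2l ?ler_wpM2r ?cabs_ge0.
apply: le_trans (lerD l1 l2) _.
have -> : e1 * 1 + (e1 * B + A * e1) = e1 * (A + B + 1) by ring.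
by rewrite -ler_pdivlMr// ge_min lexx orbT.
Qed.

Lemma ccont0_comp q r : ccont0 q -> ccont0 r -> r 0 = 0 -> ccont0 (q \o r).
Proof.
move=> cq cr r0 e e0; have [d d0 H] := cq _ e0.
have d20 : 0 < d / 2 by rewrite divr_gt0.
have [d' d'0 H'] := cr _ d20; exists d' => // h hd /=; rewrite r0; apply: H.
by have := H' h hd; rewrite r0 subr0; lra.
Qed.

Lemma cdiff_eps F z (c : R[i]) :
  (forall eps : R, 0 < eps -> exists2 delta : R, 0 < delta & forall h : R[i],
     0 < cabs h < delta -> cabs (F (z + h) - F z - c * h) <= eps * cabs h) ->
  cdiff F z.
Proof.
move=> H; exists (fun h => if h == 0 then c else (F (z + h) - F z) / h); last first.
  move=> h; case: eqVneq => [->|h0]; first by rewrite addr0 mulr0 addr0.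
  by rewrite divfK// subrKC.
move=> e e0; have [d d0 Hd] := H e e0; exists d => // h hd; rewrite eqxx.
case: eqVneq => [_|h0]; first by rewrite subrr cabs0 ltW.
have ch : 0 < cabs h by rewrite lt_def cabs_ge0 cabs_eq0 h0.
rewrite -(ler_pM2r ch) -cabsM mulrBl divfK//; apply: Hd.
by rewrite ch hd.
Qed.

Lemma eps_cdiff F z : cdiff F z -> exists c, forall eps : R, 0 < eps ->
  exists2 delta : R, 0 < delta & forall h : R[i], cabs h < delta ->
    cabs (F (z + h) - F z - c * h) <= eps * cabs h.
Proof.
move=> [q cq qE]; exists (q 0) => e e0; have [d d0 Hd] := cq e e0.
exists d => // h hd; rewrite qE (_ : _ - _ - _ = (q h - q 0) * h) ?cabsM; last by ring.
by rewrite ler_wpM2r ?cabs_ge0// Hd.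
Qed.

Lemma cdiff_cst (c : R[i]) z : cdiff (fun=> c) z.
Proof. by exists (fun=> 0); [exact: ccont0_cst|move=> h; rewrite mul0r addr0]. Qed.

Lemma cdiff_id z : cdiff id z.
Proof. by exists (fun=> 1); [exact: ccont0_cst|move=> h; rewrite mul1r]. Qed.

Lemma cdiff_opp z : cdiff (fun z => - z) z.
Proof. by exists (fun=> - 1); [exact: ccont0_cst|move=> h; rewrite mulN1r opprD]. Qed.

Lemma cdiffM F G z : cdiff F z -> cdiff G z -> cdiff (fun z => F z * G z) z.
Proof.
move=> [q cq qE] [r cr rE].
exists (fun h => q h * (G z + r h * h) + F z * r h); last first.
  by move=> h; rewrite qE rE; ring.
apply: ccont0D; apply: ccont0M => //; last exact: ccont0_cst.
by apply: ccont0D; [exact: ccont0_cst|apply: ccont0M => //; exact: ccont0_id].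
Qed.

Lemma cdiffX F z k : cdiff F z -> cdiff (fun z => F z ^+ k) z.
Proof.
move=> dF; elim: k => [|k IH]; first exact: cdiff_cst.
have -> : (fun z => F z ^+ k.+1) = (fun z => F z * F z ^+ k).
  by apply/funext => x; rewrite exprS.
exact: cdiffM.
Qed.

Lemma cdiff_comp F G z : cdiff F (G z) -> cdiff G z -> cdiff (F \o G) z.
Proof.
move=> [q cq qE] [r cr rE]; exists (fun h => q (r h * h) * r h); last first.
  by move=> h /=; rewrite rE qE mulrA.
apply: ccont0M => //; apply: (@ccont0_comp q (fun h => r h * h)) => //.
  by apply: ccont0M => //; exact: ccont0_id.
by rewrite mulr0.
Qed.

Definition cexp z : R[i] :=
  (expR (complex.Re z) * cos (complex.Im z)) +i* (expR (complex.Re z) * sin (complex.Im z)).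

Lemma cexpD z h : cexp (z + h) = cexp z * cexp h.
Proof.
case: z => a b; case: h => c d; rewrite /cexp/= expRD cosD sinD.
by congr (_ +i* _); ring.
Qed.

Lemma is_derive_eps (f : R -> R) (x d : R) : is_derive x 1 f d ->
  forall eps : R, 0 < eps -> exists2 delta : R, 0 < delta & forall h : R, `|h| < delta ->
    `|f (x + h) - f x - d * h| <= eps * `|h|.
Proof.
move=> [df dfE] e e0; move: df; rewrite /derivable => /cvg_ex[l /= Hl].
have dl : d = l by rewrite -dfE; apply/cvg_lim.
move: Hl => /cvgrPdist_lt/(_ _ e0); rewrite /dnbhs /within/= => /nbhs_ballP[r /= r0 Hr].
exists r => // h hr; have [->|h0] := eqVneq h 0.
  by rewrite addr0 subrr mulr0 subrr normr0 mulr0.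
have := Hr h _ h0; rewrite /ball/= sub0r normrN => /(_ hr).
rewrite -dl distrC /GRing.scale/= mulr1 [h + x]addrC => H.
have hh : 0 < `|h| by rewrite normr_gt0.
have -> : f (x + h) - f x - d * h = (h^-1 * (f (x + h) - f x) - d) * h.
  by field.
by rewrite normrM ler_pM2r// ltW.
Qed.

Lemma cdiff_cexp0 : cdiff cexp 0.
Proof.
apply: (@cdiff_eps _ _ 1) => e e0.
(* The real part will cost [3 e1] and the imaginary part [5 e1], relative to [|h|]. *)
have [e1 [e10 e11 e1e]] : exists e1, [/\ 0 < e1, e1 <= 1 & e1 <= e / 20].
  exists (Num.min 1 (e / 20)); split; rewrite ?lt_min ?ltr01 ?divr_gt0//.
    by rewrite ge_min lexx.
  by rewrite ge_min lexx orbT.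
have [d1 d10 H1] := is_derive_eps (is_derive_expR (0 : R)) e10.
have [d2 d20 H2] := is_derive_eps (is_derive_cos (0 : R)) e10.
have [d3 d30 H3] := is_derive_eps (is_derive_sin (0 : R)) e10.
exists (Num.min (Num.min d1 d2) (Num.min d3 e1)).
  by rewrite !lt_min d10 d20 d30 e10.
move=> h /andP[_]; rewrite !lt_min => /andP[/andP[h1 h2] /andP[h3 h4]].
have xh := normr_Re_cabs h; have yh := normr_Im_cabs h.
case: h h1 h2 h3 h4 xh yh => x y /= h1 h2 h3 h4 xh yh.
set c := cabs _ in h1 h2 h3 h4 xh yh *.
have := H1 x (le_lt_trans xh h1); have := H2 y (le_lt_trans yh h2).
have := H3 y (le_lt_trans yh h3); rewrite !add0r expR0 cos0 sin0 oppr0 !mul1r mul0r !subr0 addr0.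
set E := expR x; set S := sin y; set C := cos y => S1 C1 E1.
have C2 : `|C| <= 1 by rewrite ler_norml cos_le1 cos_geN1.
apply: le_trans (cabs_le_ReIm _) _ => /=.
rewrite ?expR0 ?cos0 ?sin0 ?mulr1 ?mulr0 ?mul1r ?mul0r ?oppr0 ?subr0 ?addr0 ?add0r -/E -/C -/S.
have c0 : 0 <= c by exact: cabs_ge0.
have x1 : `|x| <= 1 by lra.
have ec : e1 * c <= e / 20 * c by rewrite ler_wpM2r.
have ex : e1 * `|x| <= e1 * c by rewrite ler_pM2l.
have ey : e1 * `|y| <= e1 * c by rewrite ler_pM2l.
have cc : c * c <= e1 * c by rewrite ler_wpM2r// ltW.
have exc : `|E| <= 3.
  have -> : `|E| = `|(E - 1 - x) + (1 + x)| by congr `| _ |; ring.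
  apply: le_trans (ler_normD _ _) _.
  have : `|1 + x| <= 2 by apply: le_trans (ler_normD _ _) _; rewrite normr1; lra.
  have : e1 * `|x| <= 1 by rewrite -[leRHS]mulr1 ler_pM// ltW.
  lra.
have re : `|E * C - 1 - x| <= 3 * (e1 * c).
  rewrite (_ : E * C - 1 - x = (E - 1 - x) * C + (1 + x) * (C - 1)); last by ring.
  apply: le_trans (ler_normD _ _) _; rewrite !normrM.
  have a1 : `|E - 1 - x| * `|C| <= e1 * c * 1 by rewrite ler_pM//; lra.
  have a2 : `|1 + x| * `|C - 1| <= 2 * (e1 * c).
    rewrite ler_pM//; last lra.
    by apply: le_trans (ler_normD _ _) _; rewrite normr1; lra.
  lra.
have im : `|E * S - y| <= 5 * (e1 * c).
  rewrite (_ : E * S - y = E * (S - y) + ((E - 1 - x) * y + x * y)); last by ring.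
  apply: le_trans (ler_normD _ _) _; rewrite normrM.
  have a1 : `|E| * `|S - y| <= 3 * (e1 * c) by rewrite ler_pM//; lra.
  have a2 : `|(E - 1 - x) * y + x * y| <= e1 * c * 1 + c * c.
    by apply: le_trans (ler_normD _ _) _; rewrite !normrM lerD// ler_pM//; lra.
  lra.
have : 0 <= e * c by rewrite mulr_ge0// ltW.
lra.
Qed.

Lemma cdiff_cexp z : cdiff cexp z.
Proof.
have [q cq qE] := cdiff_cexp0; exists (fun h => cexp z * q h).
  by apply: ccont0M => //; exact: ccont0_cst.
move=> h; rewrite cexpD; have := qE h; rewrite add0r => ->.
have -> : cexp 0 = 1 by rewrite /cexp/= expR0 cos0 sin0 mulr1 mulr0.
by ring.
Qed.

Lemma green_pair_cdiff F : (forall z, cdiff F z) ->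
  green_pair (fun s t => complex.Re (F (s +i* t))) (fun s t => complex.Im (F (s +i* t))).
Proof.
move=> dF s t; have [c Hc] := eps_cdiff (dF (s +i* t)).
exists (complex.Re c), (- complex.Im c), (complex.Im c) => e e0.
have [d d0 Hd] := Hc e e0.
exists (d / 2); first by rewrite divr_gt0.
move=> h k hd kd.
have ch := cabs_le_ReIm (h +i* k); rewrite /= in ch.
have := Hd (h +i* k) _; move=> /(_ _)/wrap[|H]; first lra.
have le1 : e * cabs (h +i* k) <= e * (`|h| + `|k|) by rewrite ler_pM2l.
have H' := le_trans H le1; split.
  have := le_trans (normr_Re_cabs _) H'.
  rewrite (_ : (s +i* t) + (h +i* k) = (s + h) +i* (t + k))//.
  case: (F _) => a b; case: (F _) => a' b'; case: {Hc Hd H H'} c => c1 c2 /=.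
  by rewrite mulNr.
have := le_trans (normr_Im_cabs _) H'.
rewrite (_ : (s +i* t) + (h +i* k) = (s + h) +i* (t + k))//.
case: (F _) => a b; case: (F _) => a' b'; case: {Hc Hd H H'} c => c1 c2 /=.
by rewrite [c1 * k + _]addrC.
Qed.

(** The function [v s (x + t)] has equal partial derivatives in [x] and [t], so paired with itself
    it is a [green_pair]. Then [green_pair_periodic] in the variable [x] is the invariance under a
    shift of the starting angle. *)
Lemma sint_periodic_shift (v w : R -> R -> R) (T : R) : green_pair v w -> 0 <= T ->
  (forall s t, v s (t + T) = v s t) ->
  forall s t0, sint (fun t => v s (t0 + t)) 0 T = sint (v s) 0 T.
Proof.
move=> vw T0 vT s t0.
have gp : green_pair (fun x t => v s (x + t)) (fun x t => v s (x + t)).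
  move=> x t; have [A [B [C H]]] := vw s (x + t).
  exists B, B, B => e e0; have [d d0 Hd] := H e e0.
  exists (d / 2); first by rewrite divr_gt0.
  move=> h k hd kd.
  have hk : `|h + k| <= `|h| + `|k| := ler_normD _ _.
  have := Hd 0 (h + k); rewrite normr0 addr0 mulr0 !add0r => /(_ d0 _)/wrap[|[h1 _]]; first lra.
  have h2 : `|v s (x + h + (t + k)) - v s (x + t) - (B * h + B * k)| <= e * (`|h| + `|k|).
    rewrite -mulrDr addrACA; apply: le_trans h1 _; by rewrite ler_pM2l.
  by split.
have := green_pair_periodic gp T0 _ t0 0 0; rewrite add0r => ->.
  by congr sint; apply/funext => t; rewrite add0r.
by move=> x t; rewrite addrA vT.
Qed.

End ComplexDifferentiability.

Section ComplexContinuity.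
Variables (R : realType) (n : nat).
Implicit Type F G : ('I_n -> R[i]) -> R[i].

Definition ccontinuousC F := forall z (eps : R), 0 < eps -> exists2 delta : R, 0 < delta &
  forall w, (forall i, cabs (w i - z i) < delta) -> cabs (F w - F z) < eps.

Lemma ccontinuousC_cst (c : R[i]) : ccontinuousC (fun=> c).
Proof. by move=> z e e0; exists 1 => // w _; rewrite subrr cabs0. Qed.

Lemma ccontinuousC_coord i : ccontinuousC (fun z => z i).
Proof. by move=> z e e0; exists e => // w; exact. Qed.

Lemma ccontinuousCJ F : ccontinuousC F -> ccontinuousC (fun z => (F z)^*).
Proof.
move=> cF z e /(cF z)[d d0 H]; exists d => // w /H.
by rewrite -[X in X < _ -> _]cabsJ rmorphB.
Qed.

Lemma ccontinuousCM F G : ccontinuousC F -> ccontinuousC G ->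
  ccontinuousC (fun z => F z * G z).
Proof.
move=> cF cG z e e0.
have A0 : 0 <= cabs (F z) by exact: cabs_ge0.
have B0 : 0 <= cabs (G z) by exact: cabs_ge0.
have AB : 0 < cabs (F z) + cabs (G z) + 1 by lra.
have [e1 [e10 e11 e1e]] : exists e1, [/\ 0 < e1, e1 <= 1 &
    e1 <= e / 2 / (cabs (F z) + cabs (G z) + 1)].
  exists (Num.min 1 (e / 2 / (cabs (F z) + cabs (G z) + 1))).
  split; rewrite ?lt_min ?ltr01 ?divr_gt0//; first by rewrite ge_min lexx.
  by rewrite ge_min lexx orbT.
have [d1 d10 H1] := cF z _ e10; have [d2 d20 H2] := cG z _ e10.
exists (Num.min d1 d2); first by rewrite lt_min d10.
move=> w wz.
have /ltW h1 : cabs (F w - F z) < e1.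
  by apply: H1 => i; have := wz i; rewrite lt_min => /andP[].
have /ltW h2 : cabs (G w - G z) < e1.
  by apply: H2 => i; have := wz i; rewrite lt_min => /andP[].
rewrite (_ : _ - _ = (F w - F z) * (G w - G z) +
   ((F w - F z) * G z + F z * (G w - G z))); last by ring.
apply: le_lt_trans (cabsD _ _) _; rewrite cabsM.
have l1 : cabs (F w - F z) * cabs (G w - G z) <= e1 * 1.
  by rewrite ler_pM ?cabs_ge0//; exact: le_trans h2 _.
have l2 : cabs ((F w - F z) * G z + F z * (G w - G z)) <=
    e1 * cabs (G z) + cabs (F z) * e1.
  by apply: le_trans (cabsD _ _) _; rewrite !cabsM lerD// ?ler_wpM2l ?ler_wpM2r ?cabs_ge0.
apply: le_lt_trans (lerD l1 l2) _.
apply: (@le_lt_trans _ _ (e / 2)); last by rewrite ltr_pdivrMr//; lra.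
have -> : e1 * 1 + (e1 * cabs (G z) + cabs (F z) * e1) =
    e1 * (cabs (F z) + cabs (G z) + 1) by ring.
by rewrite -ler_pdivlMr.
Qed.

Lemma ccontinuousC_monomial (j : 'I_n -> nat) : ccontinuousC (monomial j).
Proof.
rewrite /monomial; elim: (index_enum _) => [|i r IH].
  have -> : (fun z : 'I_n -> R[i] => \prod_(i <- [::]) z i ^+ j i) = (fun=> 1).
    by apply/funext => z; rewrite big_nil.
  exact: ccontinuousC_cst.
have -> : (fun z : 'I_n -> R[i] => \prod_(i <- i :: r) z i ^+ j i) =
    (fun z => z i ^+ j i * \prod_(i <- r) z i ^+ j i).
  by apply/funext => z; rewrite big_cons.
apply: ccontinuousCM => //; elim: (j i) => [|k IHk]; first exact: ccontinuousC_cst.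
have -> : (fun z : 'I_n -> R[i] => z i ^+ k.+1) = (fun z => z i * z i ^+ k).
  by apply/funext => z; rewrite exprS.
by apply: ccontinuousCM => //; exact: ccontinuousC_coord.
Qed.

Lemma ccontinuous_Re F : ccontinuousC F -> ccontinuous (fun z => complex.Re (F z)).
Proof.
move=> cF z e /(cF z)[d d0 H]; exists d => // w /H; apply: le_lt_trans.
by rewrite -raddfB; exact: normr_Re_cabs.
Qed.

Lemma ccontinuous_cabs F : ccontinuousC F -> ccontinuous (fun z => cabs (F z)).
Proof.
move=> cF z e /(cF z)[d d0 H]; exists d => // w /H; apply: le_lt_trans.
exact: ler_cabsB.
Qed.

End ComplexContinuity.

(** * Cauchy's theorem on circles *)

Section CircleMeanValue.
Variable R : realType.
Local Notation RT := (measurableTypeR R).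
Local Notation mu := (@lebesgue_measure R).

Let twopi_gt0 : (0 : R) < pi *+ 2.
Proof. by rewrite mulrn_wgt0 ?pi_gt0. Qed.

Definition circle_prob : probability RT R := uniform_prob twopi_gt0.

Lemma circle_prob_avg (f : RT -> R) (M : R) : measurable_fun setT f ->
  (forall t, `|f t| <= M) ->
  Rintegral circle_prob setT f = (pi *+ 2)^-1 * sint f 0 (pi *+ 2).
Proof.
move=> mf fM; have M0 : 0 <= M by exact: le_trans (fM 0).
(* The formula [integral_uniform] is applied to nonnegative functions, so [f] is first raised by its
   bound [M]. *)
have mfM : measurable_fun setT (fun t => f t + M) by exact: measurable_funD.
have f0 t : (0 <= (f t + M)%:E)%E.
  by rewrite lee_fin; have := fM t; rewrite ler_norml => /andP[]; lra.
have mE : measurable_fun setT (fun t : RT => (f t + M)%:E) by apply/measurable_EFinP.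
have U := @integral_uniform R 0 (pi *+ 2) twopi_gt0 _ mE f0.
have ifl : mu.-integrable `[0, pi *+ 2] (EFin \o f).
  apply: measurable_bounded_integrable => //.
  - by rewrite /= lebesgue_measure_itv/= lte_fin twopi_gt0 -EFinB ltry.
  - exact: measurable_funTS.
  exists M; split; first exact: num_real.
  by move=> x Mx t _; exact: le_trans (fM t) (ltW Mx).
have cc (k : R) : continuous (fun _ : R => k) by move=> x; exact: cvg_cst.
have icl : mu.-integrable `[0, pi *+ 2] (EFin \o (fun _ : R => M)).
  exact: continuous_sintegrable.
have E1 : Rintegral circle_prob setT (fun t => f t + M) =
   (pi *+ 2)^-1 * Rintegral mu `[0, pi *+ 2] (fun t => f t + M).
  rewrite /Rintegral [X in fine X = _]U subr0 fineM//.
  apply: (integrable_fin_num _ (_ : mu.-integrable _ (EFin \o (fun t => f t + M)))) => //.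
  exact: (integrableD _ ifl icl).
have ic : circle_prob.-integrable setT (EFin \o (cst M : RT -> R)).
  by apply: (@bounded_integrable _ _ _ `|M|).
have E2 : Rintegral circle_prob setT (fun t => f t + M) = Rintegral circle_prob setT f + M.
  rewrite (@RintegralD _ _ _ circle_prob setT f (cst M))//; last exact: bounded_integrable fM.
  by rewrite Rintegral_cst//= (probability_setT circle_prob) mulr1.
have E3 : Rintegral mu `[0, pi *+ 2] (fun t => f t + M) =
    sint f 0 (pi *+ 2) + M * (pi *+ 2).
  rewrite RintegralD//; congr (_ + _).
  by have := @sint_cst R M 0 (pi *+ 2) (ltW twopi_gt0); rewrite subr0.
apply: (addIr M); rewrite -E2 E1 E3 mulrDr; congr (_ + _).
by rewrite mulrCA mulVf ?mulr1// gt_eqF.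
Qed.

Lemma polar_form (z : R[i]) : z != 0 -> exists s t, z = cexp (s +i* t).
Proof.
move=> z0; have c0 : 0 < cabs z by rewrite lt_def cabs_eq0 z0 cabs_ge0.
exists (ln (cabs z)).
have zr := sqr_cabs z.
case: z c0 zr {z0} => a b; set r := cabs _ => r0 /= zr.
pose c := a / r; pose d := b / r.
have cd : c ^+ 2 + d ^+ 2 = 1.
  by rewrite /c /d !expr_div_n -mulrDl -zr mulfV// gt_eqF// exprn_gt0.
have c1 : -1 <= c <= 1.
  rewrite -ler_norml -(@ler_sqr _ `|c|) ?nnegrE// expr1n real_normK ?num_real//.
  by rewrite -cd lerDl sqr_ge0.
have ca : cos (acos c) = c by rewrite acosK// in_itv.
have sa : sin (acos c) = `|d|.
  by rewrite sin_acos// -cd addrC addKr sqrtr_sqr.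
have aE : r * c = a by rewrite /c mulrC divfK ?gt_eqF.
have bE : r * d = b by rewrite /d mulrC divfK ?gt_eqF.
have [d0|d0] := leP 0 d.
  by exists (acos c); rewrite /cexp/= lnK ?posrE// ca sa ger0_norm// aE bE.
exists (- acos c); rewrite /cexp/= lnK ?posrE// cosN sinN ca sa ltr0_norm//.
by rewrite opprK aE bE.
Qed.

Lemma cabs_cexp (s t : R) : cabs (cexp (s +i* t)) = expR s.
Proof.
rewrite /cabs /cexp/= !exprMn -mulrDr cos2Dsin2 mulr1 sqrtr_sqr ger0_norm// expR_ge0.
Qed.

Lemma cis_cexp (s t0 t : R) : cis t * cexp (s +i* t0) = cexp (s +i* (t0 + t)).
Proof.
have -> : s +i* (t0 + t) = (0 +i* t) + (s +i* t0) :> R[i].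
  by apply/eqP; rewrite eq_complex/= add0r [t + _]addrC !eqxx.
by rewrite cexpD; congr (_ * _); rewrite /cexp/= expR0 !mul1r.
Qed.

(** On the circle of radius [e^s] the conjugate of [z] is [e^(2 s) / z]: conjugation becomes
    holomorphic up to a radial factor. *)
Lemma conjc_cexp (s t : R) :
  (cexp (s +i* t))^* = ((expR s) ^+ 2)%:C * cexp (- (s +i* t)) :> R[i].
Proof.
apply/eqP; rewrite eq_complex/= !mul0r subr0 addr0 cosN sinN expRN.
have e0 : expR s != 0 by rewrite gt_eqF ?expR_gt0.
by apply/andP; split; apply/eqP; field.
Qed.

Variable n : nat.
Variables (g : ('I_n -> R[i]) -> R[i]) (j : 'I_n -> nat) (kappa : R[i]).
Hypothesis hg : holomorphic g.

Let u z := complex.Re (kappa * (g z * (monomial j z)^*)).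

Lemma ccontinuousC_pairing : ccontinuousC (fun z => kappa * (g z * (monomial j z)^*)).
Proof.
apply: ccontinuousCM; first exact: ccontinuousC_cst.
apply: ccontinuousCM; first by case: hg.
exact/ccontinuousCJ/ccontinuousC_monomial.
Qed.

Let cu : ccontinuous u := ccontinuous_Re ccontinuousC_pairing.
Let mu' : cmeasurable (u : _ -> RT) := ccontinuous_cmeasurable cu.
Let lu : locally_bounded u := ccontinuous_locally_bounded cu.

Lemma setc_id (i : 'I_n) (z : 'I_n -> R[i]) : setc i (z i) z = z.
Proof. by apply/funext => k; rewrite /setc; case: eqVneq => [->|]. Qed.

Lemma rotc_setc (i : 'I_n) c d (z : 'I_n -> R[i]) : rotc i c (setc i d z) = setc i (c * d) z.
Proof. by apply/funext => k; rewrite /setc /rotc; case: eqVneq. Qed.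

Lemma cdiff_setc (i : 'I_n) (z : 'I_n -> R[i]) (c : R[i]) : cdiff (fun c => g (setc i c z)) c.
Proof.
have [d Hd] := hg.2 (setc i c z) i; apply: (cdiff_eps (c := d)) => e /Hd[dl dl0 H].
exists dl => // h /H; congr (cabs (g _ - _ - _) <= _).
by apply/funext => k; rewrite /shift_coord /setc; case: eqVneq.
Qed.

(** In the coordinate [s + i t = log z_i], the function [u] is [e^(2 j_i s)] times the real part of
    [Q], where the conjugate powers of [z_i] have become powers of [1 / z_i]. There [Q] has no pole
    and is [2 pi]-periodic in [t], so its mean over a period does not depend on [s]. *)
Let mean_circle (i : 'I_n) (z : 'I_n -> R[i]) : exists K, forall s t,
  avg circle_prob i u (setc i (cexp (s +i* t)) z) = expR s ^+ (2 * j i) * K.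
Proof.
pose H : R[i] := (\prod_(k < n | k != i) z k ^+ j k)^*.
pose Q (c : R[i]) := kappa * H * (g (setc i (cexp c) z) * cexp (- c) ^+ j i).
have dQ c : cdiff Q c.
  apply: cdiffM; first exact: cdiff_cst.
  apply: cdiffM; first exact: (cdiff_comp (cdiff_setc i z (cexp c)) (cdiff_cexp c)).
  apply: cdiffX; exact: (cdiff_comp (cdiff_cexp (- c)) (cdiff_opp c)).
pose V s t := complex.Re (Q (s +i* t)); pose W s t := complex.Im (Q (s +i* t)).
have gp : green_pair V W by exact: green_pair_cdiff.
have Qper s t : Q (s +i* (t + pi *+ 2)) = Q (s +i* t).
  rewrite /Q; have -> : cexp (s +i* (t + pi *+ 2)) = cexp (s +i* t).
    by rewrite /cexp/= cosD2pi sinD2pi.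
  congr (_ * (_ * _ ^+ _)).
  by rewrite /cexp/= !cosN !sinN cosD2pi sinD2pi.
have T0 : 0 <= pi *+ 2 :> R := ltW twopi_gt0.
have uE s t : u (setc i (cexp (s +i* t)) z) = expR s ^+ (2 * j i) * V s t.
  have sE : setc i (cexp (s +i* t)) z i = cexp (s +i* t) by rewrite /setc eqxx.
  rewrite /u /monomial (bigD1 i)//= sE.
  rewrite (eq_bigr (fun k => z k ^+ j k)); last by move=> k /negPf; rewrite /setc => ->.
  rewrite rmorphM rmorphXn /= conjc_cexp -/H exprMn -rmorphXn -exprM.
  rewrite (_ : _ * _ = (expR s ^+ (2 * j i))%:C * Q (s +i* t)); last by rewrite /Q; ring.
  by rewrite /V; case: (Q _) => a b /=; rewrite mul0r subr0.
exists ((pi *+ 2)^-1 * sint (V 0) 0 (pi *+ 2)) => s t0.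
rewrite /avg; have [M HM] := rot_bounded i (setc i (cexp (s +i* t0)) z) lu.
rewrite (circle_prob_avg (measurable_rot i _ mu') HM).
have -> : (fun t => u (rotc i (cis t) (setc i (cexp (s +i* t0)) z))) =
   (fun t => expR s ^+ (2 * j i) * V s (t0 + t)).
  by apply/funext => t; rewrite rotc_setc cis_cexp uE.
have cV : continuous (fun t => V s (t0 + t)).
  move=> t; apply: continuous_comp; last exact: green_pair_cv.
  by apply: cvgD; [exact: cvg_cst|exact: cvg_id].
have -> : sint (fun t => expR s ^+ (2 * j i) * V s (t0 + t)) 0 (pi *+ 2) =
   expR s ^+ (2 * j i) * sint (fun t => V s (t0 + t)) 0 (pi *+ 2).
  by rewrite /sint RintegralZl//; exact: continuous_sintegrable.
rewrite (sint_periodic_shift gp T0); last by move=> *; rewrite /V Qper.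
have := green_pair_periodic gp T0 _ s 0 0; rewrite add0r => ->; first by rewrite mulrCA.
by move=> *; rewrite /W Qper.
Qed.

(** Polar coordinates miss [z_i = 0]. There both sides vanish if [j i > 0]; if [j i = 0] the claim
    is a mean value property, obtained from circles shrinking to the point. *)
Lemma circle_homogeneous_holomorphic : circle_homogeneous circle_prob j u.
Proof.
split => // i z; have [K HK] := mean_circle i z.
have c10 : cexp (0 +i* 0) = 1 :> R[i].
  by rewrite /cexp/= expR0 cos0 sin0 mulr1 mulr0.
have KE : avg circle_prob i u (setc i 1 z) = K.
  by have := HK 0 0; rewrite c10 expR0 expr1n mul1r.
have [zi0|zi0] := eqVneq (z i) 0; last first.
  have [s [t zE]] := polar_form zi0.
  by rewrite -{1}(setc_id i z) zE HK KE cabs_cexp.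
have rz t : rotc i (cis t) z = z.
  by apply/funext => k; rewrite /rotc; case: eqVneq => [->|//]; rewrite zi0 mulr0.
have -> : avg circle_prob i u z = u z.
  rewrite /avg (_ : (fun t => _) = cst (u z)); last by apply/funext => t; rewrite rz.
  by rewrite Rintegral_cst//= (probability_setT circle_prob) mulr1.
rewrite KE zi0 cabs0; case: (posnP (j i)) => [ji0|ji0]; last first.
  rewrite expr0n muln_eq0/= eqn0Ngt ji0/= mul0r /u /monomial (bigD1 i)//= zi0.
  by rewrite expr0n eqn0Ngt ji0/= mul0r rmorph0 !mulr0.
rewrite ji0 muln0 expr0 mul1r; apply/eqP; rewrite -subr_eq0 -normr_le0.
apply/ler_addgt0Pr => e e0; rewrite add0r.
have [d d0 Hd] := cu z e0.
have d20 : 0 < d / 2 by rewrite divr_gt0.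
(* The circle of radius [d / 2], on which [u] differs from [u z] by less than [e]. *)
have := HK (ln (d / 2)) 0; rewrite ji0 muln0 expr0 mul1r => <-.
set z' := setc _ _ _.
have [M HM] := rot_bounded i z' lu.
have mr := measurable_rot i z' mu'.
have ic : circle_prob.-integrable setT (EFin \o (cst (u z) : RT -> R)).
  by apply: (@bounded_integrable _ _ _ `|u z|).
have <- : Rintegral circle_prob setT (cst (u z) : RT -> R) = u z.
  by rewrite Rintegral_cst//= (probability_setT circle_prob) mulr1.
rewrite distrC /avg -RintegralB//; last exact: bounded_integrable HM.
apply: Rintegral_bound; first exact: measurable_funB.
move=> t; apply/ltW/Hd => k; rewrite rotc_setc cis_cexp /setc.
case: eqVneq => [->|_]; last by rewrite subrr cabs0.
by rewrite zi0 subr0 cabs_cexp lnK ?posrE//; lra.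
Qed.

End CircleMeanValue.

(** * The sharp constant *)

Opaque cmoment.

Lemma fine_EFinM (R : realDomainType) (x : R) (y : \bar R) : y \is a fin_num ->
  fine (x%:E * y) = x * fine y.
Proof. by move=> yf; rewrite fineM. Qed.

Section MomentRatio.
Variables (R : realType) (a p p' : R).
Hypotheses (a0 : 0 < a) (p1 : 1 < p) (pp' : p^-1 + p'^-1 = 1).

Lemma conjugate_exponent_gt1 : 1 < p'.
Proof.
have p0 : 0 < p by have := p1; lra.
have q0 : 0 < p^-1 by rewrite invr_gt0.
have q1 : p^-1 < 1 by rewrite invf_lt1.
have q'E : p'^-1 = 1 - p^-1 by have := pp'; lra.
have p'0 : 0 < p' by rewrite -invr_gt0 q'E; lra.
by rewrite -invf_lt1// q'E; lra.
Qed.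

Let p'1 : 1 < p' := conjugate_exponent_gt1.
Let p0 : 0 < p. Proof. by have := p1; lra. Qed.
Let p'0 : 0 < p'. Proof. by have := p'1; lra. Qed.
Let q0 : 0 < p^-1. Proof. by rewrite invr_gt0. Qed.
Let q'0 : 0 < p'^-1. Proof. by rewrite invr_gt0. Qed.

(* [G x = Gamma (x + 1)] *)
Let G (x : R) : R := fine (cmoment 1 (2 * x)).
Local Notation D := (stirling_err G).

Let G_gt0 x : 0 <= x -> 0 < G x.
Proof.
move=> x0; rewrite /G fine_gt0// cmoment_gt0 ?mulr_ge0//=.
by rewrite cmoment_lty ?mulr_ge0.
Qed.

Let G_step x : 0 <= x -> G (x + 1) = (x + 1) * G x.
Proof.
move=> x0; rewrite /G mulrDr mulr1 cmoment_step ?mulr_ge0//.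
by rewrite mulrAC divff ?mul1r// pnatr_eq0.
Qed.

Let G_logconvex t x y : 0 < t -> t < 1 -> 0 <= x -> 0 <= y ->
  G (t * x + (1 - t) * y) <= G x `^ t * G y `^ (1 - t).
Proof.
move=> t0 t1 x0 y0; rewrite /G.
have -> : 2 * (t * x + (1 - t) * y) = t * (2 * x) + (1 - t) * (2 * y) by ring.
by apply: cmoment_logconvex => //; rewrite mulr_ge0.
Qed.

(** The [R_k] of the overview, with the powers of [p/2] and [p'/2] included; the powers of [a]
    cancel. *)
Definition moment_ratio (k : R) : R := fine (cmoment a (2 * k)) /
  (fine (cmoment (a * p / 2) (p * k)) `^ p^-1 *
   fine (cmoment (a * p' / 2) (p' * k)) `^ p'^-1).

Let momentE (b q : R) : 0 < b -> 0 <= q ->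
  fine (cmoment b q) = b `^ (- (q / 2)) * G (q / 2).
Proof.
move=> b0 q0'; apply: etrans (congr1 fine (cmoment_scale q b0)) _.
apply: etrans (fine_EFinM _ (cmoment_fin ltr01 q0')) _.
by rewrite /G [2 * _]mulrC divfK// pnatr_eq0.
Qed.

Lemma moment_ratio_gt0 k : 0 <= k -> 0 < moment_ratio k.
Proof.
move=> k0.
have m0 b q : 0 < b -> 0 <= q -> 0 < fine (cmoment b q).
  by move=> *; rewrite fine_gt0// cmoment_gt0//= cmoment_lty.
have ap : 0 < a * p / 2 by rewrite divr_gt0// mulr_gt0.
have ap' : 0 < a * p' / 2 by rewrite divr_gt0// mulr_gt0.
by rewrite divr_gt0 ?m0 ?mulr_ge0// mulr_gt0// powR_gt0// m0// mulr_ge0// ltW.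
Qed.

(** The terms [k/2 * ln (r/2)] cancel between the scaling of the Gaussian and Stirling's formula.
    What remains of [r] outside [D] is [r^-1 * (ln r - ln 2) / 2]; summed over [r = p] and [r = p']
    it is [- ln (Cp p p') / 2], and this is where the constant comes from. *)
Let ln_moment (b r k : R) : 0 < b -> 0 < r -> 0 < k ->
  ln (fine (cmoment (b * r / 2) (r * k)) `^ r^-1) =
  r^-1 * D (r * k / 2) - k / 2 * ln b + k / 2 * ln k - k / 2 +
  r^-1 * (ln r - ln 2 + ln k) / 2.
Proof.
move=> b0 r0 k0.
have b20 : 0 < b * r / 2 by rewrite divr_gt0// mulr_gt0.
have x0 : 0 < r * k / 2 by rewrite divr_gt0// mulr_gt0.
rewrite ln_powR momentE ?mulr_ge0// 1?ltW// lnM ?posrE ?powR_gt0 ?G_gt0 1?ltW//.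
rewrite ln_powR /stirling_err.
have -> : ln (b * r / 2) = ln b + ln r - ln 2.
  by rewrite ln_div ?posrE ?mulr_gt0// lnM ?posrE.
have -> : ln (r * k / 2) = ln r + ln k - ln 2.
  by rewrite ln_div ?posrE ?mulr_gt0// lnM ?posrE.
by field; rewrite gt_eqF.
Qed.

Lemma Cp_gt0 : 0 < Cp p p'.
Proof. by rewrite /Cp !mulr_gt0// powR_gt0. Qed.

Let ln_Cp : ln (Cp p p') = ln 2 - p^-1 * ln p - p'^-1 * ln p'.
Proof.
rewrite /Cp !lnM ?posrE ?mulr_gt0 ?powR_gt0// !ln_powR; ring.
Qed.

Let stirling_algebra (k l d d1 d2 la lk lp lp' l2 lC q q' : R) :
  lC = l2 - q * lp - q' * lp' -> l = d + (k * lk - k + lk / 2) -> q + q' = 1 ->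
  (- k * la + l) - ((q * d1 - k / 2 * la + k / 2 * lk - k / 2 + q * (lp - l2 + lk) / 2) +
    (q' * d2 - k / 2 * la + k / 2 * lk - k / 2 + q' * (lp' - l2 + lk) / 2)) =
  (q * (d - d1) + q' * (d - d2)) + lC / 2.
Proof.
move=> -> -> qq; have -> : q' = 1 - q by lra.
by field.
Qed.

Lemma ln_moment_ratio k : 0 < k -> ln (moment_ratio k) =
  (p^-1 * (D k - D (p * k / 2)) + p'^-1 * (D k - D (p' * k / 2))) + ln (Cp p p') / 2.
Proof.
move=> k0; rewrite /moment_ratio.
have m0 b q : 0 < b -> 0 <= q -> 0 < fine (cmoment b q).
  by move=> *; rewrite fine_gt0// cmoment_gt0//= cmoment_lty.
have ap : 0 < a * p / 2 by rewrite divr_gt0// mulr_gt0.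
have ap' : 0 < a * p' / 2 by rewrite divr_gt0// mulr_gt0.
have P1 : 0 < fine (cmoment (a * p / 2) (p * k)) `^ p^-1.
  by rewrite powR_gt0// m0// mulr_ge0// ltW.
have P2 : 0 < fine (cmoment (a * p' / 2) (p' * k)) `^ p'^-1.
  by rewrite powR_gt0// m0// mulr_ge0// ltW.
have P3 : 0 < fine (cmoment a (2 * k)) by rewrite m0// mulr_ge0// ltW.
have lnABC (A B C : R) : 0 < A -> 0 < B -> 0 < C -> ln (A / (B * C)) = ln A - (ln B + ln C).
  by move=> A0 B0 C0; rewrite ln_div ?posrE ?mulr_gt0// lnM ?posrE.
have E : ln (fine (cmoment a (2 * k))) = - k * ln a + ln (G k).
  rewrite (momentE a0 (mulr_ge0 (ler0n _ 2) (ltW k0))).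
  have -> : 2 * k / 2 = k by rewrite mulrAC divff ?pnatr_eq0// mul1r.
  have Gk := G_gt0 (ltW k0); have ak := powR_gt0 (- k) a0.
  by move: (G k) Gk => y y0; rewrite lnM ?posrE// ln_powR.
apply: etrans (lnABC _ _ _ P3 P1 P2) _.
apply: etrans (congr2 (fun x y => x - y) E
  (congr2 +%R (ln_moment a0 p0 k0) (ln_moment a0 p'0 k0))) _.
apply: stirling_algebra ln_Cp _ pp'.
rewrite /stirling_err; move: (ln (G k)) => l; ring.
Qed.

Lemma Cp_ge1 : 1 <= Cp p p'.
Proof.
rewrite -[X in X <= _]expR0 -[X in _ <= X]lnK ?posrE ?Cp_gt0// ler_expR ln_Cp.
have H (r : R) : 0 < r -> r^-1 * ln r <= r^-1 * ln 2 + 2^-1 - r^-1.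
  move=> r0; have := @le_ln1Dx R (r / 2 - 1).
  have -> : 1 + (r / 2 - 1) = r / 2 by ring.
  rewrite ln_div ?posrE//.
  have r20 : 0 < r / 2 by rewrite divr_gt0.
  move=> /(_ _)/wrap[|h]; first by lra.
  have ri : 0 < r^-1 by rewrite invr_gt0.
  have := ler_wpM2l (ltW ri) h; rewrite !mulrBr mulrA mulVf ?gt_eqF//; lra.
have := H _ p0; have := H _ p'0.
have -> : p'^-1 = 1 - p^-1 by have := pp'; lra.
lra.
Qed.

Lemma moment_ratio_le (k : nat) : moment_ratio k%:R <= Cp p p' `^ 2^-1.
Proof.
have [->|k0] := posnP k.
  rewrite /moment_ratio !mulr0 !cmoment0 ?divr_gt0 ?mulr_gt0//= !powR1 mulr1 invr1 mulr1.
  by rewrite -[X in X <= _](powRr0 (Cp p p')) ler_powR ?Cp_ge1// invr_ge0.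
have kR : (0 : R) < k%:R by rewrite ltr0n.
have Rk := moment_ratio_gt0 (ltW kR); have C0 := powR_gt0 2^-1 Cp_gt0.
rewrite -ler_ln ?posrE//.
rewrite ln_moment_ratio// ln_powR [X in _ <= X]mulrC gerDr.
have x0 : 0 < p * k%:R / 2 by rewrite divr_gt0// mulr_gt0.
have y0 : 0 < p' * k%:R / 2 by rewrite divr_gt0// mulr_gt0.
have q'E : p'^-1 = 1 - p^-1 by have := pp'; lra.
have q1 : p^-1 < 1 by have := q'0; lra.
(* With weights [1/p] and [1/p'], the barycentre of [p k / 2] and [p' k / 2] is [k/2 + k/2 = k]. *)
have := stirling_err_convex G_gt0 G_step G_logconvex q0 q1 x0 y0.
have -> : p^-1 * (p * k%:R / 2) + (1 - p^-1) * (p' * k%:R / 2) = k%:R.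
  by rewrite -q'E; field; rewrite !gt_eqF.
by rewrite q'E; lra.
Qed.

Lemma moment_ratio_near (e : R) : 0 < e ->
  exists k : nat, expR (- e) * Cp p p' `^ 2^-1 <= moment_ratio k%:R.
Proof.
move=> e0; have [X X0 HX] := stirling_err_cauchy G_gt0 G_step G_logconvex e0.
(* As [p] and [p'] exceed [1], a [k] above [2 X] puts [k], [p k / 2] and [p' k / 2] all beyond
   [X]. *)
pose k := (Num.truncn (2 * X)).+1.
have kX : 2 * X <= k%:R by apply/ltW; exact: truncnS_gt.
exists k; move: (k%:R) kX => {}k kX.
have k0 : 0 < k by lra.
have Rk := moment_ratio_gt0 (ltW k0); have C0 := powR_gt0 2^-1 Cp_gt0.
have EC0 := mulr_gt0 (expR_gt0 (- e)) C0.
rewrite -ler_ln ?posrE//.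
rewrite ln_moment_ratio// lnM ?posrE ?expR_gt0 ?powR_gt0 ?Cp_gt0// expRK ln_powR.
rewrite [2^-1 * _]mulrC lerD2r.
have H (r : R) : 1 < r -> - e <= D k - D (r * k / 2).
  move=> r1; have rk : k <= r * k by rewrite ler_peMl// ltW.
  have Xk : X <= k by lra.
  have Xrk : X <= r * k / 2 by lra.
  by have := HX _ _ Xk Xrk; rewrite ler_norml => /andP[].
have h1 := ler_wpM2l (ltW q0) (H _ p1); have h2 := ler_wpM2l (ltW q'0) (H _ p'1).
apply: le_trans (lerD h1 h2).
by rewrite -mulrDl pp' mul1r.
Qed.

End MomentRatio.

(** * Absolute convergence of the pairing *)

Section GaussianDensity.
Variable R : realType.
Local Notation RT := (measurableTypeR R).
Local Notation RR := (RT * RT)%type.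
Local Notation mu := (@lebesgue_measure R).
Local Notation m2 := (mu \x mu)%E.

Definition sqnorm n (z : 'I_n -> R[i]) : R :=
  \sum_(i < n) (complex.Re (z i) ^+ 2 + complex.Im (z i) ^+ 2).

Lemma cmeasurable_exp_sqnorm n (c : R) :
  cmeasurable (fun z : 'I_n -> R[i] => expR (c * sqnorm z) : RT).
Proof.
move=> d S x y mx my; apply: measurableT_comp => //.
apply: measurable_funM => //; apply: measurable_sum => i.
by apply: measurable_funD => /=; [exact: measurable_funX (mx i)|exact: measurable_funX (my i)].
Qed.

Lemma sqnorm_ccons n c (w : 'I_n -> R[i]) :
  sqnorm (ccons c w) = (complex.Re c ^+ 2 + complex.Im c ^+ 2) + sqnorm w.
Proof.
rewrite /sqnorm big_ord_recl ccons0; congr (_ + _).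
by apply: eq_bigr => i _; rewrite cconsS.
Qed.

Lemma gdens_change (b : R) (x y : R) :
  gdens b x y = b * (gdens 1 x y * expR ((1 - b) * (x ^+ 2 + y ^+ 2))).
Proof.
rewrite /gdens mul1r -!mulrA -expRD; congr (_ * (_ * expR _)).
by rewrite mulrBl mul1r mulN1r addrA addNr add0r mulNr.
Qed.

(** A common reference measure: the pairing and the two norms use three Gaussian parameters, and
    their integrands can be compared pointwise only under a single one. *)
Lemma gintE_change n (b : R) (F : ('I_n -> R[i]) -> \bar R) : 0 < b ->
  cmeasurable F -> (forall z, 0 <= F z)%E ->
  gintE b F = ((b ^+ n)%:E * gintE 1 (fun z => (expR ((1 - b) * sqnorm z))%:E * F z))%E.
Proof.
move=> b0; have r1 : (0 : R) < 1 by exact: ltr01.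
elim: n F => [|n IH] F mF F0.
  by rewrite /= /sqnorm big_ord0 mulr0 expR0 expr0 !mul1e.
have mE k (c : R) : cmeasurable (fun z : 'I_k -> R[i] => (expR (c * sqnorm z))%:E).
  by move=> d S x y mx my; apply/measurable_EFinP; exact: cmeasurable_exp_sqnorm.
have mEF : cmeasurable (fun z => (expR ((1 - b) * sqnorm z))%:E * F z)%E.
  by move=> d S x y mx my; apply: emeasurable_funM; [exact: mE|exact: mF].
have EF0 z : (0 <= (expR ((1 - b) * sqnorm z))%:E * F z)%E.
  by rewrite mule_ge0// lee_fin expR_ge0.
rewrite (gintES b0 mF F0) (gintES r1 mEF EF0) -ge0_integralZl//; first last.
- by rewrite lee_fin exprn_ge0// ltW.
- by move=> p _; rewrite mule_ge0 ?lee_fin ?gdens_ge0// gintE_ge0.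
- exact: (cmeasurable_gintE_slice r1 mEF EF0).
apply: eq_integral => p _.
have mFp : cmeasurable (fun w => F (ccons (zpair p) w)).
  exact: pmeasurable_at (cmeasurable_slice mF).
rewrite (IH _ mFp (fun w => F0 _)).
have -> : (fun w => (expR ((1 - b) * sqnorm (ccons (zpair p) w)))%:E * F (ccons (zpair p) w))%E =
   (fun w => (expR ((1 - b) * (p.1 ^+ 2 + p.2 ^+ 2)))%:E *
     ((expR ((1 - b) * sqnorm w))%:E * F (ccons (zpair p) w)))%E.
  by apply/funext => w; rewrite sqnorm_ccons mulrDr expRD EFinM muleA.
have mEFp : cmeasurable (fun w => (expR ((1 - b) * sqnorm w))%:E * F (ccons (zpair p) w))%E.
  by move=> d S x y mx my; apply: emeasurable_funM; [exact: mE|exact: mFp].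
have EFp0 w : (0 <= (expR ((1 - b) * sqnorm w))%:E * F (ccons (zpair p) w))%E.
  by rewrite mule_ge0// lee_fin expR_ge0.
rewrite (gintEZ r1 (expR_ge0 _) mEFp EFp0) gdens_change.
move: (gintE 1 _) => I; rewrite !muleA -!EFinM; congr (_%:E * _)%E.
by rewrite (exprS b n); ring.
Qed.

Lemma cmeasurable_powR n (u : ('I_n -> R[i]) -> RT) (q : R) : cmeasurable u ->
  cmeasurable (fun z => u z `^ q : RT).
Proof.
move=> mu' d S x y mx my.
by apply: (measurableT_comp (measurable_powR q)); exact: mu'.
Qed.

(** Young's inequality for [e^(-a s/2) A] and [e^(-a s/2) B]: raising the half weight to the power
    [p] gives the Gaussian of parameter [a p / 2]. The extra [e^s] accounts for the reference
    parameter [1]. *)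
Let young_density (a p p' s A B : R) : 1 < p -> 1 < p' -> p^-1 + p'^-1 = 1 ->
  0 <= A -> 0 <= B ->
  expR ((1 - a) * s) * (A * B) <=
  p^-1 * (expR ((1 - a * p / 2) * s) * A `^ p) +
  p'^-1 * (expR ((1 - a * p' / 2) * s) * B `^ p').
Proof.
move=> p1 p'1 pp' A0 B0.
have e0 := expR_ge0 (- (a / 2 * s)).
have p0 : 0 < p by lra.
have p'0 : 0 < p' by lra.
have := conjugate_powR (mulr_ge0 e0 A0) (mulr_ge0 e0 B0) p0 p'0 pp'.
rewrite !powRM// -!expRM => /(ler_wpM2l (expR_ge0 s)).
have -> : expR s * (expR (- (a / 2 * s)) * A * (expR (- (a / 2 * s)) * B)) =
   expR ((1 - a) * s) * (A * B).
  have -> : (1 - a) * s = s + (- (a / 2 * s) + - (a / 2 * s)) by field.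
  by rewrite !expRD; ring.
have E (q X : R) : expR s * (expR (- (a / 2 * s) * q) * X) =
    expR ((1 - a * q / 2) * s) * X.
  have -> : (1 - a * q / 2) * s = s + - (a / 2 * s) * q by field.
  by rewrite expRD mulrA.
have F (u v w x y : R) : u * (v / x + w / y) = x^-1 * (u * v) + y^-1 * (u * w) by ring.
by rewrite F !E.
Qed.

Lemma pairing_integrable (a p p' : R) n (A B : ('I_n -> R[i]) -> RT) :
  0 < a -> 1 < p -> 1 < p' -> p^-1 + p'^-1 = 1 ->
  cmeasurable A -> cmeasurable B -> (forall z, 0 <= A z) -> (forall z, 0 <= B z) ->
  (gintE (a * p / 2) (fun z => (A z `^ p)%:E) < +oo)%E ->
  (gintE (a * p' / 2) (fun z => (B z `^ p')%:E) < +oo)%E ->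
  (gintE a (fun z => (A z * B z)%:E) < +oo)%E.
Proof.
move=> a0 p1 p'1 pp' mA mB A0 B0.
have r1 : (0 : R) < 1 by exact: ltr01.
have p0 : 0 < p by lra.
have p'0 : 0 < p' by lra.
have ap : 0 < a * p / 2 by rewrite divr_gt0// mulr_gt0.
have ap' : 0 < a * p' / 2 by rewrite divr_gt0// mulr_gt0.
have mE (c : R) (u : ('I_n -> R[i]) -> RT) : cmeasurable u ->
    cmeasurable (fun z => (expR (c * sqnorm z))%:E * (u z)%:E)%E.
  move=> mu' d S x y mx my; apply: emeasurable_funM.
    by apply/measurable_EFinP; exact: cmeasurable_exp_sqnorm.
  by apply/measurable_EFinP; exact: mu'.
have lty (b q : R) (u : ('I_n -> R[i]) -> RT) : 0 < b -> cmeasurable u ->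
    (gintE b (fun z => (u z `^ q)%:E) < +oo)%E ->
    (gintE 1 (fun z => (expR ((1 - b) * sqnorm z))%:E * (u z `^ q)%:E) < +oo)%E.
  move=> b0 mu'; rewrite gintE_change//; last first.
  - by move=> z; rewrite lee_fin powR_ge0.
  - exact/cmeasurable_EFin/cmeasurable_powR.
  have : (0 <= gintE 1 (fun z => (expR ((1 - b) * sqnorm z))%:E * (u z `^ q)%:E))%E.
    by apply: gintE_ge0 => // z; rewrite -EFinM lee_fin mulr_ge0 ?expR_ge0 ?powR_ge0.
  move: (gintE 1 _) => [r _ _|_|//]; first by rewrite ltry.
  by rewrite gt0_muley// lte_fin exprn_gt0.
move=> /(lty _ _ _ ap mA) iA /(lty _ _ _ ap' mB) iB.
have mAB : cmeasurable (fun z => A z * B z : RT).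
  by move=> d S x y mx my; apply: measurable_funM; [exact: mA|exact: mB].
rewrite gintE_change//; last first.
- by move=> z; rewrite lee_fin mulr_ge0.
- exact: cmeasurable_EFin.
pose FA z := ((expR ((1 - a * p / 2) * sqnorm z))%:E * (A z `^ p)%:E)%E.
pose FB z := ((expR ((1 - a * p' / 2) * sqnorm z))%:E * (B z `^ p')%:E)%E.
have mFA : cmeasurable FA by apply: mE; exact: cmeasurable_powR.
have mFB : cmeasurable FB by apply: mE; exact: cmeasurable_powR.
have FA0 z : (0 <= FA z)%E by rewrite mule_ge0// lee_fin ?expR_ge0 ?powR_ge0.
have FB0 z : (0 <= FB z)%E by rewrite mule_ge0// lee_fin ?expR_ge0 ?powR_ge0.
have mZ (k : R) (F : ('I_n -> R[i]) -> \bar R) : cmeasurable F ->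
    cmeasurable (fun z => k%:E * F z)%E.
  by move=> mF d S x y mx my; apply: emeasurable_funM => //; exact: mF.
have q0 : 0 <= p^-1 by rewrite invr_ge0 ltW.
have q'0 : 0 <= p'^-1 by rewrite invr_ge0 ltW.
have L : (gintE 1 (fun z => (expR ((1 - a) * sqnorm z))%:E * (A z * B z)%:E) <=
    gintE 1 (fun z => (p^-1)%:E * FA z + (p'^-1)%:E * FB z))%E.
  apply: le_gintE => //.
  - exact: mE.
  - move=> d S x y mx my; apply: emeasurable_funD; [exact: mZ mFA _ _ _ _ mx my|exact: mZ mFB _ _ _ _ mx my].
  - by move=> z; rewrite mule_ge0// lee_fin ?expR_ge0// mulr_ge0.
  - by move=> z; rewrite /FA /FB -!EFinM -EFinD lee_fin young_density.
have : (gintE 1 (fun z => (p^-1)%:E * FA z + (p'^-1)%:E * FB z) < +oo)%E.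
  rewrite (gintED r1 (mZ _ _ mFA) (mZ _ _ mFB)); last 2 first.
  - by move=> z; rewrite mule_ge0// lee_fin.
  - by move=> z; rewrite mule_ge0// lee_fin.
  rewrite (gintEZ r1 q0 mFA FA0) (gintEZ r1 q'0 mFB FB0).
  by rewrite lte_add_pinfty// lte_mul_pinfty// ?lee_fin// ge0_fin_numE.
move=> /(le_lt_trans L) I.
by rewrite lte_mul_pinfty// lee_fin exprn_ge0// ltW.
Qed.

End GaussianDensity.

(** * Linearity of the real Gaussian integral *)

Section RealLinearity.
Variables (R : realType) (a : R).
Hypothesis a0 : 0 < a.
Local Notation RT := (measurableTypeR R).

Definition gintegrable n (u : ('I_n -> R[i]) -> RT) :=
  cmeasurable u /\ (gintE a (fun z => `|u z|%:E) < +oo)%E.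

Lemma gintR_upos_uneg n (u : ('I_n -> R[i]) -> RT) : gintegrable u ->
  gintR a u = fine (gintE a (EFin \o upos u)) - fine (gintE a (EFin \o uneg u)).
Proof.
move=> [mu' iu].
have mP := cmeasurable_upos mu'; have mN := cmeasurable_uneg mu'.
have P0 z : 0 <= upos u z by have /andP[] := upos_le u z.
have N0 z : 0 <= uneg u z by have /andP[] := uneg_le u z.
have iP := gintE_pos_lty a0 mu' mP (upos_le u) iu.
have iN := gintE_pos_lty a0 mu' mN (uneg_le u) iu.
rewrite -(gintR_sub a0 mP mN P0 N0 iP iN); congr gintR.
by apply/funext => z; exact: upos_uneg.
Qed.

Lemma gintRD n (u v : ('I_n -> R[i]) -> RT) : gintegrable u -> gintegrable v ->
  gintR a (fun z => u z + v z) = gintR a u + gintR a v.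
Proof.
move=> iu iv; rewrite (gintR_upos_uneg iu) (gintR_upos_uneg iv).
case: iu iv => [mu' iu] [mv iv].
have mPu := cmeasurable_upos mu'; have mNu := cmeasurable_uneg mu'.
have mPv := cmeasurable_upos mv; have mNv := cmeasurable_uneg mv.
have P0 (w : ('I_n -> R[i]) -> RT) z : 0 <= upos w z by have /andP[] := upos_le w z.
have N0 (w : ('I_n -> R[i]) -> RT) z : 0 <= uneg w z by have /andP[] := uneg_le w z.
have iPu := gintE_pos_lty a0 mu' mPu (upos_le u) iu.
have iNu := gintE_pos_lty a0 mu' mNu (uneg_le u) iu.
have iPv := gintE_pos_lty a0 mv mPv (upos_le v) iv.
have iNv := gintE_pos_lty a0 mv mNv (uneg_le v) iv.
have D (f g : ('I_n -> R[i]) -> RT) : cmeasurable f -> cmeasurable g ->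
    (forall z, 0 <= f z) -> (forall z, 0 <= g z) ->
    gintE a (EFin \o (fun z => f z + g z)) =
    (gintE a (EFin \o f) + gintE a (EFin \o g))%E.
  move=> mf mg f0 g0; rewrite -(gintED a0 (cmeasurable_EFin mf) (cmeasurable_EFin mg))//.
have mD (f g : ('I_n -> R[i]) -> RT) : cmeasurable f -> cmeasurable g ->
    cmeasurable (fun z => f z + g z : RT).
  by move=> mf mg d S x y mx my; apply: measurable_funD; [exact: mf|exact: mg].
have fin (F : ('I_n -> R[i]) -> RT) : (forall z, 0 <= F z) ->
    (gintE a (EFin \o F) < +oo)%E -> gintE a (EFin \o F) \is a fin_num.
  by move=> F0 h; rewrite ge0_fin_numE// gintE_ge0// => z; rewrite lee_fin.
have -> : (fun z => u z + v z) =
    (fun z => (upos u z + upos v z) - (uneg u z + uneg v z)).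
  by apply/funext => z; rewrite {1}(upos_uneg u z) {1}(upos_uneg v z); ring.
rewrite (gintR_sub a0 (mD _ _ mPu mPv) (mD _ _ mNu mNv)).
- rewrite (D _ _ mPu mPv (P0 u) (P0 v)) (D _ _ mNu mNv (N0 u) (N0 v)).
  rewrite (fineD (fin _ (P0 u) iPu) (fin _ (P0 v) iPv)).
  by rewrite (fineD (fin _ (N0 u) iNu) (fin _ (N0 v) iNv)); ring.
- by move=> z; rewrite addr_ge0.
- by move=> z; rewrite addr_ge0.
- by rewrite (D _ _ mPu mPv (P0 u) (P0 v)) lte_add_pinfty.
- by rewrite (D _ _ mNu mNv (N0 u) (N0 v)) lte_add_pinfty.
Qed.

Lemma gintR_ge0E n (u : ('I_n -> R[i]) -> RT) : cmeasurable u -> (forall z, 0 <= u z) ->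
  (gintE a (EFin \o u) < +oo)%E -> gintR a u = fine (gintE a (EFin \o u)).
Proof.
move=> mu' u0 iu; rewrite gintR_upos_uneg; last first.
  split=> //; rewrite (_ : (fun z => `|u z|%:E) = EFin \o u)//.
  by apply/funext => z /=; rewrite ger0_norm.
have -> : upos u = u by apply/funext => z; rewrite /upos max_l.
have -> : uneg u = (fun z => 0 * u z).
  by apply/funext => z; rewrite /uneg mul0r max_r// oppr_le0.
have -> : gintE a (EFin \o (fun z => 0 * u z)) = 0%E; last by rewrite subr0.
have u0' z : (0 <= (EFin \o u) z)%E by rewrite lee_fin.
by have := gintEZ a0 (lexx 0) (cmeasurable_EFin mu') u0'; rewrite mul0e.
Qed.

Lemma gintRZ_ge0 n (u : ('I_n -> R[i]) -> RT) (k : R) : 0 <= k -> gintegrable u ->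
  gintR a (fun z => k * u z) = k * gintR a u.
Proof.
move=> k0 iu; rewrite (gintR_upos_uneg iu); case: iu => mu' iu.
have mP := cmeasurable_upos mu'; have mN := cmeasurable_uneg mu'.
have P0 z : 0 <= upos u z by have /andP[] := upos_le u z.
have N0 z : 0 <= uneg u z by have /andP[] := uneg_le u z.
have iP := gintE_pos_lty a0 mu' mP (upos_le u) iu.
have iN := gintE_pos_lty a0 mu' mN (uneg_le u) iu.
have Z (f : ('I_n -> R[i]) -> RT) : cmeasurable f -> (forall z, 0 <= f z) ->
    gintE a (EFin \o (fun z => k * f z)) = (k%:E * gintE a (EFin \o f))%E.
  move=> mf f0; rewrite -(gintEZ a0 k0 (cmeasurable_EFin mf))//.
have mZ (f : ('I_n -> R[i]) -> RT) : cmeasurable f -> cmeasurable (fun z => k * f z : RT).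
  by move=> mf d S x y mx my; apply: measurable_funM => //; exact: mf.
have fin (F : ('I_n -> R[i]) -> RT) : (forall z, 0 <= F z) ->
    (gintE a (EFin \o F) < +oo)%E -> gintE a (EFin \o F) \is a fin_num.
  by move=> F0 h; rewrite ge0_fin_numE// gintE_ge0// => z; rewrite lee_fin.
have lty (F : ('I_n -> R[i]) -> RT) : cmeasurable F -> (forall z, 0 <= F z) ->
    (gintE a (EFin \o F) < +oo)%E -> (gintE a (EFin \o (fun z => (k * F z)%R)) < +oo)%E.
  by move=> mF F0 h; rewrite (Z _ mF F0) -(fineK (fin _ F0 h)) -EFinM ltry.
have -> : (fun z => k * u z) = (fun z => k * upos u z - k * uneg u z).
  by apply/funext => z; rewrite {1}(upos_uneg u z) mulrBr.
rewrite (gintR_sub a0 (mZ _ mP) (mZ _ mN) _ _ (lty _ mP P0 iP) (lty _ mN N0 iN)).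
- rewrite (Z _ mP P0) (Z _ mN N0) (fine_EFinM _ (fin _ P0 iP)).
  by rewrite (fine_EFinM _ (fin _ N0 iN)) mulrBr.
- by move=> z; rewrite mulr_ge0.
- by move=> z; rewrite mulr_ge0.
Qed.

Lemma gintegrableZ n (u : ('I_n -> R[i]) -> RT) (k : R) : gintegrable u ->
  gintegrable (fun z => k * u z).
Proof.
move=> [mu' iu]; split.
  by move=> d S x y mx my; apply: measurable_funM => //; exact: mu'.
have -> : (fun z => `|k * u z|%:E) = (fun z => (`|k|)%:E * `|u z|%:E)%E.
  by apply/funext => z; rewrite normrM EFinM.
have m := cmeasurable_EFin (cmeasurable_norm mu').
have p z : (0 <= (EFin \o (fun z => `|u z|%R)) z)%E by rewrite lee_fin.
rewrite (gintEZ a0 (normr_ge0 k) m p) lte_mul_pinfty ?lee_fin//.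
Qed.

Lemma gintRN n (u : ('I_n -> R[i]) -> RT) : gintegrable u ->
  gintR a (fun z => - u z) = - gintR a u.
Proof.
move=> iu; apply/eqP; rewrite -addr_eq0 -gintRD//; last first.
  by have := gintegrableZ (- 1) iu; under eq_fun do rewrite mulN1r.
have -> : (fun z => - u z + u z) = (fun z => 0 * u z).
  by apply/funext => z; rewrite addNr mul0r.
by rewrite gintRZ_ge0// mul0r.
Qed.

Lemma gintRZ n (u : ('I_n -> R[i]) -> RT) (k : R) : gintegrable u ->
  gintR a (fun z => k * u z) = k * gintR a u.
Proof.
move=> iu; have [k0|k0] := leP 0 k; first exact: gintRZ_ge0.
have -> : (fun z => k * u z) = (fun z => - (- k * u z)).
  by apply/funext => z; rewrite mulNr opprK.
rewrite gintRN; last exact: gintegrableZ.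
by rewrite gintRZ_ge0// ?oppr_ge0 ?ltW// mulNr opprK.
Qed.

End RealLinearity.

Section Monomials.
Variable R : realType.
Local Notation RT := (measurableTypeR R).

Lemma cabs_monomial n (j : 'I_n -> nat) (z : 'I_n -> R[i]) :
  cabs (monomial j z) = hmod j z.
Proof.
rewrite /monomial /hmod.
by elim/big_rec2: _ => [|i x y _ <-]; rewrite ?cabs1 ?cabsM ?cabsX.
Qed.

Lemma cmeasurable_hmod n (j : 'I_n -> nat) : cmeasurable (hmod j : ('I_n -> R[i]) -> RT).
Proof.
have -> : hmod j = (fun z : 'I_n -> R[i] => cabs (monomial j z)).
  by apply/funext => z; rewrite cabs_monomial.
exact/ccontinuous_cmeasurable/ccontinuous_cabs/ccontinuousC_monomial.
Qed.

Lemma gintE_hmod_powR n (j : 'I_n -> nat) (b q : R) : 0 < b -> 0 <= q ->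
  gintE b (fun z => (hmod j z `^ q)%:E) = (\prod_i fine (cmoment b (q * (j i)%:R)))%:E.
Proof.
move=> b0 q0; elim: n j => [|n IH] j; first by rewrite /= /hmod !big_ord0 powR1.
have -> : (fun z : 'I_n.+1 -> R[i] => (hmod j z `^ q)%:E) =
   (fun z => (cabs (z ord0) `^ (q * (j ord0)%:R))%:E *
     (fun w => (hmod (j \o lift ord0) w `^ q)%:E) (z \o lift ord0))%E.
  apply/funext => z; rewrite -{1}(ccons_eta z) hmod_ccons.
  rewrite powRM ?exprn_ge0 ?cabs_ge0 ?hmod_ge0// -EFinM; congr (_ * _)%:E.
  by rewrite -powR_mulrn ?cabs_ge0// -powRrM mulrC.
have mk : measurable_fun setT (fun q' : RT * RT => cabs (zpair q') `^ (q * (j ord0)%:R)).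
  exact: measurable_cabs_powR.
have mF := cmeasurable_EFin (cmeasurable_powR q (cmeasurable_hmod (j \o lift ord0))).
have F0 (w : 'I_n -> R[i]) : (0 <= (hmod (j \o lift ord0) w `^ q)%:E)%E.
  by rewrite lee_fin powR_ge0.
apply: etrans (gintE_prod b0 (k := fun c => cabs c `^ (q * (j ord0)%:R)) mk _ mF F0) _.
  by move=> c; exact: powR_ge0.
have E := IH (j \o lift ord0); rewrite /comp E big_ord_recl EFinM; congr (_ * _)%E.
have f : cmoment b (q * (j ord0)%:R) \is a fin_num by rewrite cmoment_fin// mulr_ge0.
exact: esym (fineK f).
Qed.

Lemma pint_monomial n (j : 'I_n -> nat) (a p : R) : 0 < a -> 0 < p ->
  pint a p (monomial j) = (\prod_i fine (cmoment (a * p / 2) (p * (j i)%:R)))%:E.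
Proof.
move=> a0 p0; rewrite /pint -gintE_hmod_powR ?divr_gt0 ?mulr_gt0// 1?ltW//.
by congr gintE; apply/funext => z; rewrite cabs_monomial.
Qed.

Lemma holomorphic_monomial n (j : 'I_n -> nat) :
  holomorphic (monomial j : ('I_n -> R[i]) -> R[i]).
Proof.
split=> [|z i]; first exact: ccontinuousC_monomial.
pose H := \prod_(k < n | k != i) z k ^+ j k.
have dF : cdiff (fun c : R[i] => c ^+ j i * H) (z i).
  by apply: cdiffM; [exact/cdiffX/cdiff_id|exact: cdiff_cst].
have E (h : R[i]) : monomial j (shift_coord z i h) = (z i + h) ^+ j i * H.
  rewrite /monomial (bigD1 i)//= /shift_coord eqxx; congr (_ * _).
  by apply: eq_bigr => k /negPf ->.
have E0 : monomial j z = z i ^+ j i * H by rewrite /monomial (bigD1 i).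
have [c Hc] := eps_cdiff dF; exists c => e /Hc[d d0 Hd]; exists d => // h /andP[_ hd].
by rewrite E E0; exact: Hd.
Qed.

Lemma Hpa_monomial n (j : 'I_n -> nat) (a p : R) : 0 < a -> 0 < p -> Hpa a p (monomial j).
Proof.
by move=> a0 p0; split; [exact: holomorphic_monomial|rewrite pint_monomial// ltry].
Qed.

Lemma monomial_neq0 n (j : 'I_n -> nat) : monomial j <> (fun _ : 'I_n -> R[i] => 0).
Proof.
move=> /(congr1 (@^~ (fun=> 1))); rewrite /monomial big1; last by move=> i _; rewrite expr1n.
by move/eqP; rewrite oner_eq0.
Qed.

End Monomials.

Lemma ccontinuous_Im (R : realType) n (F : ('I_n -> R[i]) -> R[i]) : ccontinuousC F ->
  ccontinuous (fun z => complex.Im (F z)).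
Proof.
move=> cF z e /(cF z)[d d0 H]; exists d => // w /H; apply: le_lt_trans.
by rewrite -raddfB; exact: normr_Im_cabs.
Qed.

Lemma prod_powR (R : realType) n (f : 'I_n -> R) r : (forall i, 0 <= f i) ->
  (\prod_i f i) `^ r = \prod_i f i `^ r.
Proof.
move=> f0; suff [] : (\prod_i f i) `^ r = \prod_i f i `^ r /\ 0 <= \prod_i f i by [].
apply: (big_rec2 (fun x y => x `^ r = y /\ 0 <= x)) => [|i x _ _ [<- x0]].
  by rewrite powR1.
by rewrite powRM// mulr_ge0.
Qed.

Lemma ler_pairing_product (R : realType) (c A B B' ratio N : R) :
  0 <= ratio -> 0 <= B' -> 0 <= A -> A = ratio * (B * B') -> `|c| * B <= N ->
  c * A <= ratio * (N * B').
Proof.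
move=> r0 B'0 A0 AE cB; apply: (@le_trans _ _ (`|c| * A)); first by rewrite ler_wpM2r// ler_norm.
by rewrite AE mulrCA ler_wpM2l// mulrA ler_wpM2r.
Qed.

(** * The quotient and its bound *)

Section FockPairing.
Variables (R : realType) (n : nat) (a p p' : R).
Hypotheses (a0 : 0 < a) (p1 : 1 < p) (pp' : p^-1 + p'^-1 = 1).
Local Notation RT := (measurableTypeR R).
Local Notation ratio j := (\prod_(i < n) moment_ratio a p p' (j i)%:R).

Let p'1 : 1 < p' := conjugate_exponent_gt1 p1 pp'.
Let p0 : 0 < p. Proof. by have := p1; lra. Qed.
Let p'0 : 0 < p'. Proof. by have := p'1; lra. Qed.
Let ap : 0 < a * p / 2. Proof. by rewrite divr_gt0// mulr_gt0. Qed.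
Let ap' : 0 < a * p' / 2. Proof. by rewrite divr_gt0// mulr_gt0. Qed.

Let A (j : 'I_n -> nat) : R := \prod_i fine (cmoment a (2 * (j i)%:R)).
Let B (j : 'I_n -> nat) : R := \prod_i fine (cmoment (a * p / 2) (p * (j i)%:R)).
Let B' (j : 'I_n -> nat) : R := \prod_i fine (cmoment (a * p' / 2) (p' * (j i)%:R)).

Let m0 (b q : R) k : 0 < b -> 0 < q -> 0 < fine (cmoment b (q * k%:R)).
Proof.
move=> b0 q0; have qk : 0 <= q * k%:R by rewrite mulr_ge0// ltW.
by rewrite fine_gt0// cmoment_gt0// cmoment_lty.
Qed.

Let A_gt0 j : 0 < A j. Proof. by apply: prodr_gt0 => i _; exact: m0. Qed.
Let B_gt0 j : 0 < B j. Proof. by apply: prodr_gt0 => i _; exact: m0. Qed.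
Let B'_gt0 j : 0 < B' j. Proof. by apply: prodr_gt0 => i _; exact: m0. Qed.

Let ratioE j : ratio j = A j / (B j `^ p^-1 * B' j `^ p'^-1).
Proof.
rewrite /moment_ratio prodf_div big_split/=; congr (_ / (_ * _)).
  by rewrite -prod_powR// => i; exact/ltW/m0.
by rewrite -prod_powR// => i; exact/ltW/m0.
Qed.

Let AE j : A j = ratio j * (B j `^ p^-1 * B' j `^ p'^-1).
Proof.
have BB' := mulr_gt0 (powR_gt0 p^-1 (B_gt0 j)) (powR_gt0 p'^-1 (B'_gt0 j)).
by rewrite ratioE (divfK (lt0r_neq0 BB')).
Qed.

Let ratio_ge0 (j : 'I_n -> nat) : 0 <= ratio j.
Proof. by apply: prodr_ge0 => i _; apply/ltW/moment_ratio_gt0. Qed.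

Let pnorm_monomial (j : 'I_n -> nat) q : 0 < q -> pnorm a q (monomial j : ('I_n -> R[i]) -> R[i]) =
  (\prod_i fine (cmoment (a * q / 2) (q * (j i)%:R))) `^ q^-1.
Proof. by move=> q0; rewrite /pnorm (pint_monomial j a0 q0). Qed.

(** Up to a phase the pairing is [c * A j], while [|c|^p * B j] is at most the [p]-th power of the
    norm of [g]. Eliminating [c] leaves [A j / B j^(1/p)], which is [ratio j] times the norm of the
    monomial. *)
Lemma pairing_bound (g : ('I_n -> R[i]) -> R[i]) (j : 'I_n -> nat) : Hpa a p g ->
  cabs (finner a g (monomial j)) <= ratio j * (pnorm a p g * pnorm a p' (monomial j)).
Proof.
move=> [hg ig]; pose F z := g z * (monomial j z)^*.
have cF : ccontinuousC F.
  by apply: ccontinuousCM; [exact: hg.1|exact/ccontinuousCJ/ccontinuousC_monomial].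
have mg := ccontinuous_cmeasurable (ccontinuous_cabs hg.1).
have mh := @cmeasurable_hmod R n j.
have g0 z : 0 <= cabs (g z) by exact: cabs_ge0.
have h0 (z : 'I_n -> R[i]) : 0 <= hmod j z by exact: hmod_ge0.
have ih : (gintE (a * p' / 2) (fun z => ((hmod j z : RT) `^ p')%:E) < +oo)%E.
  by rewrite (gintE_hmod_powR j ap' (ltW p'0)) ltry.
have igh := pairing_integrable a0 p1 p'1 pp' mg mh g0 h0 ig ih.
have FE z : cabs (F z) = cabs (g z) * hmod j z by rewrite cabsM cabsJ cabs_monomial.
have gi (u : ('I_n -> R[i]) -> RT) : ccontinuous u -> (forall z, `|u z| <= cabs (F z)) ->
    gintegrable a u.
  move=> cu uF; have mu' := ccontinuous_cmeasurable cu; split=> //.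
  apply: le_lt_trans igh; apply: le_gintE => //.
  - exact/cmeasurable_EFin/cmeasurable_norm.
  - apply: cmeasurable_EFin => d S x y mx my; apply: measurable_funM; [exact: mg|exact: mh].
  - by move=> z; rewrite lee_fin -FE.
have iRe := gi _ (ccontinuous_Re cF) (fun z => normr_Re_cabs _).
have iIm := gi _ (ccontinuous_Im cF) (fun z => normr_Im_cabs _).
have [I1 I1E] : exists I1, gintR a (fun z => complex.Re (F z)) = I1 by eexists.
have [I2 I2E] : exists I2, gintR a (fun z => complex.Im (F z)) = I2 by eexists.
have -> : finner a g (monomial j) = I1 +i* I2 by rewrite -I1E -I2E.
have [m mE] : exists m, cabs (I1 +i* I2) = m by eexists.
have m_ge0 : 0 <= m by rewrite -mE cabs_ge0.
have m2 : m ^+ 2 = I1 ^+ 2 + I2 ^+ 2 by rewrite -mE sqr_cabs.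
rewrite mE; have [->|mn0] := eqVneq m 0.
  by rewrite mulr_ge0// mulr_ge0// powR_ge0.
have [k1 k1E] : exists k1, k1 = I1 / m by eexists.
have [k2 k2E] : exists k2, k2 = I2 / m by eexists.
have k12 : k1 ^+ 2 + k2 ^+ 2 = 1.
  by rewrite k1E k2E !expr_div_n -mulrDl -m2 divff// expf_neq0.
have kI : k1 * I1 + k2 * I2 = m.
  have -> : k1 * I1 + k2 * I2 = (I1 ^+ 2 + I2 ^+ 2) / m by rewrite k1E k2E; ring.
  by rewrite -m2 expr2 mulfK.
(* The conjugate phase of the pairing: it turns the modulus [m] into the integral of the real
   function [Re (kappa F)], to which the torus reduction applies. *)
pose kappa : R[i] := k1 +i* (- k2).
have kappa1 : cabs kappa = 1 by rewrite /cabs/= sqrrN k12 sqrtr1.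
have uE z : complex.Re (kappa * F z) = k1 * complex.Re (F z) + k2 * complex.Im (F z).
  by case: (F z) => x y /=; rewrite mulNr opprK.
have uF z : `|complex.Re (kappa * F z)| <= cabs (F z).
  by apply: le_trans (normr_Re_cabs _) _; rewrite cabsM kappa1 mul1r.
have cu : ccontinuous (fun z => complex.Re (kappa * F z)).
  by apply/ccontinuous_Re/ccontinuousCM => //; exact: ccontinuousC_cst.
have gu : gintR a (fun z => complex.Re (kappa * F z)) = m.
  have -> : (fun z => complex.Re (kappa * F z)) =
     (fun z => k1 * complex.Re (F z) + k2 * complex.Im (F z)) by apply/funext.
  rewrite (gintRD a0 (gintegrableZ a0 k1 iRe) (gintegrableZ a0 k2 iIm)).
  by rewrite (gintRZ a0 k1 iRe) (gintRZ a0 k2 iIm) I1E I2E.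
have [c [H1 H2]] := torus_reduction (circle_homogeneous_holomorphic j kappa hg).
have mA : m = c * A j by rewrite -gu; exact: H1 a0 (gi _ cu uF).2.
have H := H2 _ _ _ ap p1 mg (ccontinuous_locally_bounded (ccontinuous_cabs hg.1)) g0.
have {}H : ((`|c| `^ p * B j)%:E <= pint a p g)%E.
  by apply: H => z; rewrite -FE; exact: uF.
have P0 : (0 <= pint a p g)%E by apply: gintE_ge0 => // z; rewrite lee_fin powR_ge0.
have cB : `|c| * B j `^ p^-1 <= pnorm a p g.
  have Pf : pint a p g \is a fin_num by rewrite ge0_fin_numE.
  move: H; rewrite -{1}(fineK Pf) lee_fin => H.
  have q0 : 0 <= p^-1 by rewrite invr_ge0 ltW.
  have X0 : 0 <= `|c| `^ p * B j by rewrite mulr_ge0 ?powR_ge0// ltW.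
  have := ge0_ler_powR q0 _ _ H; rewrite !nnegrE X0 fine_ge0// => /(_ isT isT).
  by rewrite (powRM p^-1 (powR_ge0 _ _) (ltW (B_gt0 j))) -powRrM mulfV ?gt_eqF// powRr1.
rewrite mA (pnorm_monomial j p'0).
apply: ler_pairing_product (AE j) cB => //; first exact: powR_ge0.
exact: ltW.
Qed.

Lemma ratioR_le (g : ('I_n -> R[i]) -> R[i]) (j : 'I_n -> nat) : Hpa a p g ->
  ratioR a p p' g (monomial j) <= Cp p p' `^ (n%:R / 2).
Proof.
move=> hg; rewrite /ratioR.
have := pairing_bound j hg.
have : 0 <= pnorm a p g * pnorm a p' (monomial j) by rewrite mulr_ge0// powR_ge0.
move: (pnorm a p g * _) => d d0 H.
have rC : ratio j <= Cp p p' `^ (n%:R / 2).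
  apply: (@le_trans _ _ (\prod_(i < n) Cp p p' `^ 2^-1)).
    apply: ler_prod => i _; rewrite moment_ratio_le// andbT.
    exact/ltW/moment_ratio_gt0.
  by rewrite prodr_const card_ord -powR_mulrn ?powR_ge0// -powRrM mulrC.
(* A vanishing denominator makes the quotient [0] by the convention for division. *)
have [->|dn0] := eqVneq d 0; first by rewrite invr0 mulr0 powR_ge0.
rewrite ler_pdivrMr; last by rewrite lt_def dn0.
by apply: le_trans H _; rewrite ler_wpM2r.
Qed.

Lemma ratioR_monomial (j : 'I_n -> nat) :
  ratioR a p p' (monomial j) (monomial j) = ratio j.
Proof.
have ih : (gintE a (EFin \o (fun z : 'I_n -> R[i] => (hmod j z `^ 2)%R)) < +oo)%E.
  by rewrite (gintE_hmod_powR j a0 (ler0n _ 2)) ltry.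
have mh := cmeasurable_powR 2 (@cmeasurable_hmod R n j).
have h0 (z : 'I_n -> R[i]) : 0 <= hmod j z `^ 2 by exact: powR_ge0.
have gh : gintegrable a (fun z => hmod j z `^ 2).
  split=> //; rewrite (_ : (fun z => _) = EFin \o (fun z : 'I_n -> R[i] => hmod j z `^ 2))//.
  by apply/funext => z /=; rewrite ger0_norm.
have cc (w : R[i]) : w * w^* = (cabs w ^+ 2)%:C.
  rewrite sqr_cabs; case: w => x y; apply/eqP; rewrite eq_complex/=.
  by apply/andP; split; apply/eqP; ring.
have E (z : 'I_n -> R[i]) : monomial j z * (monomial j z)^* = (hmod j z `^ 2)%:C.
  by rewrite cc cabs_monomial (powR_mulrn 2) ?hmod_ge0.
rewrite /ratioR; have -> : finner a (monomial j) (monomial j) = (A j)%:C.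
  rewrite /finner /gintC; congr (_ +i* _).
    have -> : (fun z : 'I_n -> R[i] => complex.Re (monomial j z * (monomial j z)^*)) =
        (fun z => hmod j z `^ 2) by apply/funext => z; rewrite E.
    rewrite (gintR_ge0E a0 mh h0 ih).
    by apply: etrans (congr1 fine (gintE_hmod_powR j a0 (ler0n _ 2))) _.
  have -> : (fun z : 'I_n -> R[i] => complex.Im (monomial j z * (monomial j z)^*)) =
      (fun z => 0 * hmod j z `^ 2) by apply/funext => z; rewrite E mul0r.
  by rewrite (gintRZ a0 0 gh) mul0r.
have -> : cabs (A j)%:C = A j.
  by rewrite /cabs/= expr0n addr0 sqrtr_sqr ger0_norm// ltW.
by rewrite ratioE (pnorm_monomial j p0) (pnorm_monomial j p'0).
Qed.

End FockPairing.

Local Close Scope complex_scope.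
Local Open Scope classical_set_scope.

Theorem theorem1p6 (R : realType) (n : nat) (alpha p p' : R) :
  (0 < n)%N -> 0 < alpha -> 1 < p -> p^-1 + p'^-1 = 1 ->
  sup [set r : R | exists (g : ('I_n -> R[i]) -> R[i]) (j : 'I_n -> nat),
         [/\ Hpa alpha p g, g <> (fun _ => 0) &
             r = ratioR alpha p p' g (monomial j)]]
  = Cp p p' `^ (n%:R / 2).
Proof.
move=> n0 a0 p1 pp'; set E := [set r | _].
have p0 : 0 < p by lra.
have Emon (j : 'I_n -> nat) : E (\prod_(i < n) moment_ratio alpha p p' (j i)%:R).
  exists (monomial j), j; split; [exact: Hpa_monomial|exact: monomial_neq0|].
  by rewrite ratioR_monomial.
have Eub : ubound E (Cp p p' `^ (n%:R / 2)).
  by move=> r [g [j [hg _ ->]]]; exact: ratioR_le.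
apply/eqP; rewrite eq_le; apply/andP; split.
  by apply: ge_sup Eub; exists (\prod_(i < n) moment_ratio alpha p p' 0%:R); exact: (Emon (fun=> 0%N)).
have C0 : 0 < Cp p p' `^ (n%:R / 2) by rewrite powR_gt0// (Cp_gt0 p1 pp').
apply/ler_addgt0Pr => e e0.
have nR : (0 : R) < n%:R by rewrite ltr0n.
(* Each of the [n] coordinates loses a factor [e^(-d)] with this [d]; with [C] the claimed supremum,
   the total loss [C (1 - e^(- n d))] is at most [C n d], the allowed error. *)
have d0 : 0 < e / (n%:R * Cp p p' `^ (n%:R / 2)) by rewrite divr_gt0// mulr_gt0.
have [k Hk] := moment_ratio_near a0 p1 pp' d0.
(* The near-extremal pair is a monomial with the same large exponent in every coordinate, paired
   with itself. *)
have := @ub_le_sup _ E _ _ (Emon (fun=> k)).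
rewrite prodr_const card_ord => /(_ _)/wrap[|S]; first by exists (Cp p p' `^ (n%:R / 2)).
have CE : (Cp p p' `^ 2^-1) ^+ n = Cp p p' `^ (n%:R / 2).
  by rewrite -powR_mulrn ?powR_ge0// -powRrM mulrC.
have : expR (- (e / Cp p p' `^ (n%:R / 2))) * Cp p p' `^ (n%:R / 2) <= sup E.
  apply: le_trans S; rewrite -{2}CE.
  have -> : - (e / Cp p p' `^ (n%:R / 2)) = n%:R * - (e / (n%:R * Cp p p' `^ (n%:R / 2))).
    by move: (Cp _ _ `^ _) C0 => C C0; field; rewrite !gt_eqF.
  rewrite expRM_natl -exprMn lerXn2r// nnegrE.
    by rewrite mulr_ge0 ?expR_ge0 ?powR_ge0.
  by apply: le_trans Hk; rewrite mulr_ge0 ?expR_ge0 ?powR_ge0.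
move: (Cp _ _ `^ _) (sup E) C0 => C s C0 H.
have := expR_ge1Dx (- (e / C)) => /(ler_wpM2r (ltW C0)).
by rewrite mulrDl mul1r mulNr divfK ?gt_eqF//; lra.
Qed.
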